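(* There exist universal constants $c>0$ and $K>0$ such that the following holds for the MonadBFT protocol (specified in the context). If all $n=3f+1$ validators are correct, then for every time interval $[\tau_1,\tau_2]$ with $\tau_1>\mathrm{GST}+4\Theta_{view}+4\delta$ and $\tau_2-\tau_1\ge K\delta$, each correct validator commits at least $c\,\frac{\tau_2-\tau_1}{\delta}$ blocks during $[\tau_1,\tau_2]$. (That is: for $\tau_2-\tau_1\in\omega(\delta)$, each correct validator commits $\Omega\big(\frac{\tau_2-\tau_1}{\delta}\big)$ blocks.)
   Context: MODEL. There are $n=3f+1$ validators; correct validators follow the protocol (up to $f$ validators may in general be Byzantine). Channels are point-to-point, authenticated and reliable. The network is partially synchronous: there are an unknown time GST and a known $\Delta>0$ such that a message sent at time $\tau$ between correct validators is delivered by $\max(\tau,\mathrm{GST})+\Delta$; $\delta$, $0<\delta\le\Delta$, denotes the actual network delay, i.e. such messages are in fact delivered by $\max(\tau,\mathrm{GST})+\delta$. Local clocks may drift before GST and are accurate after GST. All correct validators start the protocol before GST. ''Broadcast'' means send to all validators (including oneself). Local computation takes no time. Signatures and aggregate signatures are unforgeable; the hash function $H$ is treated as collision-free. An aggregate of $2f+1$ signatures means signatures of $2f+1$ distinct validators. Views are positive integers; leaders are assigned round-robin over the $n$ validators. A validator stores all proposals it receives; on obtaining a QC it is assumed also to obtain the proposal the QC points to (and ancestors as needed). $\bot$ denotes an absent field. A correct leader issues at most one proposal per view. Parameters: $\kappa\ge1$, $\Theta_{interval}$, $\Theta_{recovery}=(\lceil n/\kappa\rceil-1)\cdot\Theta_{interval}+2\Delta$,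 $\Theta_{view}=3\Delta+\Theta_{recovery}+3\Delta$. DATA. Block $B=\langle block\_view, payload, payload\_hash, qc, block\_hash\rangle$ with $block\_hash=H(block\_view,payload\_hash,qc)$; its header is $B$ without $payload$. Vote $\langle view, block\_hash, proposal\_id,\sigma\rangle$, valid if $proposal\_id=H(block\_hash,view)$ and $\sigma$ is a valid signature on the other fields. QC $\langle view, block\_hash, proposal\_id,\Sigma\rangle$, valid if $proposal\_id=H(block\_hash,view)$ and $\Sigma$ aggregates $2f+1$ signatures on the other fields; it points to any proposal with the same $proposal\_id$. Proposal $p=\langle view, proposal\_id, block,\sigma,tc,nec\rangle$ with $proposal\_id=H(block.block\_hash,view)$, $\sigma$ the leader's signature on $proposal\_id$ ($tc,nec$ possibly $\bot$). The tip of $p$ is $p$ with its block replaced by the block header. Timeout message $M=\langle view, tip, tip\_vote, qc, last\_cer,\sigma\rangle$. Timeout certificate (TC) $\langle view, tips\_views, high\_tip, qcs\_views, high\_qc,\Sigma\rangle$, where $tips\_views,qcs\_views$ give for each of $2f+1$ contributing validators the view of the reported tip ($\bot$, counted as $0$ in maxima, if it reported a QC) and the view of the reported QC (of the QC in the tip's header if it reported a tip). No-endorsement certificate (NEC) $\langle view, high\_tip\_qc\_view,\Sigma\rangle$. There are a genesis block and a genesis tip and genesis QC of view $0$, valid without signatures; initially they are $local\_tip$ and $last\_qc$. VALIDITY. A header is valid if its $qc$ is valid and its $block\_hash$ is correct; a block is valid if additionally $payload\_hash=H(payload)$. fresh($p$): $p.block.qc.view=p.view-1$, or $p.nec\ne\bot$,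 or ($p.tc\neq\bot$ and $p.tc.high\_qc\ne\bot$). Valid fresh tip $T$: valid header, correct $proposal\_id$, $\sigma$ by the leader of $T.view$, $header.block\_view=T.view>header.qc.view$, and: if $T.view=header.qc.view+1$ then $T.tc=T.nec=\bot$; otherwise $T.tc\neq\bot$ is valid with $T.view=T.tc.view+1$, and either ($T.nec=\bot$, $T.tc.high\_qc\ne\bot$ and $header.qc=T.tc.high\_qc$) or ($T.nec$ is valid, $T.view=T.nec.view$ and $header.qc.view=T.nec.high\_tip\_qc\_view$). Valid proposal $p$: valid block, correct $proposal\_id$, $\sigma$ by the leader of $p.view$, $p.view\ge p.block.block\_view$, $p.view>p.block.qc.view$, and: if fresh($p$), the tip of $p$ is a valid fresh tip; otherwise (''reproposal'') $p.view>p.block.block\_view$, $p.tc\neq\bot$ is valid, $p.view=p.tc.view+1$, $p.tc.high\_tip\ne\bot$, and the header of $p.block$ equals $p.tc.high\_tip$'s header. (So a valid proposal is fresh iff $p.view=p.block.block\_view$.) Valid timeout message $M$: $last\_cer$ is a valid QC or TC with $last\_cer.view=M.view-1$; exactly one of $tip,qc$ is non-$\bot$; if $tip\neq\bot$: $tip\_vote$ is a valid vote with $tip\_vote.view=M.view$, $tip$ is a valid fresh tip with $tip.view\le M.view$, $\sigma$ signs $(M.view,tip.view,tip.header.qc.view)$; if $qc\ne\bot$: $qc$ is valid, $qc.view<M.view$, $\sigma$ signs $(M.view,\bot,qc.view)$. Valid TC $tc$: $\Sigma$ aggregates $2f+1$ timeout signatures certifying $view,tips\_views,qcs\_views$; and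 either ($high\_qc\ne\bot$ is valid, $high\_tip=\bot$, $high\_qc.view<tc.view$, $\max(tips\_views)\le high\_qc.view=\max(qcs\_views)$) or ($high\_qc=\bot$, $high\_tip$ is a valid fresh tip, $high\_tip.view\le tc.view$, $qcs\_views[i]<tips\_views[i]$ whenever $tips\_views[i]\ne\bot$, no $tips\_views[i]>high\_tip.view$, no $i$ with $tips\_views[i]=high\_tip.view$ and $qcs\_views[i]>high\_tip.header.qc.view$, and $high\_tip.view>\max(qcs\_views)$). Valid NEC: $high\_tip\_qc\_view<view-1$ and $\Sigma$ aggregates $2f+1$ signatures on $(view,high\_tip\_qc\_view)$. LOCAL STATE of validator $i$: $cur\_view$, $local\_tip$, $highest\_voted\_view$, $last\_qc$, $last\_tc$, collected votes and timeouts, and a timer. At start every validator performs Enter(genesis QC), entering view $1$, and the leader of view 1 performs ProposeQC(genesis QC). PROCEDURES. Enter($c$) ($c$ a QC or TC): if $c.view\ge cur\_view$, set $cur\_view:=c.view+1$, restart the timer, and set $last\_qc:=c$ (QC) or $last\_tc:=c$ (TC). Commit($qc$): let $parent$ be the proposal $qc$ points to and $gp$ the proposal $parent.block.qc$ points to; if fresh($parent$), speculatively commit $parent.block$; if $qc.view=parent.block.qc.view+1$, commit $gp.block$ (and all its ancestors). ProposeQC($qc$): broadcast a proposal for $cur\_view$ with a new block $B$, $B.block\_view=cur\_view$, $B.qc=qc$, and $tc=nec=\bot$. ProposeTC($tc$): if $tc.high\_qc\neq\bot$, broadcast a proposal for $cur\_view$ with a new block with $qc=tc.high\_qc$, this $tc$,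 $nec=\bot$; else if the block of $tc.high\_tip$ is available, broadcast a proposal for $cur\_view$ containing that same block, this $tc$, $nec=\bot$; else run Recover($tc$): if it returns a proposal, repropose its block as before; if it returns an NEC, broadcast a proposal with a new block with $qc=tc.high\_tip.header.qc$, this $tc$, and this $nec$. Recover($tc$): broadcast $\langle\mathsf{NERequest},tc\rangle$, send $\langle\mathsf{ProposalRequest},tc\rangle$ to $\kappa$ validators and, every $\Theta_{interval}$ time, to $\kappa$ further ones; return the first received proposal with $proposal\_id=tc.high\_tip.proposal\_id$, or an NEC with view $tc.view+1$ and $high\_tip\_qc\_view=tc.high\_tip.header.qc.view$ once $2f+1$ validators sent valid NE signatures on this pair; abort if Recover is called for a higher view. BroadcastQC($qc$): broadcast $qc$ if not yet done. HANDLERS (messages of a view smaller than indicated, or invalid, are ignored). (1) On a valid proposal $p$ from the leader of $p.view\ge cur\_view$: Enter($p.tc$) if $p.tc\ne\bot$, else Enter($p.block.qc$); if $p.block.qc.view=p.view-1$, then BroadcastQC($p.block.qc$) if $i$ is the leader of view $p.block.qc.view$, and send $p.block.qc$ to that leader; Commit($p.block.qc$); if $p.view>highest\_voted\_view$: set $local\_tip$ to the tip of $p$ if fresh($p$) and to $p.tc.high\_tip$ otherwise, send a vote for ($cur\_view$, block hash of $local\_tip$) to the leaders of views $cur\_view$ and $cur\_view+1$, and set $highest\_voted\_view:=cur\_view$. (2) On a valid vote with view $v\ge cur\_view$, if $i$ leads $v$ or $v+1$: once $2f+1$ votes with the same $proposal\_id$ are collected, form the QC $qc$; Enter($qc$);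 Commit($qc$); BroadcastQC($qc$) if $i$ leads $v$, else ProposeQC($qc$). (3) On a valid QC $qc$ from $j$ with $qc.view\ge cur\_view$: if $j$ leads $qc.view$: Enter($qc$), Commit($qc$), send $qc$ to the leader of $qc.view+1$; if $i$ leads $qc.view$: BroadcastQC($qc$); if $i$ leads $qc.view+1$: Enter($qc$), Commit($qc$), ProposeQC($qc$). (4) On timing out in $cur\_view=v$ (at most once per view; when the timer reaches $\Theta_{view}$ or when triggered in (5)): $highest\_voted\_view:=v$; broadcast a timeout message for view $v$ with $last\_cer=last\_qc$ if $last\_qc.view=v-1$ and $last\_cer=last\_tc$ otherwise; if $local\_tip.view\le last\_qc.view$ it has $qc=last\_qc$, $tip=tip\_vote=\bot$; otherwise $tip=local\_tip$, $tip\_vote$ a vote for ($v$, block hash of $local\_tip$), $qc=\bot$. (5) On a valid timeout message $M$ with $M.view\ge cur\_view$: let $c=M.last\_cer$; if $c$ is a TC and $i$ has broadcast neither a timeout message nor a TC for $c.view$, broadcast $c$; Enter($c$); if $i$ leads $c.view+1$ and has issued no proposal for it, ProposeQC($c$) or ProposeTC($c$) according to the type of $c$; if $c$ is a QC: BroadcastQC($c$) if $i$ leads $c.view$, send $c$ to the leaders of $c.view$ and $c.view+1$, Commit($c$). Then: if $M.tip\neq\bot$, record $M.tip\_vote$; if $2f+1$ tip votes with the same $proposal\_id$ are recorded, form the QC $qc$, Enter($qc$), Commit($qc$), ProposeQC($qc$) if $i$ leads $qc.view+1$, and stop. Otherwise record $M$; when $f+1$ timeout messages for $M.view$ are recorded,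 trigger the timeout of view $M.view$ if not yet triggered; when $2f+1$ are recorded, form a TC $tc$ (with $high\_tip$ the reported tip of highest view, ties broken by highest $header.qc.view$, if this view exceeds all reported QC views; otherwise with $high\_qc$ the highest reported QC), Enter($tc$), and ProposeTC($tc$) if $i$ leads $tc.view+1$. (6) On a valid TC $tc$ with $tc.view\ge cur\_view$: Enter($tc$); broadcast $tc$ if no TC and no timeout message was broadcast for $tc.view$; ProposeTC($tc$) if $i$ leads $tc.view+1$. (7) On $\langle\mathsf{ProposalRequest},tc\rangle$ or $\langle\mathsf{NERequest},tc\rangle$ from the leader of $tc.view+1\ge cur\_view$, with $tc$ valid and $tc.high\_tip\neq\bot$: Enter($tc$); for a ProposalRequest, if $i$ has a proposal with $proposal\_id=tc.high\_tip.proposal\_id$, send it to that leader; for an NERequest, if $i$ has not voted for a proposal with that $proposal\_id$ and has sent no NE message in view $tc.view+1$, send that leader an NE signature on $(tc.view+1,tc.high\_tip.header.qc.view)$. TERMINOLOGY. Block $B_1$ is the parent of $B_2$ if some proposal $p$ has $p.block=B_1$ and $p.proposal\_id=B_2.qc.proposal\_id$; ancestors are defined by iterating the parent relation. Committing a block commits all its ancestors (those not already committed).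
   Formalization: The formal theorem assumes f ≥ 1; for f = 0 (a single validator leading every view) the claim fails: after forming a QC it only broadcasts it, proposes nothing until a timeout, and then never obtains QCs of consecutive views, so it commits no new blocks. *)

(* Defs.v *)
From HB Require Import structures.
From mathcomp Require Import all_boot all_order all_algebra.
From mathcomp Require Import boolp reals.

Set Implicit Arguments.
Unset Strict Implicit.
Unset Printing Implicit Defensive.

Import Order.TTheory GRing.Theory Num.Theory.

(* MonadBFT with n = 3f+1 validators, all of them correct,
   over a partially synchronous network.  Views are natural numbers, 0 being
   the genesis view.  An absent field is [None]. *)

Section MonadBFT.

Variables (R : realType) (f : nat) (Payload Hash : eqType).

Local Notation validator := 'I_(3 * f).+1.

Definition quorum : nat := (2 * f).+1.

Definition leader (v : nat) : validator := inord (v %% (3 * f).+1).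

(* Signatures are symbolic: a signature is the pair of its signer and of the
   signed fields.  Since every message comes from a correct validator, and the
   protocol below only ever creates [Sig i _] at validator [i], no signature is
   forged.  An aggregate signature is the list of the aggregated ones. *)
Inductive content :=
| OnProposal of Hash                       (* proposal_id *)
| OnVote of nat & Hash & Hash              (* view, block_hash, proposal_id *)
| OnTimeout of nat & option nat & nat      (* view, tip view, qc view *)
| OnNE of nat & nat.                       (* view, high_tip_qc_view *)
HB.instance Definition _ := gen_eqMixin content.

Record signature := Sig { signer : validator; signed : content }.
HB.instance Definition _ := gen_eqMixin signature.

Record qc := QC {
  qc_view : nat; qc_block_hash : Hash; qc_id : Hash; qc_agg : seq signature }.
HB.instance Definition _ := gen_eqMixin qc.

Record header := Header {
  h_view : nat; h_payload_hash : Hash; h_qc : qc; h_hash : Hash }.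
HB.instance Definition _ := gen_eqMixin header.

Record block := Block { b_header : header; b_payload : Payload }.
HB.instance Definition _ := gen_eqMixin block.

Record vote := Vote {
  vt_view : nat; vt_block_hash : Hash; vt_id : Hash; vt_sig : signature }.
HB.instance Definition _ := gen_eqMixin vote.

Record nec := NEC { nec_view : nat; nec_qc_view : nat; nec_agg : seq signature }.
HB.instance Definition _ := gen_eqMixin nec.

(* [Tip view proposal_id header sigma tc nec] and
   [TC view tips_views high_tip qcs_views high_qc Sigma]; the lists
   [tips_views], [qcs_views] and [Sigma] of a TC are indexed alike, by the
   contributing validators. *)
Inductive tip :=
  Tip of nat & Hash & header & signature & option tc & option nec
with tc :=
  TC of nat & seq (option nat) & option tip & seq nat & option qc & seq signature.
HB.instance Definition _ := gen_eqMixin tip.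
HB.instance Definition _ := gen_eqMixin tc.

Definition tip_view T := let: Tip v _ _ _ _ _ := T in v.
Definition tip_id T := let: Tip _ id _ _ _ _ := T in id.
Definition tip_header T := let: Tip _ _ h _ _ _ := T in h.
Definition tip_qc_view T := qc_view (h_qc (tip_header T)).
Definition tc_view c := let: TC v _ _ _ _ _ := c in v.
Definition tc_high_tip c := let: TC _ _ T _ _ _ := c in T.
Definition tc_high_qc c := let: TC _ _ _ _ q _ := c in q.

Record proposal := Proposal {
  p_view : nat; p_id : Hash; p_block : block; p_sig : signature;
  p_tc : option tc; p_nec : option nec }.
HB.instance Definition _ := gen_eqMixin proposal.

Definition p_header p := b_header (p_block p).
Definition p_qc p := h_qc (p_header p).
Definition tip_of p :=
  Tip (p_view p) (p_id p) (p_header p) (p_sig p) (p_tc p) (p_nec p).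

Inductive cert := CertQC of qc | CertTC of tc.
Definition cert_view c :=
  match c with CertQC q => qc_view q | CertTC t => tc_view t end.

Record timeout := Timeout {
  m_view : nat; m_tip : option tip; m_tip_vote : option vote;
  m_qc : option qc; m_last_cer : cert; m_sig : signature }.

Inductive msg :=
| MProposal of proposal
| MVote of vote
| MQC of qc
| MTimeout of timeout
| MTC of tc
| MNERequest of tc
| MProposalRequest of tc
| MNE of signature.
HB.instance Definition _ := gen_eqMixin msg.

Inductive hash_input :=
| HPayload of Payload
| HBlock of nat & Hash & qc
| HProposal of Hash & nat.

(* [new_payload v] is the payload of the new block, if any, made by the leader
   of view [v] (it makes at most one).  [request_order c] is the order in which
   [Recover(c)] contacts the validators.  [clock i t] is the reading of the
   local clock of [i] at real time [t]. *)
Record setting := Setting {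
  hash : hash_input -> Hash;
  genesis_payload : Payload;
  new_payload : nat -> Payload;
  request_order : tc -> seq validator;
  kappa : nat;
  Theta_interval : R;
  Delta : R;
  delta : R;
  GST : R;
  clock : validator -> R -> R }.

Record setting_ok (S : setting) : Prop := SettingOk {
  hash_collision_free : injective (hash S);
  request_order_enum : forall c, perm_eq (request_order S c) (enum 'I_(3 * f).+1);
  kappa_ge1 : 0 < kappa S;
  Theta_interval_ge0 : (0 <= Theta_interval S)%R;
  delta_gt0 : (0 < delta S)%R;
  delta_le_Delta : (delta S <= Delta S)%R;
  clock_monotone : forall i x y, (x <= y)%R -> (clock S i x <= clock S i y)%R;
  clock_accurate : forall i x y, (GST S <= x)%R -> (x <= y)%R ->
    (clock S i y - clock S i x = y - x)%R }.

Variable S : setting.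

Local Notation H := (hash S).

(* ceil (n / kappa) - 1 *)
Definition further_rounds : nat :=
  (((3 * f).+1 + kappa S).-1 %/ kappa S).-1.
Definition Theta_recovery : R :=
  (further_rounds%:R * Theta_interval S + 2 * Delta S)%R.
Definition Theta_view : R := (3 * Delta S + Theta_recovery + 3 * Delta S)%R.

(* The genesis block has no parent: its [qc] field is a dummy, whose id is not
   a proposal id as [H] is injective. *)
Definition genesis_header : header :=
  let ph := H (HPayload (genesis_payload S)) in
  let q := QC 0 ph ph [::] in
  Header 0 ph q (H (HBlock 0 ph q)).
Definition genesis_block := Block genesis_header (genesis_payload S).
Definition genesis_id : Hash := H (HProposal (h_hash genesis_header) 0).
Definition genesis_qc := QC 0 (h_hash genesis_header) genesis_id [::].
Definition genesis_proposal :=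
  Proposal 0 genesis_id genesis_block (Sig (leader 0) (OnProposal genesis_id))
    None None.
Definition genesis_tip := tip_of genesis_proposal.

Definition valid_agg (x : content) (Sigma : seq signature) : bool :=
  [&& size Sigma == quorum, uniq (map signer Sigma)
    & all (fun sg => signed sg == x) Sigma].

Definition valid_vote (w : vote) : bool :=
  (vt_id w == H (HProposal (vt_block_hash w) (vt_view w))) &&
  (signed (vt_sig w) == OnVote (vt_view w) (vt_block_hash w) (vt_id w)).

Definition valid_qc (q : qc) : bool :=
  (q == genesis_qc) ||
  (qc_id q == H (HProposal (qc_block_hash q) (qc_view q))) &&
  valid_agg (OnVote (qc_view q) (qc_block_hash q) (qc_id q)) (qc_agg q).

Definition valid_nec (e : nec) : bool :=
  ((nec_qc_view e).+1 < nec_view e) &&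
  valid_agg (OnNE (nec_view e) (nec_qc_view e)) (nec_agg e).

Definition valid_header (h : header) : bool :=
  (h == genesis_header) ||
  valid_qc (h_qc h) &&
  (h_hash h == H (HBlock (h_view h) (h_payload_hash h) (h_qc h))).

Definition valid_block (b : block) : bool :=
  valid_header (b_header b) &&
  (h_payload_hash (b_header b) == H (HPayload (b_payload b))).

Definition max_views (s : seq nat) : nat := \max_(v <- s) v.

Fixpoint valid_tip (T : tip) : bool :=
  let: Tip v id h sg otc onec := T in
  (T == genesis_tip) ||
  [&& valid_header h,
      id == H (HProposal (h_hash h) v),
      sg == Sig (leader v) (OnProposal id),
      h_view h == v,
      qc_view (h_qc h) < v
    & if v == (qc_view (h_qc h)).+1 then (otc == None) && (onec == None)
      else match otc with
           | None => false
           | Some c =>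
             [&& valid_tc c, v == (tc_view c).+1
               & match onec with
                 | None => tc_high_qc c == Some (h_qc h)
                 | Some e => [&& valid_nec e, v == nec_view e
                               & qc_view (h_qc h) == nec_qc_view e]
                 end]
           end]
with valid_tc (c : tc) : bool :=
  let: TC v tvs oT qvs oq Sigma := c in
  [&& size Sigma == quorum, uniq (map signer Sigma),
      size tvs == quorum, size qvs == quorum,
      map signed Sigma == [seq OnTimeout v x.1 x.2 | x <- zip tvs qvs]
    & match oq, oT with
      | Some q, None =>
        [&& valid_qc q, qc_view q < v,
            max_views (map (odflt 0) tvs) <= qc_view q
          & qc_view q == max_views qvs]
      | None, Some T =>
        [&& valid_tip T, tip_view T <= v,
            all (fun x => if x.1 is Some tv
                          then [&& x.2 < tv, tv <= tip_view T
                                 & (tv == tip_view T) ==> (x.2 <= tip_qc_view T)]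
                          else true)
                (zip tvs qvs)
          & max_views qvs < tip_view T]
      | _, _ => false
      end].

Definition fresh (p : proposal) : bool :=
  [|| (qc_view (p_qc p)).+1 == p_view p, isSome (p_nec p)
    | if p_tc p is Some c then isSome (tc_high_qc c) else false].

Definition valid_proposal (p : proposal) : bool :=
  [&& valid_block (p_block p),
      p_id p == H (HProposal (h_hash (p_header p)) (p_view p)),
      p_sig p == Sig (leader (p_view p)) (OnProposal (p_id p)),
      h_view (p_header p) <= p_view p,
      qc_view (p_qc p) < p_view p
    & if fresh p then valid_tip (tip_of p)
      else (h_view (p_header p) < p_view p) &&
           match p_tc p with
           | None => false
           | Some c => [&& valid_tc c, p_view p == (tc_view c).+1
                         & omap tip_header (tc_high_tip c) == Some (p_header p)]
           end].

Definition valid_cert (c : cert) : bool :=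
  match c with CertQC q => valid_qc q | CertTC t => valid_tc t end.

Definition valid_timeout (M : timeout) : bool :=
  [&& valid_cert (m_last_cer M),
      (cert_view (m_last_cer M)).+1 == m_view M
    & match m_tip M, m_qc M with
      | Some T, None =>
        [&& (if m_tip_vote M is Some w
             then valid_vote w && (vt_view w == m_view M) else false),
            valid_tip T, tip_view T <= m_view M
          & signed (m_sig M) ==
            OnTimeout (m_view M) (Some (tip_view T)) (tip_qc_view T)]
      | None, Some q =>
        [&& valid_qc q, qc_view q < m_view M
          & signed (m_sig M) == OnTimeout (m_view M) None (qc_view q)]
      | _, _ => false
      end].

(* A running call of [Recover(rec_tc)]: [rec_rounds] groups of [kappa]
   validators have been contacted, the last one at real time [rec_time]. *)
Record recovery := Recovery { rec_tc : tc; rec_rounds : nat; rec_time : R }.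
HB.instance Definition _ := gen_eqMixin recovery.

Record lstate := LState {
  cur_view : nat;  (* 0 before the start *)
  timer_start : R;  (* real time of the last restart; see [elapsed] *)
  local_tip : tip;
  highest_voted_view : nat;
  last_qc : qc;
  last_tc : option tc;
  proposals : seq proposal;  (* in order of reception *)
  votes : seq vote;
  tip_votes : seq vote;
  timeouts : seq timeout;  (* recorded, one per view and signer *)
  ne_sigs : seq signature;  (* NE signatures received *)
  broadcasts : seq msg;  (* messages broadcast so far by this validator *)
  voted_ids : seq Hash;  (* proposal ids of all votes and tip votes sent *)
  ne_views : seq nat;  (* views in which an NE signature was sent *)
  recoveries : seq recovery;
  speculative : seq block;  (* speculatively committed blocks *)
  committed : seq block
}.

Definition set_cur_view (x : nat) (s : lstate) : lstate :=
  LState x (timer_start s) (local_tip s) (highest_voted_view s)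
    (last_qc s) (last_tc s) (proposals s) (votes s) (tip_votes s)
    (timeouts s) (ne_sigs s) (broadcasts s) (voted_ids s) (ne_views s)
    (recoveries s) (speculative s) (committed s).
Definition set_timer_start (x : R) (s : lstate) : lstate :=
  LState (cur_view s) x (local_tip s) (highest_voted_view s) (last_qc s)
    (last_tc s) (proposals s) (votes s) (tip_votes s) (timeouts s)
    (ne_sigs s) (broadcasts s) (voted_ids s) (ne_views s) (recoveries s)
    (speculative s) (committed s).
Definition set_local_tip (x : tip) (s : lstate) : lstate :=
  LState (cur_view s) (timer_start s) x (highest_voted_view s) (last_qc s)
    (last_tc s) (proposals s) (votes s) (tip_votes s) (timeouts s)
    (ne_sigs s) (broadcasts s) (voted_ids s) (ne_views s) (recoveries s)
    (speculative s) (committed s).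
Definition set_highest_voted_view (x : nat) (s : lstate) : lstate :=
  LState (cur_view s) (timer_start s) (local_tip s) x (last_qc s)
    (last_tc s) (proposals s) (votes s) (tip_votes s) (timeouts s)
    (ne_sigs s) (broadcasts s) (voted_ids s) (ne_views s) (recoveries s)
    (speculative s) (committed s).
Definition set_last_qc (x : qc) (s : lstate) : lstate :=
  LState (cur_view s) (timer_start s) (local_tip s) (highest_voted_view s)
    x (last_tc s) (proposals s) (votes s) (tip_votes s) (timeouts s)
    (ne_sigs s) (broadcasts s) (voted_ids s) (ne_views s) (recoveries s)
    (speculative s) (committed s).
Definition set_last_tc (x : option tc) (s : lstate) : lstate :=
  LState (cur_view s) (timer_start s) (local_tip s) (highest_voted_view s)
    (last_qc s) x (proposals s) (votes s) (tip_votes s) (timeouts s)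
    (ne_sigs s) (broadcasts s) (voted_ids s) (ne_views s) (recoveries s)
    (speculative s) (committed s).
Definition set_proposals (x : seq proposal) (s : lstate) : lstate :=
  LState (cur_view s) (timer_start s) (local_tip s) (highest_voted_view s)
    (last_qc s) (last_tc s) x (votes s) (tip_votes s) (timeouts s)
    (ne_sigs s) (broadcasts s) (voted_ids s) (ne_views s) (recoveries s)
    (speculative s) (committed s).
Definition set_votes (x : seq vote) (s : lstate) : lstate :=
  LState (cur_view s) (timer_start s) (local_tip s) (highest_voted_view s)
    (last_qc s) (last_tc s) (proposals s) x (tip_votes s) (timeouts s)
    (ne_sigs s) (broadcasts s) (voted_ids s) (ne_views s) (recoveries s)
    (speculative s) (committed s).
Definition set_tip_votes (x : seq vote) (s : lstate) : lstate :=
  LState (cur_view s) (timer_start s) (local_tip s) (highest_voted_view s)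
    (last_qc s) (last_tc s) (proposals s) (votes s) x (timeouts s)
    (ne_sigs s) (broadcasts s) (voted_ids s) (ne_views s) (recoveries s)
    (speculative s) (committed s).
Definition set_timeouts (x : seq timeout) (s : lstate) : lstate :=
  LState (cur_view s) (timer_start s) (local_tip s) (highest_voted_view s)
    (last_qc s) (last_tc s) (proposals s) (votes s) (tip_votes s) x
    (ne_sigs s) (broadcasts s) (voted_ids s) (ne_views s) (recoveries s)
    (speculative s) (committed s).
Definition set_ne_sigs (x : seq signature) (s : lstate) : lstate :=
  LState (cur_view s) (timer_start s) (local_tip s) (highest_voted_view s)
    (last_qc s) (last_tc s) (proposals s) (votes s) (tip_votes s)
    (timeouts s) x (broadcasts s) (voted_ids s) (ne_views s)
    (recoveries s) (speculative s) (committed s).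
Definition set_broadcasts (x : seq msg) (s : lstate) : lstate :=
  LState (cur_view s) (timer_start s) (local_tip s) (highest_voted_view s)
    (last_qc s) (last_tc s) (proposals s) (votes s) (tip_votes s)
    (timeouts s) (ne_sigs s) x (voted_ids s) (ne_views s) (recoveries s)
    (speculative s) (committed s).
Definition set_voted_ids (x : seq Hash) (s : lstate) : lstate :=
  LState (cur_view s) (timer_start s) (local_tip s) (highest_voted_view s)
    (last_qc s) (last_tc s) (proposals s) (votes s) (tip_votes s)
    (timeouts s) (ne_sigs s) (broadcasts s) x (ne_views s) (recoveries s)
    (speculative s) (committed s).
Definition set_ne_views (x : seq nat) (s : lstate) : lstate :=
  LState (cur_view s) (timer_start s) (local_tip s) (highest_voted_view s)
    (last_qc s) (last_tc s) (proposals s) (votes s) (tip_votes s)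
    (timeouts s) (ne_sigs s) (broadcasts s) (voted_ids s) x (recoveries s)
    (speculative s) (committed s).
Definition set_recoveries (x : seq recovery) (s : lstate) : lstate :=
  LState (cur_view s) (timer_start s) (local_tip s) (highest_voted_view s)
    (last_qc s) (last_tc s) (proposals s) (votes s) (tip_votes s)
    (timeouts s) (ne_sigs s) (broadcasts s) (voted_ids s) (ne_views s) x
    (speculative s) (committed s).
Definition set_speculative (x : seq block) (s : lstate) : lstate :=
  LState (cur_view s) (timer_start s) (local_tip s) (highest_voted_view s)
    (last_qc s) (last_tc s) (proposals s) (votes s) (tip_votes s)
    (timeouts s) (ne_sigs s) (broadcasts s) (voted_ids s) (ne_views s)
    (recoveries s) x (committed s).
Definition set_committed (x : seq block) (s : lstate) : lstate :=
  LState (cur_view s) (timer_start s) (local_tip s) (highest_voted_view s)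
    (last_qc s) (last_tc s) (proposals s) (votes s) (tip_votes s)
    (timeouts s) (ne_sigs s) (broadcasts s) (voted_ids s) (ne_views s)
    (recoveries s) (speculative s) x.

Definition initial_lstate : lstate :=
  LState 0 0%R genesis_tip 0 genesis_qc None [:: genesis_proposal] [::] [::]
    [::] [::] [::] [::] [::] [::] [::] [::].

Definition started (s : lstate) : bool := 0 < cur_view s.

Definition has_proposed (s : lstate) (v : nat) : bool :=
  has (fun m => if m is MProposal p then p_view p == v else false) (broadcasts s).
Definition has_timed_out (s : lstate) (v : nat) : bool :=
  has (fun m => if m is MTimeout M then m_view M == v else false) (broadcasts s).
Definition has_broadcast_tc (s : lstate) (v : nat) : bool :=
  has (fun m => if m is MTC c then tc_view c == v else false) (broadcasts s).

Definition lookup (id : Hash) (ps : seq proposal) : option proposal :=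
  ohead [seq p <- ps | p_id p == id].

(* The proposal with the given id, the one its block's QC points to, and so on,
   up to [fuel] of them; views decrease strictly along this sequence. *)
Fixpoint proposal_chain (ps : seq proposal) (fuel : nat) (id : Hash) :
    seq proposal :=
  if fuel is k.+1 then
    if lookup id ps is Some p then p :: proposal_chain ps k (qc_id (p_qc p))
    else [::]
  else [::].

(* The proposals in [ps] to which [q] leads: the one it points to, followed by
   those of the ancestors. *)
Definition pointed_by (ps : seq proposal) (q : qc) : seq proposal :=
  proposal_chain ps (qc_view q).+1 (qc_id q).

Definition with_ancestors (ps : seq proposal) (b : block) : seq block :=
  b :: map p_block (pointed_by ps (h_qc (b_header b))).

(* An action returns the new state and the messages sent, each with its
   recipient. *)

Definition act := lstate -> lstate * seq (validator * msg).

Definition skip : act := fun s => (s, [::]).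
Definition andthen (a b : act) : act := fun s =>
  let: (s1, o1) := a s in let: (s2, o2) := b s1 in (s2, o1 ++ o2).
Definition update (g : lstate -> lstate) : act := fun s => (g s, [::]).
Definition read (k : lstate -> act) : act := fun s => k s s.
Definition when (b : bool) (a : act) : act := if b then a else skip.

Local Notation "a ;; b" := (andthen a b) (at level 61, right associativity).
Local Notation "'get' s , a" := (read (fun s => a))
  (at level 61, s name, a at level 200).

Definition send (j : validator) (m : msg) : act := fun s => (s, [:: (j, m)]).
Definition broadcast (m : msg) : act := fun s =>
  (set_broadcasts (m :: broadcasts s) s, [seq (j, m) | j <- enum 'I_(3 * f).+1]).

(* Below, validator [i] acts at real time [now]; [issued] are the proposals
   issued so far in the whole system, from which a validator that obtains a QC
   obtains the proposals this QC leads to. *)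

Section Validator.

Variables (i : validator) (now : R) (issued : seq proposal).

Definition obtain (q : qc) : act :=
  update (fun s => set_proposals (proposals s ++ pointed_by issued q) s).

Definition enter (c : cert) : act := get s,
  when (cur_view s <= cert_view c) (
    update (set_cur_view (cert_view c).+1) ;;
    update (set_timer_start now) ;;
    update (match c with CertQC q => set_last_qc q
                       | CertTC t => set_last_tc (Some t) end)).

Definition commit (q : qc) : act := get s,
  if lookup (qc_id q) (proposals s) is Some parent then
    when (fresh parent)
      (update (set_speculative (p_block parent :: speculative s))) ;;
    if lookup (qc_id (p_qc parent)) (proposals s) is Some gp then
      when (qc_view q == (qc_view (p_qc parent)).+1)
        (update (set_committed
           (undup (with_ancestors (proposals s) (p_block gp) ++ committed s))))
    else skip
  else skip.

Definition broadcast_qc (q : qc) : act := get s,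
  when (MQC q \notin broadcasts s) (broadcast (MQC q)).

Definition new_block (v : nat) (q : qc) : block :=
  let ph := H (HPayload (new_payload S v)) in
  Block (Header v ph q (H (HBlock v ph q))) (new_payload S v).

Definition issue (b : block) (otc : option tc) (onec : option nec) : act := get s,
  when (~~ has_proposed s (cur_view s)) (
    let id := H (HProposal (h_hash (b_header b)) (cur_view s)) in
    broadcast (MProposal
      (Proposal (cur_view s) id b (Sig i (OnProposal id)) otc onec))).

Definition propose_qc (q : qc) : act := get s,
  issue (new_block (cur_view s) q) None None.

Definition request_round (c : tc) (k : nat) : act := fun s =>
  (s, [seq (j, MProposalRequest c)
         | j <- take (kappa S) (drop (k * kappa S) (request_order S c))]).

(* The beginning of [Recover(c)]; the further rounds of requests are in
   [recover_tick] and the results in [recover_return].  Calling it again while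
   it is running has no effect. *)
Definition recover (c : tc) : act := get s,
  when (c \notin map rec_tc (recoveries s)) (
    update (set_recoveries (Recovery c 1 now ::
      [seq r <- recoveries s | tc_view c <= tc_view (rec_tc r)])) ;;
    broadcast (MNERequest c) ;;
    request_round c 0).

Definition recover_tick (r : recovery) : act := get s,
  update (set_recoveries
    (Recovery (rec_tc r) (rec_rounds r).+1 now ::
      [seq r' <- recoveries s | rec_tc r' != rec_tc r])) ;;
  request_round (rec_tc r) (rec_rounds r).

Definition propose_tc (c : tc) : act := get s,
  when (~~ has_proposed s (cur_view s))
    match tc_high_qc c, tc_high_tip c with
    | Some q, _ => issue (new_block (cur_view s) q) (Some c) None
    | None, Some T =>
      if ohead [seq p <- proposals s | p_header p == tip_header T] is Some p
      then issue (p_block p) (Some c) None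
      else recover c
    | None, None => skip
    end.

(* The result of [Recover] is used only in the view it was called for. *)
Definition recover_return (r : recovery) : act := get s,
  let c := rec_tc r in
  let return_with a :=
    update (set_recoveries [seq r' <- recoveries s | rec_tc r' != c]) ;;
    when (cur_view s == (tc_view c).+1) a in
  if tc_high_tip c is Some T then
    if lookup (tip_id T) (proposals s) is Some p then
      return_with (issue (p_block p) (Some c) None)
    else
      let sgs := [seq sg <- ne_sigs s
                    | signed sg == OnNE (tc_view c).+1 (tip_qc_view T)] in
      when (quorum <= size sgs)
        (return_with (issue (new_block (cur_view s) (h_qc (tip_header T)))
          (Some c)
          (Some (NEC (tc_view c).+1 (tip_qc_view T) (take quorum sgs)))))
  else skip.

Definition recover_returns : act := get s,
  foldr (fun r a => recover_return r ;; a) skip (recoveries s).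

Definition make_vote (v : nat) (bh : Hash) : vote :=
  let id := H (HProposal bh v) in Vote v bh id (Sig i (OnVote v bh id)).

Definition log_vote (w : vote) : act :=
  update (fun s => set_voted_ids (vt_id w :: voted_ids s) s).

Definition add_vote (w : vote) (ws : seq vote) : seq vote :=
  if w \in ws then ws else rcons ws w.

(* The QC formed by the votes in [ws] with the proposal id of [w], if they are
   numerous enough; as [ws] has no repetition, these have distinct signers. *)
Definition form_qc (w : vote) (ws : seq vote) : option qc :=
  let ws' := [seq w' <- ws | vt_id w' == vt_id w] in
  if quorum <= size ws' then
    Some (QC (vt_view w) (vt_block_hash w) (vt_id w)
             (map vt_sig (take quorum ws')))
  else None.

Definition pick_max (T : Type) (ge : rel T) : seq T -> option T :=
  foldr (fun x o => if o is Some y then Some (if ge x y then x else y)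
                    else Some x) None.

Definition tip_ge (T T' : tip) : bool :=
  (tip_view T' < tip_view T) ||
  (tip_view T == tip_view T') && (tip_qc_view T' <= tip_qc_view T).

Definition reported_qc_view (M : timeout) : nat :=
  match m_tip M, m_qc M with
  | Some T, _ => tip_qc_view T
  | None, Some q => qc_view q
  | None, None => 0
  end.

Definition form_tc (v : nat) (Ms : seq timeout) : tc :=
  let tvs := [seq omap tip_view (m_tip M) | M <- Ms] in
  let qvs := map reported_qc_view Ms in
  let oT := pick_max tip_ge (pmap m_tip Ms) in
  let oq := pick_max (fun q q' => qc_view q' <= qc_view q) (pmap m_qc Ms) in
  if (if oT is Some T then max_views qvs < tip_view T else false)
  then TC v tvs oT qvs None (map m_sig Ms)
  else TC v tvs None qvs oq (map m_sig Ms).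

Definition timeout_view : act := get s,
  let v := cur_view s in
  let q := last_qc s in
  let T := local_tip s in
  let cer := if (qc_view q).+1 == v then CertQC q
             else if last_tc s is Some c then CertTC c else CertQC q in
  let w := make_vote v (h_hash (tip_header T)) in
  when (~~ has_timed_out s v) (
    update (set_highest_voted_view v) ;;
    if tip_view T <= qc_view q then
      broadcast (MTimeout (Timeout v None None (Some q) cer
        (Sig i (OnTimeout v None (qc_view q)))))
    else
      log_vote w ;;
      broadcast (MTimeout (Timeout v (Some T) (Some w) None cer
        (Sig i (OnTimeout v (Some (tip_view T)) (tip_qc_view T)))))).

Definition on_start : act :=
  enter (CertQC genesis_qc) ;;
  when (i == leader 1) (propose_qc genesis_qc).

Definition on_proposal (j : validator) (p : proposal) : act := get s,
  when [&& valid_proposal p, j == leader (p_view p) & cur_view s <= p_view p] (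
    let q := p_qc p in
    enter (if p_tc p is Some c then CertTC c else CertQC q) ;;
    when ((qc_view q).+1 == p_view p) (
      when (i == leader (qc_view q)) (broadcast_qc q) ;;
      send (leader (qc_view q)) (MQC q)) ;;
    commit q ;;
    when (highest_voted_view s < p_view p) (
      let otip := if fresh p then Some (tip_of p)
                  else if p_tc p is Some c then tc_high_tip c else None in
      update (if otip is Some T then set_local_tip T else id) ;;
      get s',
        let v := cur_view s' in
        let w := make_vote v (h_hash (tip_header (local_tip s'))) in
        send (leader v) (MVote w) ;;
        send (leader v.+1) (MVote w) ;;
        log_vote w ;;
        update (set_highest_voted_view v))).

Definition on_vote (w : vote) : act := get s,
  let v := vt_view w in
  when [&& valid_vote w, cur_view s <= v
         & (i == leader v) || (i == leader v.+1)] (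
    let ws := add_vote w (votes s) in
    update (set_votes ws) ;;
    if form_qc w ws is Some q then
      obtain q ;; enter (CertQC q) ;; commit q ;;
      if i == leader v then broadcast_qc q else propose_qc q
    else skip).

Definition on_qc (j : validator) (q : qc) : act := get s,
  when (valid_qc q && (cur_view s <= qc_view q)) (
    when (j == leader (qc_view q)) (
      enter (CertQC q) ;; commit q ;; send (leader (qc_view q).+1) (MQC q)) ;;
    when (i == leader (qc_view q)) (broadcast_qc q) ;;
    when (i == leader (qc_view q).+1) (
      enter (CertQC q) ;; commit q ;; propose_qc q)).

Definition broadcast_tc (c : tc) : act := get s,
  when (~~ has_broadcast_tc s (tc_view c) && ~~ has_timed_out s (tc_view c))
    (broadcast (MTC c)).

Definition record_timeout (M : timeout) : act := get s,
  when (~~ has (fun M' => (m_view M' == m_view M) &&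
                          (signer (m_sig M') == signer (m_sig M))) (timeouts s))
    (update (set_timeouts (rcons (timeouts s) M))).

Definition on_timeout (M : timeout) : act := get s,
  when (valid_timeout M && (cur_view s <= m_view M)) (
    let c := m_last_cer M in
    let v := m_view M in
    (if c is CertTC t then broadcast_tc t else skip) ;;
    enter c ;;
    when ((i == leader (cert_view c).+1) && ~~ has_proposed s (cert_view c).+1)
      (match c with CertQC q => propose_qc q | CertTC t => propose_tc t end) ;;
    (if c is CertQC q then
       when (i == leader (qc_view q)) (broadcast_qc q) ;;
       send (leader (qc_view q)) (MQC q) ;;
       send (leader (qc_view q).+1) (MQC q) ;;
       commit q
     else skip) ;;
    (if (m_tip M, m_tip_vote M) is (Some _, Some w)
     then update (fun s' => set_tip_votes (add_vote w (tip_votes s')) s')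
     else skip) ;;
    get s',
      if (if (m_tip M, m_tip_vote M) is (Some _, Some w)
          then form_qc w (tip_votes s') else None) is Some q then
        obtain q ;; enter (CertQC q) ;; commit q ;;
        when (i == leader (qc_view q).+1) (propose_qc q)
      else
        record_timeout M ;;
        get s'',
          let Ms := [seq M' <- timeouts s'' | m_view M' == v] in
          when (f.+1 <= size Ms) timeout_view ;;
          when (quorum <= size Ms) (
            let t := form_tc v (take quorum Ms) in
            enter (CertTC t) ;;
            when (i == leader (tc_view t).+1) (propose_tc t))).

Definition on_tc (c : tc) : act := get s,
  when (valid_tc c && (cur_view s <= tc_view c)) (
    enter (CertTC c) ;;
    broadcast_tc c ;;
    when (i == leader (tc_view c).+1) (propose_tc c)).

Definition valid_request (s : lstate) (j : validator) (c : tc) : bool :=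
  [&& valid_tc c, isSome (tc_high_tip c), j == leader (tc_view c).+1
    & cur_view s <= (tc_view c).+1].

Definition on_proposal_request (j : validator) (c : tc) : act := get s,
  when (valid_request s j c) (
    enter (CertTC c) ;;
    if tc_high_tip c is Some T then
      if lookup (tip_id T) (proposals s) is Some p then send j (MProposal p)
      else skip
    else skip).

Definition on_ne_request (j : validator) (c : tc) : act := get s,
  when (valid_request s j c) (
    enter (CertTC c) ;;
    if tc_high_tip c is Some T then
      when ((tip_id T \notin voted_ids s) && ((tc_view c).+1 \notin ne_views s)) (
        send j (MNE (Sig i (OnNE (tc_view c).+1 (tip_qc_view T)))) ;;
        update (set_ne_views ((tc_view c).+1 :: ne_views s)))
    else skip).

Definition on_ne (sg : signature) : act := get s,
  when (sg \notin ne_sigs s) (update (set_ne_sigs (rcons (ne_sigs s) sg))).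

Fixpoint qcs_of_tip (T : tip) : seq qc :=
  let: Tip _ _ h _ otc _ := T in
  h_qc h :: (if otc is Some c then qcs_of_tc c else [::])
with qcs_of_tc (c : tc) : seq qc :=
  let: TC _ _ oT _ oq _ := c in
  (if oq is Some q then [:: q] else [::]) ++
  (if oT is Some T then qcs_of_tip T else [::]).

Definition qcs_of_cert (c : cert) : seq qc :=
  match c with CertQC q => [:: q] | CertTC t => qcs_of_tc t end.

Definition qcs_of_msg (m : msg) : seq qc :=
  match m with
  | MProposal p => qcs_of_tip (tip_of p)
  | MQC q => [:: q]
  | MTimeout M => qcs_of_cert (m_last_cer M) ++
      (if m_tip M is Some T then qcs_of_tip T else [::]) ++
      (if m_qc M is Some q then [:: q] else [::])
  | MTC c | MNERequest c | MProposalRequest c => qcs_of_tc c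
  | MVote _ | MNE _ => [::]
  end.

(* A received proposal, and those obtained through the QCs of the message, are
   stored whatever the views. *)
Definition absorb (m : msg) : act :=
  (if m is MProposal p then update (fun s => set_proposals (rcons (proposals s) p) s)
   else skip) ;;
  foldr (fun q a => obtain q ;; a) skip (qcs_of_msg m).

Definition on_message (j : validator) (m : msg) : act :=
  absorb m ;;
  match m with
  | MProposal p => on_proposal j p
  | MVote w => on_vote w
  | MQC q => on_qc j q
  | MTimeout M => on_timeout M
  | MTC c => on_tc c
  | MNERequest c => on_ne_request j c
  | MProposalRequest c => on_proposal_request j c
  | MNE sg => on_ne sg
  end ;;
  recover_returns.

End Validator.

Record packet := Packet {
  src : validator; dst : validator; contents : msg; sent_at : R }.

(* [net] are the messages in transit, [issued] the proposals sent so far. *)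
Record config := Config {
  local : validator -> lstate; net : seq packet; issued : seq proposal }.

Definition initial_config : config :=
  Config (fun _ => initial_lstate) [::] [:: genesis_proposal].

(* Run [a] at [i] at time [t], [rest] being the other messages in transit. *)
Definition run (i : validator) (t : R) (a : act) (rest : seq packet)
    (c : config) : config :=
  let: (s, out) := a (local c i) in
  Config (fun j => if j == i then s else local c j)
    (rest ++ [seq Packet i x.1 x.2 t | x <- out])
    (issued c ++
     pmap (fun x => if x.2 is MProposal p then Some p else None) out).

(* Time elapsed between [t0] and [t] according to the local clock of [i]. *)
Definition elapsed (i : validator) (t0 t : R) : R := (clock S i t - clock S i t0)%R.

Definition more_requests (r : recovery) : bool :=
  rec_rounds r * kappa S < (3 * f).+1.

Inductive step (t : R) (c : config) : config -> Prop :=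
| StepStart i : ~~ started (local c i) -> (t < GST S)%R ->
    step t c (run i t (on_start i t) (net c) c)
| StepDeliver pk l1 l2 : net c = l1 ++ pk :: l2 ->
    started (local c (dst pk)) ->
    step t c (run (dst pk) t
                (on_message (dst pk) t (issued c) (src pk) (contents pk))
                (l1 ++ l2) c)
| StepTimer i : started (local c i) ->
    ~~ has_timed_out (local c i) (cur_view (local c i)) ->
    (Theta_view <= elapsed i (timer_start (local c i)) t)%R ->
    step t c (run i t (timeout_view i) (net c) c)
| StepRecover i r : r \in recoveries (local c i) -> more_requests r ->
    (Theta_interval S <= elapsed i (rec_time r) t)%R ->
    step t c (run i t (recover_tick t r) (net c) c)
| StepIdle : step t c c.

(* Configuration [c] may last until time [t]: no delivery, start or timer is overdue.  The
   delivery bound with [Delta] follows from the one with [delta]. *)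
Definition not_overdue (t : R) (c : config) : Prop :=
  [/\ forall pk l1 l2, net c = l1 ++ pk :: l2 ->
        (t <= Num.max (sent_at pk) (GST S) + delta S)%R,
      forall i, ~~ started (local c i) -> (t < GST S)%R,
      forall i, started (local c i) ->
        ~~ has_timed_out (local c i) (cur_view (local c i)) ->
        (elapsed i (timer_start (local c i)) t <= Theta_view)%R
    & forall i r, r \in recoveries (local c i) -> more_requests r ->
        (elapsed i (rec_time r) t <= Theta_interval S)%R].

(* The [k]-th step occurs at time [time k], in configuration [conf k]. *)
Record execution := Execution {
  time : nat -> R;
  conf : nat -> config;
  conf0 : conf 0 = initial_config;
  time_le : forall k, (time k <= time k.+1)%R;
  conf_step : forall k, step (time k) (conf k) (conf k.+1);
  conf_not_overdue : forall k, not_overdue (time k) (conf k);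
  (* finitely many steps in bounded time *)
  time_diverges : forall t : R, exists k, (t < time k)%R }.

(* [i] commits [b] (not just speculatively) during [[t1, t2]]. *)
Definition commits_during (E : execution) (i : validator) (t1 t2 : R)
    (b : block) : Prop :=
  exists k, [/\ (t1 <= time E k)%R, (time E k <= t2)%R,
    b \notin committed (local (conf E k) i)
    & b \in committed (local (conf E k.+1) i)].

End MonadBFT.

(* Main.v *)
(* The leader of a view never waits for recovery longer than one network delay:
   all validators being correct, the proposal behind a reported tip has been
   broadcast and arrives by itself.  Hence once a view [v] is first entered at a
   time [e] after GST, everybody is in it at [e + delta], its proposal is out at
   [e + 2 delta], all votes are cast at [e + 3 delta], and the next leader has a
   QC at [e + 4 delta], long before any timer expires as
   [Theta_view >= 8 delta].  So no validator times out of a view entered after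
   GST, no TC of such a view exists, and all later views are chained by QCs of
   consecutive views, each new view committing the block two views below.  The
   timeouts of the view that is current at GST lead to such a regime by
   [GST + Theta_view + 2 delta]; then a view takes at most [4 delta], whence
   [c = 1/8] and [K = 26]. *)

Require Import Defs.
From HB Require Import structures.
From mathcomp Require Import all_boot all_order all_algebra.
From mathcomp Require Import boolp reals zify lra.

Set Implicit Arguments.
Unset Strict Implicit.
Unset Printing Implicit Defensive.

Import Order.TTheory GRing.Theory Num.Theory.

(** The timing argument needs liveness facts about eight message handlers. Each handler is checked
    once against them by Hoare triples; afterwards a validator that has received enough messages
    must have moved on, since staying would contradict an invariant.

    Two circularities are broken. A QC formed from votes becomes public only at the end of the
    handler that has already acted on it; hence the invariants refer to the broadcasts both before
    and after a handler. And progress within a view presupposes that nobody times out of it, which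
    itself rests on progress; induction on steps resolves this, because the first timeout of a view
    comes from an expired timer.

    Commits are counted by block view: a block of view [w] cannot be committed before [w] is first
    entered, which places the commit inside the window, and blocks of different views differ. *)

HB.instance Definition _ (f : nat) (Hash : eqType) := gen_eqMixin (timeout f Hash).

(** * Validity of certificates and proposals *)

Section Validity.

Variables (R : realType) (f : nat) (Payload Hash : eqType).
Variable S : setting R f Payload Hash.
Hypothesis hash_inj : injective (hash S).

Local Notation H := (hash S).
Local Notation validator := 'I_(3 * f).+1.

(** [on_vote] makes a leader of both [v] and [v.+1] broadcast the QC instead of proposing, which
    would leave [v.+1] without a proposal. Round-robin over at least four validators excludes
    this. *)
Lemma leader_succ_neq v : 0 < f -> leader f v != leader f v.+1.
Proof.
move=> f0; apply/eqP => /(congr1 val) /=.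
rewrite /leader !inordK ?ltn_pmod //.
move/eqP; rewrite -[X in _ == X %[mod _]]addn1 -{1}[v]addn0 eqn_modDl.
by rewrite mod0n modn_small //; lia.
Qed.

Lemma valid_header_hash h : valid_header S h ->
  h_hash h = H (HBlock Payload (h_view h) (h_payload_hash h) (h_qc h)).
Proof. by case/orP => [/eqP -> //|/andP[_ /eqP]]. Qed.

Lemma valid_header_inj h h' : valid_header S h -> valid_header S h' ->
  h_hash h = h_hash h' -> h = h'.
Proof.
move=> /valid_header_hash e /valid_header_hash e' ee.
have := hash_inj (etrans (esym e) (etrans ee e')).
by case: h {e} ee => ? ? ? ?; case: h' {e'} => ? ? ? ? /= -> [-> -> ->].
Qed.

Lemma valid_header_qc h : valid_header S h -> 0 < h_view h -> valid_qc S (h_qc h).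
Proof. by case/orP => [/eqP -> //|/andP[-> _]]. Qed.

Lemma valid_tipP T : valid_tip S T -> 0 < tip_view T ->
  [/\ valid_header S (tip_header T),
      tip_id T = H (HProposal _ _ (h_hash (tip_header T)) (tip_view T)),
      h_view (tip_header T) = tip_view T,
      tip_qc_view T < tip_view T & valid_qc S (h_qc (tip_header T))].
Proof.
case: T => v id h sg otc onec /= /orP[/eqP[-> //]|/and5P[vh /eqP eid _ /eqP hv /andP[lt
  _]]] v0.
split => //; apply: valid_header_qc => //; by rewrite hv.
Qed.

(** A high tip strictly exceeds all reported QC views, so its view is positive and it is not the
    genesis tip. *)
Lemma valid_tcP c : valid_tc S c ->
  (exists q, [/\ tc_high_qc c = Some q, tc_high_tip c = None, valid_qc S q
               & qc_view q < tc_view c]) \/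
  (exists T, [/\ tc_high_qc c = None, tc_high_tip c = Some T, valid_tip S T
               & 0 < tip_view T <= tc_view c]).
Proof.
case: c => v tvs oT qvs oq Sg /= /and5P[_ _ _ _ /andP[_]].
case: oq => [q|]; case: oT => [T|] //.
  by case/and4P => vq lt _ _; left; exists q.
case/and4P => vT le _ lt; right; exists T; split=> //.
by rewrite le andbT; apply: leq_ltn_trans lt.
Qed.

(** The certificate with which [on_proposal] calls [enter]; for a valid proposal it belongs to the
    preceding view. *)
Definition pcert (p : proposal f Payload Hash) : cert f Hash :=
  if p_tc p is Some c then CertTC c else CertQC (p_qc p).

Lemma valid_proposal_view p : valid_proposal S p -> 0 < p_view p.
Proof. by case/and5P => _ _ _ _ /andP[lt _]; apply: leq_ltn_trans lt. Qed.

Lemma valid_proposal_tip p : valid_proposal S p -> fresh p -> valid_tip S (tip_of p).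
Proof. by case/and5P => _ _ _ _ /andP[_ h] fr; move: h; rewrite fr. Qed.

Lemma valid_proposal_id p : valid_proposal S p ->
  p_id p = H (HProposal _ _ (h_hash (p_header p)) (p_view p)).
Proof. by case/and5P => _ /eqP. Qed.

Lemma fresh_tip_nongenesis p : valid_proposal S p -> tip_of p == genesis_tip S = false.
Proof.
move=> /valid_proposal_view v0; apply/negbTE/eqP => - [e].
by rewrite e in v0.
Qed.

(** A TC may be missing only from a fresh proposal whose QC is of the preceding view, and then
    [valid_tip] vouches for that QC. *)
Lemma valid_proposal_cert p : valid_proposal S p ->
  valid_cert S (pcert p) /\ (cert_view (pcert p)).+1 = p_view p.
Proof.
move=> vp; have v0 := valid_proposal_view vp; have ng := fresh_tip_nongenesis vp.
have vtip := valid_proposal_tip vp.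
case/and5P: vp => vb _ _ _ /andP[lt].
rewrite /pcert; case: ifP => [fr|nfr].
  have := vtip fr; rewrite /tip_of /= -/(tip_of p) ng /=.
  case/and5P => vh _ _ /eqP hv /andP[_].
  case: eqP => [e|ne].
    move=> /andP[/eqP -> _] /=; split; last by rewrite e.
    apply: valid_header_qc => //; by rewrite hv.
  by case: (p_tc p) => // c /andP[vc /andP[/eqP -> _]].
case/andP => _; case: (p_tc p) => // c /and3P[vc /eqP -> _] //.
Qed.

Lemma valid_proposal_notc p : valid_proposal S p -> p_tc p = None ->
  [/\ fresh p, h_view (p_header p) = p_view p, (qc_view (p_qc p)).+1 = p_view p
    & valid_qc S (p_qc p)].
Proof.
move=> vp tcN; have [vc vv] := valid_proposal_cert vp.
rewrite /pcert tcN /= in vc vv.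
have fr : fresh p by rewrite /fresh vv eqxx.
split => //.
have := valid_proposal_tip vp fr; rewrite /tip_of /= -/(tip_of p) fresh_tip_nongenesis //=.
by case/and5P => _ _ _ /eqP.
Qed.

Lemma valid_proposal_reproposal p : valid_proposal S p -> ~~ fresh p ->
  exists c T, [/\ p_tc p = Some c, tc_high_tip c = Some T, valid_tc S c,
    p_view p = (tc_view c).+1 & tip_header T = p_header p].
Proof.
case/and5P => _ _ _ _ /andP[_ h] nfr; move: h; rewrite (negbTE nfr).
case/andP => _; case: (p_tc p) => // c /and3P[vc /eqP ev /eqP eT].
case ec: (tc_high_tip c) eT => [T|] //= [eT].
by exists c, T.
Qed.

(** * Validity of the proposals that a leader issues *)

Definition mk_proposal (i : validator) v b otc onec : proposal f Payload Hash :=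
  let id := H (HProposal _ _ (h_hash (b_header b)) v) in
  Proposal v id b (Sig i (OnProposal id)) otc onec.

Lemma valid_new_block v q : valid_qc S q -> valid_block S (new_block S v q).
Proof.
move=> vq; rewrite /valid_block /new_block /= eqxx andbT.
by apply/orP; right => /=; rewrite vq eqxx.
Qed.

Lemma valid_proposal_newqc i v q : valid_qc S q -> v = (qc_view q).+1 ->
  i = leader f v ->
  valid_proposal S (mk_proposal i v (new_block S v q) None None).
Proof.
move=> vq -> ->; apply/and5P; split => //=; first exact: valid_new_block.
by rewrite /fresh /p_qc /p_header /= eqxx /= eqxx /= /valid_header /= vq !eqxx !orbT /=
  leqnn /= orbT.
Qed.

Lemma valid_proposal_newtc i v c q : valid_tc S c -> tc_high_qc c = Some q ->
  v = (tc_view c).+1 -> i = leader f v ->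
  valid_proposal S (mk_proposal i v (new_block S v q) (Some c) None).
Proof.
move=> vc cq -> ->; have := valid_tcP vc => - [[q' [e _ vq lt]]|[T [e]]];
  last by rewrite cq in e.
move: e; rewrite cq => - [e]; subst q'.
apply/and5P; split => //=; first exact: valid_new_block.
have lt1 : qc_view q < (tc_view c).+1 by lia.
rewrite /fresh /p_qc /p_header /= cq orbT.
rewrite /tip_of /p_header /= /valid_header /= vq vc !eqxx !orbT /= lt1 /=.
by apply/orP; right; case: ifP => //= /eqP; lia.
Qed.

Lemma valid_proposal_re i v c T b : valid_tc S c -> tc_high_tip c = Some T ->
  valid_block S b -> b_header b = tip_header T ->
  v = (tc_view c).+1 -> i = leader f v ->
  valid_proposal S (mk_proposal i v b (Some c) None).
Proof.
move=> vc cT vb hb -> ->;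
  have := valid_tcP vc => - [[q' [_ e]]|[T' [cq e vT /andP[T0 le]]]]; first by rewrite cT in e.
move: e; rewrite cT => - [e]; subst T'.
have [vh eid hv lt vq] := valid_tipP vT T0.
apply/and5P; split => //=; rewrite ?/p_header ?/p_qc /= ?hb ?hv; first lia.
rewrite /fresh /p_qc /p_header /= cq !hb ?hv cT /= !eqxx vc.
rewrite /tip_qc_view in lt.
have -> : (qc_view (h_qc (tip_header T))).+1 == (tc_view c).+1 = false by lia.
by rewrite /= andbT; apply/andP; split; lia.
Qed.

Lemma valid_proposal_nec i v c T e : valid_tc S c -> tc_high_tip c = Some T ->
  valid_nec e -> nec_view e = (tc_view c).+1 -> nec_qc_view e = tip_qc_view T ->
  v = (tc_view c).+1 -> i = leader f v ->
  valid_proposal S (mk_proposal i v (new_block S v (h_qc (tip_header T))) (Some c) (Some e)).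
Proof.
move=> vc cT ve ev eq -> ->;
  have := valid_tcP vc => - [[q' [_ e']]|[T' [cq e' vT /andP[T0 le]]]];
    first by rewrite cT in e'.
move: e'; rewrite cT => - [e']; subst T'.
have [vh eid hv lt vq] := valid_tipP vT T0; rewrite /tip_qc_view in lt eq.
apply/and5P; split => //=; first exact: valid_new_block.
rewrite /fresh /p_qc /p_header /= orbT.
have lt1 : qc_view (h_qc (tip_header T)) < (tc_view c).+1 by lia.
rewrite /tip_of /p_header /= /valid_header /= vq vc ve ev eq !eqxx !orbT /= lt1 /=.
by apply/orP; right; case: ifP => //= /eqP; lia.
Qed.

End Validity.

(** * Maxima over reported tips and views *)

Section PickMax.

Variables (T : eqType) (ge : rel T).
Hypotheses (ge_total : total ge) (ge_trans : transitive ge).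

Lemma pick_maxP s :
  if pick_max ge s is Some x then x \in s /\ (forall y, y \in s -> ge x y)
  else s = [::].
Proof.
elim: s => [|x s IH] //=; case: (pick_max ge s) IH => [y|] /=.
  case=> ys hy; case: ifP => g.
    split; first exact: mem_head.
    move=> z; rewrite inE => /orP[/eqP ->|/hy]; last exact: ge_trans.
    by have := ge_total x x; rewrite orbb.
  have gyx : ge y x by have := ge_total x y; rewrite g.
  split; first by rewrite inE ys orbT.
  by move=> z; rewrite inE => /orP[/eqP ->|/hy].
move=> ->; split; first exact: mem_head.
move=> z; rewrite inE => /eqP ->; by have := ge_total x x; rewrite orbb.
Qed.

End PickMax.

Lemma max_viewsP s b : reflect {in s, forall v, v <= b} (max_views s <= b).
Proof.
rewrite /max_views; apply: (iffP idP) => [le v vs|h].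
  by apply: leq_trans le; apply: (@leq_bigmax_seq _ _ xpredT id).
elim: s h => [|x s IH] h; rewrite ?big_nil // big_cons geq_max.
by rewrite h ?mem_head //= IH // => v vs; apply: h; rewrite inE vs orbT.
Qed.

Lemma max_views_mem s : s != [::] -> max_views s \in s.
Proof.
rewrite /max_views; elim: s => [|x s IH] // _; rewrite big_cons.
case: (eqVneq s [::]) => [->|/IH]; first by rewrite big_nil maxn0 mem_head.
by move=> h; rewrite inE; case: leqP => _; rewrite ?h ?orbT ?eqxx.
Qed.

(** * QCs and TCs formed from collected messages *)

Section Forming.

Variables (R : realType) (f : nat) (Payload Hash : eqType).
Variable S : setting R f Payload Hash.
Hypothesis hash_inj : injective (hash S).

Local Notation H := (hash S).
Local Notation validator := 'I_(3 * f).+1.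
Local Notation quorum := (quorum f).

Lemma vote_id_inj (w w' : vote f Hash) : valid_vote S w -> valid_vote S w' -> vt_id w =
  vt_id w' ->
  vt_view w = vt_view w' /\ vt_block_hash w = vt_block_hash w'.
Proof.
by case/andP=> /eqP e _ /andP[/eqP e' _]; rewrite e e' => /hash_inj[-> ->].
Qed.

(** As [H] is injective, the id fixes view and block hash and thereby the signed content. Hence
    votes without repetition and with one common id have distinct signers, as an aggregate
    requires. *)
Lemma vote_signer_inj (w w' : vote f Hash) : valid_vote S w -> valid_vote S w' ->
  vt_id w = vt_id w' -> signer (vt_sig w) = signer (vt_sig w') -> w = w'.
Proof.
move=> vw vw' e; have [e1 e2] := vote_id_inj vw vw' e.
case/andP: vw vw' => _ /eqP s /andP[_ /eqP s'].
case: w e e1 e2 s => ? ? ? [? ?] /=; case: w' s' => ? ? ? [? ?] /=.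
by move=> -> -> -> -> -> ->.
Qed.

Lemma votes_uniq_signer (w : vote f Hash) ws : uniq ws -> {in ws, forall w',
  valid_vote S w'} ->
  uniq [seq signer (vt_sig w') | w' <- ws & vt_id w' == vt_id w].
Proof.
move=> u vws; rewrite map_inj_in_uniq ?filter_uniq // => x y.
rewrite !mem_filter => /andP[/eqP ex xs] /andP[/eqP ey ys].
by apply: vote_signer_inj; rewrite ?vws // ex ey.
Qed.

(** The list of signers is kept because a QC made of tip votes is backed by the timeouts of its
    voters. *)
Lemma form_qcP (w : vote f Hash) ws q : uniq ws -> {in ws, forall w', valid_vote S w'} ->
  valid_vote S w -> form_qc w ws = Some q ->
  [/\ valid_qc S q, qc_view q = vt_view w, qc_id q = vt_id w &
    exists l : seq validator, [/\ uniq l, size l = quorum &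
      forall j, j \in l -> exists w', [/\ w' \in ws, signer (vt_sig w') = j
                                   & vt_view w' = vt_view w]]].
Proof.
move=> u vws vw; rewrite /form_qc.
set ws' := filter _ ws; case: leqP => // le [<-] /=.
have us : uniq [seq signer (vt_sig w') | w' <- ws'] by apply: votes_uniq_signer.
have vt w' : w' \in take quorum ws' -> [/\ w' \in ws, vt_id w' = vt_id w & valid_vote S w'].
  by move=> /mem_take; rewrite mem_filter => /andP[/eqP -> h]; rewrite vws.
split=> //.
  rewrite /valid_qc /=; apply/orP; right.
  case/andP: (vw) => -> _ /=; apply/and3P; split.
  - by rewrite size_map size_take_min (minn_idPl le).
  - by rewrite -map_comp map_take take_uniq.
  - apply/allP => sg /mapP[w' /vt[w's e vw'] ->].
    have [<- <-] := vote_id_inj vw' vw e; rewrite -e.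
    by case/andP: vw' => _.
exists [seq signer (vt_sig w') | w' <- take quorum ws']; split.
- by rewrite map_take take_uniq.
- by rewrite size_map size_take_min (minn_idPl le).
- move=> j /mapP[w' /vt[w's e vw'] ->]; exists w'; split=> //.
  by have [] := vote_id_inj vw' vw e.
Qed.

Lemma tip_ge_total : total (@tip_ge f Hash).
Proof. by move=> x y; rewrite /tip_ge; lia. Qed.

Lemma tip_ge_trans : transitive (@tip_ge f Hash).
Proof. by move=> x y z; rewrite /tip_ge; lia. Qed.

(** The delicate case is a TC with a high QC. Let [M0] attain the maximal reported QC view. Were it
    to report a tip, that tip would have a larger view than its QC, hence exceed the maximum, and
    the other branch would have been taken. So [M0] reports a QC, and the chosen high QC attains the
    maximum too. Positivity of tip views excludes the genesis tip, which does not exceed its own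
    QC. *)
Lemma form_tcP v (Ms : seq (timeout f Hash)) : size Ms = quorum ->
  (forall M, M \in Ms -> [/\ valid_timeout S M, m_view M = v
     & forall T, m_tip M = Some T -> 0 < tip_view T]) ->
  uniq [seq signer (m_sig M) | M <- Ms] ->
  [/\ valid_tc S (form_tc v Ms), tc_view (form_tc v Ms) = v
    & forall T, tc_high_tip (form_tc v Ms) = Some T ->
        exists2 M, M \in Ms & m_tip M = Some T].
Proof.
move=> sz vM us.
have vM' M : M \in Ms ->
    (exists T, [/\ m_tip M = Some T, m_qc M = None, valid_tip S T,
       [&& 0 < tip_view T, tip_view T <= v & tip_qc_view T < tip_view T]
       & signed (m_sig M) = OnTimeout _ v (Some (tip_view T)) (tip_qc_view T)]) \/
    (exists q, [/\ m_tip M = None, m_qc M = Some q, valid_qc S q, qc_view q < v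
       & signed (m_sig M) = OnTimeout _ v None (qc_view q)]).
  move=> /vM[/and3P[_ _ h] ev T0]; move: h; rewrite ev.
  case eT: (m_tip M) T0 => [T|] T0; case: (m_qc M) => [q|] //.
    case/and4P => _ vT le /eqP sg; left; exists T.
    have {}T0 := T0 _ erefl; have [_ _ _ lt _] := valid_tipP vT T0.
    by rewrite T0 le lt.
  by case/and3P => vq lt /eqP sg; right; exists q.
pose tvs := [seq omap (@tip_view f Hash) (m_tip M) | M <- Ms].
pose qvs := map (@reported_qc_view f Hash) Ms.
have base : [&& size (map (@m_sig f Hash) Ms) == quorum,
  uniq (map (@signer f Hash) (map (@m_sig f Hash) Ms)),
      size tvs == quorum, size qvs == quorum
    & map (@signed f Hash) (map (@m_sig f Hash) Ms) == [seq OnTimeout _ v x.1 x.2 | x <-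
      zip tvs qvs]].
  rewrite !size_map sz eqxx -map_comp us /=; apply/eqP.
  rewrite zip_map -!map_comp; apply/eq_in_map => M /vM' /=.
  by rewrite /reported_qc_view => - [[T [-> _ _ _ ->]]|[q [-> -> _ _ ->]]].
have Ms0 : qvs != [::] by rewrite -size_eq0 size_map sz.
have [M0 M0s e0] : exists2 M, M \in Ms & max_views qvs = reported_qc_view M.
  by have /mapP := max_views_mem Ms0.
have mq M : M \in Ms -> reported_qc_view M <= max_views qvs.
  by move=> Mm; apply: (max_viewsP _ _ (leqnn _)); apply: map_f.
rewrite /form_tc -/tvs -/qvs.
have := pick_maxP tip_ge_total tip_ge_trans (pmap (@m_tip f Hash) Ms).
set oT := pick_max _ (pmap _ _) => hT.
have hT' : (if oT is Some T then max_views qvs < tip_view T else false) = false ->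
    forall M T', M \in Ms -> m_tip M = Some T' -> tip_view T' <= max_views qvs.
  case: oT hT => [T [Tm Tx]|e0'] h M T' Mm eT'.
    have /Tx : T' \in pmap (@m_tip f Hash) Ms by rewrite mem_pmap -eT' map_f.
    rewrite /tip_ge; move: h; lia.
  have : T' \in pmap (@m_tip f Hash) Ms by rewrite mem_pmap -eT' map_f.
  by rewrite e0'.
case: ifP hT' => [h _|_ /(_ erefl) hT'].
  case: oT h hT => // T lt [Tm Tx].
  move: (Tm); rewrite mem_pmap => /mapP[M Mm eT].
  split=> //; last by move=> T' /= [<-]; exists M.
  case/and5P: base => b1 b2 b3 b4 b5; rewrite /= b1 b2 b3 b4 b5 lt /=.
  case: (vM' M Mm) => [[T' [e _ vT /and3P[_ le _] _]]|[q [e]]]; last by rewrite e in eT.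
  move: e; rewrite -eT => - [e]; subst T'; rewrite vT le /= andbT.
  rewrite zip_map all_map; apply/allP => M' M'm /=.
  case: (vM' M' M'm) => [[T' [e _ vT' /and3P[T0 le' lt'] _]]|[q [-> //]]].
  have /Tx : T' \in pmap (@m_tip f Hash) Ms by rewrite mem_pmap -e map_f.
  by rewrite e /reported_qc_view e /= lt' /tip_ge; lia.
have oqP := @pick_maxP (qc f Hash) (fun q q' => qc_view q' <= qc_view q) _ _ (pmap (@m_qc
  f Hash) Ms).
case: (vM' M0 M0s) => [[T' [e _ vT' /and3P[_ _ lt'] _]]|[q0 [eT0 eq0 _ _ _]]].
  have := hT' _ _ M0s e; rewrite e0 /reported_qc_view e; lia.
have q0m : q0 \in pmap (@m_qc f Hash) Ms by rewrite mem_pmap -eq0 map_f.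
case: (pick_max _ (pmap (@m_qc f Hash) Ms)) oqP => [q|] oqP; last first.
  by move: q0m; rewrite oqP // => ? ?; lia.
have [qm qx] : q \in pmap (@m_qc f Hash) Ms /\ (forall y,
  y \in pmap (@m_qc f Hash) Ms -> qc_view y <= qc_view q).
  by apply: oqP => ? ?; lia.
split=> //; case/and5P: base => b1 b2 b3 b4 b5; rewrite /= b1 b2 b3 b4 b5 /=.
move: qm; rewrite mem_pmap => /mapP[M Mm eq].
case: (vM' M Mm) => [[T' [_ e]]|[q' [eT e vq lt _]]]; first by rewrite e in eq.
move: e; rewrite -eq => - [e]; subst q'; rewrite vq lt /=.
have eqm : qc_view q = max_views qvs.
  apply/eqP; rewrite eqn_leq.
  have := mq _ Mm; rewrite {1}/reported_qc_view eT -eq => -> /=.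
  by rewrite e0 /reported_qc_view eT0 eq0 qx.
rewrite -eqm eqxx andbT; apply/max_viewsP => x /mapP[o /mapP[M' M'm ->] ->].
case e: (m_tip M') => [T|] //=; rewrite eqm; exact: hT' e.
Qed.

End Forming.

(** * Actions only add to the broadcasts *)

Section BroadcastMono.

Variables (R : realType) (f : nat) (Payload Hash : eqType).

Local Notation act := (act R f Payload Hash).

(** Separate from the triples below, whose rule for sequences needs it: a bound on the final
    broadcasts must also bound those made after the first action. *)
Definition bmono (a : act) : Prop :=
  forall s, {subset broadcasts s <= broadcasts (a s).1}.

Lemma bmono_skip : bmono (@skip R f Payload Hash).
Proof. by move=> ? ?. Qed.

Lemma bmono_seq (a b : act) : bmono a -> bmono b -> bmono (andthen a b).
Proof.
move=> ma mb s m /(ma s); rewrite /andthen; case: (a s) => s1 o1 /= /(mb s1).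
by case: (b s1).
Qed.

Lemma bmono_read (k : lstate R f Payload Hash -> act) :
  (forall s, bmono (k s)) -> bmono (read k).
Proof. by move=> h s; apply: h. Qed.

Lemma bmono_when b (a : act) : bmono a -> bmono (when b a).
Proof. by move=> h; rewrite /when; case: b => //; apply: bmono_skip. Qed.

Lemma bmono_send j (m : msg f Payload Hash) : bmono (@send R f Payload Hash j m).
Proof. by move=> ? ?. Qed.

Lemma bmono_broadcast (m : msg f Payload Hash) : bmono (@broadcast R f Payload Hash m).
Proof. by move=> s m' /= h; rewrite inE h orbT. Qed.

Lemma bmono_foldr (T : Type) (F : T -> act) (xs : seq T) :
  (forall x, bmono (F x)) ->
  bmono (foldr (fun x a => andthen (F x) a) (@skip R f Payload Hash) xs).
Proof. by move=> h; elim: xs => [|x xs IH] /=; [exact: bmono_skip | exact: bmono_seq]. Qed.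

End BroadcastMono.

Create HintDb bmono.
#[local] Hint Resolve bmono_skip bmono_send bmono_broadcast : bmono.

Ltac bmono := repeat match goal with
  | |- bmono (andthen _ _) => apply: bmono_seq
  | |- bmono (when _ _) => apply: bmono_when
  | |- bmono (read _) => apply: bmono_read => ?
  | |- bmono (match ?x with _ => _ end) => destruct x
  | |- bmono (update _) => by move=> ? ?
  | |- bmono (log_vote _) => by move=> ? ?
  | |- bmono (let _ := _ in _) => cbv zeta
  | |- bmono _ => solve [auto with bmono nocore]
  end.

Section ActionsBroadcastMono.

Variables (R : realType) (f : nat) (Payload Hash : eqType).
Variable S : setting R f Payload Hash.

Lemma bmono_obtain iss q : bmono (@obtain R f Payload Hash iss q).
Proof. by move=> ? ?. Qed.

Lemma bmono_enter now c : bmono (@enter R f Payload Hash now c).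
Proof. by rewrite /enter; bmono; case: c => ? ? ?. Qed.

Lemma bmono_commit q : bmono (@commit R f Payload Hash q).
Proof. by rewrite /commit; bmono. Qed.

Lemma bmono_broadcast_qc q : bmono (@broadcast_qc R f Payload Hash q).
Proof. by rewrite /broadcast_qc; bmono. Qed.

Lemma bmono_broadcast_tc c : bmono (@broadcast_tc R f Payload Hash c).
Proof. by rewrite /broadcast_tc; bmono. Qed.

Lemma bmono_issue i b otc onec : bmono (issue S i b otc onec).
Proof. by rewrite /issue; bmono. Qed.

Lemma bmono_propose_qc i q : bmono (propose_qc S i q).
Proof. by rewrite /propose_qc; bmono; apply: bmono_issue. Qed.

Lemma bmono_request_round c k : bmono (request_round S c k).
Proof. by move=> ? ?. Qed.

Lemma bmono_recover now c : bmono (recover S now c).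
Proof. by rewrite /recover; bmono; apply: bmono_request_round. Qed.

Hint Resolve bmono_obtain bmono_enter bmono_commit bmono_broadcast_qc
  bmono_broadcast_tc bmono_issue bmono_propose_qc bmono_recover
  bmono_request_round : bmono.

Lemma bmono_recover_tick now r : bmono (recover_tick S now r).
Proof. by rewrite /recover_tick; bmono. Qed.

Lemma bmono_propose_tc i now c : bmono (propose_tc S i now c).
Proof. by rewrite /propose_tc; bmono. Qed.

Lemma bmono_recover_return i r : bmono (recover_return S i r).
Proof. by rewrite /recover_return; bmono. Qed.

Lemma bmono_timeout_view i : bmono (timeout_view S i).
Proof. by rewrite /timeout_view; bmono. Qed.

Lemma bmono_record_timeout M : bmono (@record_timeout R f Payload Hash M).
Proof. by rewrite /record_timeout; bmono. Qed.

Hint Resolve bmono_recover_tick bmono_propose_tc bmono_recover_return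
  bmono_timeout_view bmono_record_timeout : bmono.

Lemma bmono_recover_returns i : bmono (recover_returns S i).
Proof. by rewrite /recover_returns; bmono; apply: bmono_foldr => r; bmono. Qed.

End ActionsBroadcastMono.

#[local] Hint Resolve bmono_skip bmono_send bmono_broadcast bmono_obtain bmono_enter
  bmono_commit bmono_broadcast_qc bmono_broadcast_tc bmono_issue
  bmono_propose_qc bmono_recover bmono_request_round bmono_recover_tick
  bmono_propose_tc bmono_recover_return bmono_timeout_view
  bmono_record_timeout bmono_recover_returns : bmono.

(** * Facts witnessed by the messages broadcast so far *)

Section World.

Variables (R : realType) (f : nat) (Payload Hash : eqType).
Variable S : setting R f Payload Hash.

Local Notation validator := 'I_(3 * f).+1.
Local Notation quorum := (quorum f).
Local Notation msg := (msg f Payload Hash).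
Local Notation proposal := (proposal f Payload Hash).
Local Notation timeout := (timeout f Hash).

(* What each validator has broadcast so far.  All of them being correct, this
   decides what a certificate in circulation can testify to, monotonically. *)
Definition world := validator -> seq msg.

Implicit Types W : world.

Definition issued_in W (p : proposal) := p = genesis_proposal S \/ exists j,
  MProposal p \in W j.

Definition timed_out W j v := exists M, MTimeout Payload M \in W j /\ m_view M = v.

Definition quorum_timed_out W v := exists l : seq validator,
  [/\ uniq l, quorum <= size l & forall j, j \in l -> timed_out W j v].

(* The possible public reasons for entering view [v.+1]; each of them drags every
   validator beyond [v] within one network delay. *)
Definition entry_backed W v :=
  [\/ v = 0, quorum_timed_out W v,
      exists q, MQC Payload q \in W (leader f v) /\ qc_view q = v |
      exists p, issued_in W p /\ p_view p = v.+1].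

(* A vote of view [v] is cast either upon timing out of [v] or for a proposal
   of view [v]; the absence of timeouts thus identifies what a QC points to. *)
Definition id_backed W v id :=
  (exists j, timed_out W j v) \/ (exists p, [/\ issued_in W p, p_view p = v & p_id p = id]).

(** Only ids are compared; [issued_in_tip] derives equality of headers and views. *)
Definition tip_backed W (T : tip f Hash) := exists p, issued_in W p /\ p_id p = tip_id T.

(* [W0] is the world before a step and [W] the one after it: a QC formed by a
   handler is only backed by what this handler finally broadcasts. *)
Definition known_cert W0 W (c : cert f Hash) :=
  [/\ valid_cert S c, entry_backed W (cert_view c) &
    match c with
    | CertQC q => id_backed W0 (qc_view q) (qc_id q)
    | CertTC t => quorum_timed_out W0 (tc_view t) /\ (forall T,
      tc_high_tip t = Some T -> tip_backed W0 T)
    end].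

(** A tip is reported only if its view exceeds that of [last_qc], whence the positivity that
    [form_tcP] requires. *)
Definition known_timeout W (M : timeout) :=
  [/\ valid_timeout S M, MTimeout Payload M \in W (signer (m_sig M)),
      forall T, m_tip M = Some T -> tip_backed W T /\ 0 < tip_view T
    & forall w, m_tip_vote M = Some w -> signer (vt_sig w) = signer (m_sig M)].

(** For a request, the recorded [MNERequest] shows that its sender has already left the view of the
    TC; this matters when a leader receives its own request. *)
Definition msg_ok W0 W (j : validator) (m : msg) : Prop :=
  match m with
  | MProposal p => issued_in W p
  | MVote w => valid_vote S w /\ id_backed W (vt_view w) (vt_id w)
  | MQC q => known_cert W0 W (CertQC q)
  | MTimeout M => known_timeout W M /\ known_cert W0 W (m_last_cer M)
  | MTC c => known_cert W0 W (CertTC c)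
  | MNERequest c | MProposalRequest c =>
      known_cert W0 W (CertTC c) /\ MNERequest Payload c \in W j
  | MNE _ => True
  end.

Definition world_sub W0 W := forall j, {subset W0 j <= W j}.

Section Mono.
Variables (W0 W : world).
Hypothesis sub : world_sub W0 W.

Lemma issued_in_mono p : issued_in W0 p -> issued_in W p.
Proof. by case=> [->|[j /sub]]; [left|right; exists j]. Qed.

Lemma timed_out_mono j v : timed_out W0 j v -> timed_out W j v.
Proof. by case=> M [/sub ? ?]; exists M. Qed.

Lemma quorum_timed_out_mono v : quorum_timed_out W0 v -> quorum_timed_out W v.
Proof. by case=> l [? ? h]; exists l; split=> // j /h; apply: timed_out_mono. Qed.

Lemma entry_backed_mono v : entry_backed W0 v -> entry_backed W v.
Proof.
case=> [->|/quorum_timed_out_mono|[q [/sub ? ?]]|[p [/issued_in_mono ? ?]]].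
- by constructor 1.
- by constructor 2.
- by constructor 3; exists q.
- by constructor 4; exists p.
Qed.

Lemma id_backed_mono v id : id_backed W0 v id -> id_backed W v id.
Proof.
case=> [[j /timed_out_mono]|[p [/issued_in_mono]]] *; first by left; exists j.
by right; exists p.
Qed.

Lemma tip_backed_mono T : tip_backed W0 T -> tip_backed W T.
Proof. by case=> p [/issued_in_mono]; exists p. Qed.

Lemma known_timeout_mono M : known_timeout W0 M -> known_timeout W M.
Proof.
by case=> ? /sub ? h ?; split=> // T /h[/tip_backed_mono].
Qed.

Lemma known_cert_monor c : known_cert W0 W0 c -> known_cert W0 W c.
Proof. by case=> ? /entry_backed_mono. Qed.

Lemma known_cert_monol c : known_cert W0 W c -> known_cert W W c.
Proof.
case: c => [q|t] [? ? h]; split=> //; first exact: id_backed_mono.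
by case: h => /quorum_timed_out_mono ? h; split=> // T /h/tip_backed_mono.
Qed.

Lemma msg_ok_monol j m : msg_ok W0 W j m -> msg_ok W W j m.
Proof.
case: m => //= [q|M|c|c|c]; try exact: known_cert_monol.
- by case=> ? /known_cert_monol.
- by case=> /known_cert_monol.
- by case=> /known_cert_monol.
Qed.

End Mono.

Lemma msg_ok_mono W0 W j m : world_sub W0 W -> msg_ok W0 W0 j m -> msg_ok W W j m.
Proof.
move=> sub.
have k c : known_cert W0 W0 c -> known_cert W W c by move=> /(known_cert_monor sub)
  /(known_cert_monol sub).
case: m => /= [p|w|q|M|c|c|c|//].
- exact: issued_in_mono.
- by case=> ? /(id_backed_mono sub).
- exact: k.
- by case=> /(known_timeout_mono sub) ? /k.
- exact: k.
- by case=> /k ? /sub.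
- by case=> /k ? /sub.
Qed.

End World.

(** * Non-equivocation and the identification of proposals *)

Section WorldOk.

Variables (R : realType) (f : nat) (Payload Hash : eqType).
Variable S : setting R f Payload Hash.
Hypothesis hash_inj : injective (hash S).

Local Notation H := (hash S).
Local Notation msg := (msg f Payload Hash).

Record world_ok (W : world f Payload Hash) : Prop := WorldOkI {
  wo_issued : forall j p, MProposal p \in W j ->
    [/\ leader f (p_view p) = j, valid_proposal S p & known_cert S W W (pcert p)];
  wo_uniq : forall j p p', MProposal p \in W j -> MProposal p' \in W j ->
    p_view p = p_view p' -> p = p' }.

Variable W : world f Payload Hash.
Hypothesis Wok : world_ok W.

Lemma issued_in_valid p : issued_in S W p -> p = genesis_proposal S \/
  [/\ MProposal p \in W (leader f (p_view p)),
    valid_proposal S p & known_cert S W W (pcert p)].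
Proof.
case=> [|[j jp]]; [by left|right].
by have [e ? ?] := wo_issued Wok jp; rewrite e.
Qed.

Lemma issued_in_block p : issued_in S W p -> [/\ valid_block S (p_block p),
  h_view (p_header p) <= p_view p &
  p_id p = H (HProposal _ _ (h_hash (p_header p)) (p_view p))].
Proof.
case/issued_in_valid => [->|[_ vp _]]; first by rewrite /valid_block /valid_header /= !eqxx.
split; last exact: valid_proposal_id.
  by case/and5P: vp.
by case/and5P: vp.
Qed.

Lemma issued_in_header p : issued_in S W p -> valid_header S (p_header p).
Proof. by case/issued_in_block => /andP[]. Qed.

(** Only the leader of a view proposes in it, and at most once; the genesis proposal is alone in
    view 0 because valid proposals have positive views. *)
Lemma issued_in_view_inj p p' : issued_in S W p -> issued_in S W p' -> p_view p = p_view
  p' -> p = p'.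
Proof.
case/issued_in_valid => [->|[m v _]]; case/issued_in_valid => [->|[m' v' _]] // e.
- by have := valid_proposal_view v'; rewrite -e.
- by have := valid_proposal_view v; rewrite e.
- by rewrite e in m; exact: (wo_uniq Wok m m' e).
Qed.

Lemma issued_in_id_inj p p' : issued_in S W p -> issued_in S W p' -> p_id p = p_id p' ->
  p = p'.
Proof.
move=> ip ip'; have [_ _ ->] := issued_in_block ip; have [_ _ ->] := issued_in_block ip'.
by move/hash_inj => [_ e]; apply: issued_in_view_inj.
Qed.

(** An id hashes the view along with the block, so a later reproposal of the same block cannot be
    mistaken for the proposal behind the tip. *)
Lemma issued_in_tip p T : issued_in S W p -> valid_tip S T -> 0 < tip_view T ->
  p_id p = tip_id T -> p_header p = tip_header T /\ p_view p = tip_view T.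
Proof.
move=> ip vT T0; have [vh -> _ _ _] := valid_tipP vT T0.
have [_ _ ->] := issued_in_block ip; move/hash_inj => [e ev]; split => //.
by apply: (valid_header_inj hash_inj) => //; exact: issued_in_header.
Qed.

Lemma known_cert_tcP c : known_cert S W W (CertTC c) -> tc_high_qc c = None ->
  exists T, [/\ tc_high_tip c = Some T, valid_tip S T, 0 < tip_view T <= tc_view c
   & tip_backed S W T].
Proof.
case=> vc _ [_ h] e; case: (valid_tcP vc) => [[q [e']]|[T [_ eT vT le]]].
  by rewrite e in e'.
by exists T; split=> //; apply: h.
Qed.

End WorldOk.

Lemma lookupP (f : nat) (Payload Hash : eqType) id (ps : seq (proposal f Payload Hash)) p :
  lookup id ps = Some p -> p \in ps /\ p_id p = id.
Proof.
rewrite /lookup; case e: (filter _ ps) => [|x s] //= [<-].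
have : x \in [seq p <- ps | p_id p == id] by rewrite e mem_head.
by rewrite mem_filter => /andP[/eqP].
Qed.

Lemma lookup_None (f : nat) (Payload Hash : eqType) id (ps : seq (proposal f Payload Hash)) p :
  lookup id ps = None -> p \in ps -> p_id p <> id.
Proof.
rewrite /lookup; case e: (filter _ ps) => [|x s] //= _ pps eid.
have : p \in [seq p <- ps | p_id p == id] by rewrite mem_filter eid eqxx.
by rewrite e.
Qed.

Lemma proposal_chain_sub (f : nat) (Payload Hash : eqType) (ps : seq (proposal f Payload
  Hash)) k id :
  {subset proposal_chain ps k id <= ps}.
Proof.
elim: k id => [|k IH] id //= p; case e: (lookup id ps) => [p'|] //.
by rewrite inE => /orP[/eqP ->|/IH //]; have [] := lookupP e.
Qed.

(** What [commit] adds, as a function of the stored proposals alone, so that invariants can still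
    refer to it after the state has changed. *)
Definition commit_blocks (f : nat) (Payload Hash : eqType)
    (ps : seq (proposal f Payload Hash)) (q : qc f Hash) : seq (block f Payload Hash) :=
  if lookup (qc_id q) ps is Some parent then
    if lookup (qc_id (p_qc parent)) ps is Some gp then
      if qc_view q == (qc_view (p_qc parent)).+1 then with_ancestors ps (p_block gp)
      else [::]
    else [::]
  else [::].

(** * Handlers *)

Section Triples.

Variables (R : realType) (f : nat) (Payload Hash : eqType).
Variable S : setting R f Payload Hash.
Hypothesis hash_inj : injective (hash S).
Hypothesis f_gt0 : 0 < f.

Local Notation H := (hash S).
Local Notation validator := 'I_(3 * f).+1.
Local Notation quorum := (quorum f).
Local Notation msg := (msg f Payload Hash).
Local Notation act := (act R f Payload Hash).
Local Notation lstate := (lstate R f Payload Hash).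
Local Notation proposal := (proposal f Payload Hash).
Local Notation timeout := (timeout f Hash).
Local Notation world := (world f Payload Hash).
Local Notation issued_in := (issued_in S).
Local Notation known_cert := (known_cert S).
Local Notation "a ;; b" := (andthen a b) (at level 61, right associativity).

(* Validator [i] runs a handler from view [cv0]; [W0] is the world at that time
   and [W] one that includes the final broadcasts of the handler.  Fixing [W] in
   advance lets intermediate states refer to what is broadcast later on.
   [cause v] tells why [i] may time out of [v]. *)
Variables (i : validator) (now : R) (iss : seq proposal).
Variables (W0 W : world) (cv0 : nat) (cause : nat -> Prop).
Hypothesis W0_ok : world_ok S W0.
Hypothesis W0W : world_sub W0 W.
Hypothesis iss_issued_in : forall p, p \in iss <-> issued_in W0 p.
Hypothesis timed_out_cause : forall j v, timed_out W0 j v -> cause v.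

(** Everything is justified by [W0], except that certificates may owe their entry backing to [W]. A
    broadcast timeout only needs a [cause], chosen by the caller: an earlier timeout of the view or,
    in a timer step, the expired timer. *)
Record local_inv (s : lstate) : Prop := LocalInv {
  inv_props : forall p, p \in proposals s -> issued_in W0 p;
  inv_qc : known_cert W0 W (CertQC (last_qc s)) /\ qc_view (last_qc s) < cur_view s;
  inv_tc : forall c, last_tc s = Some c -> known_cert W0 W (CertTC c);
  inv_cert : (qc_view (last_qc s)).+1 = cur_view s \/
    exists c, last_tc s = Some c /\ (tc_view c).+1 = cur_view s;
  inv_tip : [/\ valid_tip S (local_tip s), tip_view (local_tip s) <= cur_view s
              & tip_backed S W0 (local_tip s)];
  inv_hv : highest_voted_view s <= cur_view s;
  inv_votes : uniq (votes s) /\ (forall w, w \in votes s ->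
    valid_vote S w /\ id_backed S W0 (vt_view w) (vt_id w));
  inv_tvotes : uniq (tip_votes s) /\ (forall w, w \in tip_votes s ->
    valid_vote S w /\ timed_out W0 (signer (vt_sig w)) (vt_view w));
  inv_to : uniq [seq (m_view M, signer (m_sig M)) | M <- timeouts s] /\
    (forall M, M \in timeouts s -> known_timeout S W0 M /\ m_view M <= cur_view s);
  inv_ne : uniq (ne_sigs s);
  inv_rec : forall r, r \in recoveries s ->
    [/\ known_cert W0 W (CertTC (rec_tc r)), tc_high_qc (rec_tc r) = None,
        leader f (tc_view (rec_tc r)).+1 = i, tc_view (rec_tc r) < cur_view s
      & MNERequest Payload (rec_tc r) \in broadcasts s];
  inv_bprop : forall p, MProposal p \in broadcasts s ->
    [/\ leader f (p_view p) = i, p_view p <= cur_view s, valid_proposal S p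
      & known_cert W0 W (pcert p)];
  inv_buniq : forall p p', MProposal p \in broadcasts s -> MProposal p' \in broadcasts s ->
    p_view p = p_view p' -> p = p';
  inv_bto : forall M, MTimeout Payload M \in broadcasts s ->
    cause (m_view M) /\ signer (m_sig M) = i;
  inv_bne : forall c, MNERequest Payload c \in broadcasts s -> tc_view c < cur_view s;
  inv_committed : forall b, b \in committed s -> exists p, issued_in W0 p /\ p_block p = b;
  inv_W0 : {subset W0 i <= broadcasts s} }.

(** Liveness of leaders as an invariant. The second alternative is temporary: [leader_has_proposed]
    rules it out once the sought proposal has had time to arrive. *)
Definition leader_served (s : lstate) := leader f (cur_view s) = i ->
  has_proposed s (cur_view s) \/
  exists2 r, r \in recoveries s & (tc_view (rec_tc r)).+1 = cur_view s.

Definition votes_short b (s : lstate) := forall w, w \in votes s -> b <= vt_view w ->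
  size [seq w' <- votes s | vt_id w' == vt_id w] < quorum.

Definition timeouts_short b (s : lstate) := forall v, b <= v ->
  size [seq M <- timeouts s | m_view M == v] < quorum.

(** The three outcomes of a handler: the view is unchanged, it was entered after a quorum of
    timeouts, or it was entered by a QC [q] whose commits have been made. [ps] are the proposals
    stored when [commit] ran. *)
Definition entry_commits (s : lstate) :=
  [\/ cur_view s = cv0, quorum_timed_out W0 (cur_view s).-1 |
   exists q ps, [/\ (qc_view q).+1 = cur_view s, id_backed S W0 (qc_view q) (qc_id q),
    forall p, p \in ps -> issued_in W0 p, {subset pointed_by iss q <= ps}
    & {subset commit_blocks ps q <= committed s}]].

(* While a handler runs, its intermediate state may violate part of the
   invariants that hold between handlers: [bv] and [bt] are the views from which
   the vote and timeout counts are known to be below a quorum, [bl] and [be] tell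
   whether the duties of a leader, resp. the commits due upon entering a view,
   are fulfilled, and [ps] are proposals known to be stored. *)
Record running (u bv bt : nat) (bl be : bool) (ps : seq proposal) (s : lstate) : Prop :=
  Running {
  running_inv : local_inv s;
  running_cv : cur_view s = u;
  running_v : votes_short bv s;
  running_t : timeouts_short bt s;
  running_l : bl -> leader_served s;
  running_e : be -> entry_commits s;
  running_ps : {subset ps <= proposals s} }.

(** The part of the behaviour of an action that composes over any number of steps: growth, with
    every new broadcast and every rise of [highest_voted_view] accounted for by a timeout or by the
    messages in [o]. *)
Record evolve (s s' : lstate) (o : seq (validator * msg)) : Prop := Evolve {
  ev_bc : {subset broadcasts s <= broadcasts s'};
  ev_props : {subset proposals s <= proposals s'};
  ev_comm : {subset committed s <= committed s'};
  ev_votes : {subset votes s <= votes s'};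
  ev_to : {subset timeouts s <= timeouts s'};
  ev_cv : (cur_view s' = cur_view s /\ timer_start s' = timer_start s) \/
          (cur_view s < cur_view s' /\ timer_start s' = now);
  ev_hv : highest_voted_view s <= highest_voted_view s';
  ev_sent : forall m, m \in broadcasts s' -> m \in broadcasts s \/ forall j, (j, m) \in o;
  ev_new : forall p, MProposal p \in broadcasts s' ->
    MProposal p \in broadcasts s \/ cur_view s <= p_view p;
  ev_vote : [\/ highest_voted_view s' = highest_voted_view s,
    exists M, MTimeout Payload M \in broadcasts s' /\ m_view M = highest_voted_view s' |
    exists p, let v := highest_voted_view s' in
      let w := make_vote S i v (h_hash (p_header p)) in
      [/\ issued_in W0 p, p_view p = v, (leader f v, MVote _ w) \in o
        & (leader f v.+1, MVote _ w) \in o]] }.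

(** * Composition of changes and rules for triples *)

Lemma evolve_trans s s1 s2 o1 o2 : evolve s s1 o1 -> evolve s1 s2 o2 -> evolve s s2 (o1 ++ o2).
Proof.
case=> a1 a2 a3 a4 a5 a6 a7 a8 a9 a10 [b1 b2 b3 b4 b5 b6 b7 b8 b9 b10].
have le : cur_view s <= cur_view s1 by lia.
split.
- by move=> x /a1/b1.
- by move=> x /a2/b2.
- by move=> x /a3/b3.
- by move=> x /a4/b4.
- by move=> x /a5/b5.
- case: b6 => [[-> ->]|[lt ->]] //; right; split=> //; lia.
- exact: leq_trans b7.
- move=> m /b8[/a8[]|]; [by left| |]; move=> h; right=> j; by rewrite mem_cat h ?orbT.
- move=> p /b9[/a9[]|]; [by left|by right|move=> h; right; lia].
- case: b10 => [->|h|[p [h1 h2 h3 h4]]].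
  + case: a10 => [h|[M [/b1 h1 h2]]|[p [h1 h2 h3 h4]]]; first by constructor 1.
      by constructor 2; exists M.
    by constructor 3; exists p; split=> //; rewrite mem_cat ?h3 ?h4.
  + by constructor 2.
  + by constructor 3; exists p; split=> //; rewrite mem_cat ?h3 ?h4 orbT.
Qed.

Lemma evolve_refl s o : evolve s s o.
Proof. by split=> //; [left | left | left | constructor 1]. Qed.

(* The hypothesis on the final broadcasts is what makes [W] the final world. *)
Definition hoare (P : lstate -> Prop) (a : act) (Q : lstate -> Prop) : Prop :=
  forall s, {subset broadcasts (a s).1 <= W i} -> P s ->
    [/\ Q (a s).1, evolve s (a s).1 (a s).2
      & forall x, x \in (a s).2 -> msg_ok S W0 W i x.2].

Lemma hoare_seq P a Q b T : bmono b -> hoare P a Q -> hoare Q b T -> hoare P (a ;; b) T.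
Proof.
move=> mb ha hb s; rewrite /andthen; move: (ha s).
case: (a s) => s1 o1 /= {}ha; move: (hb s1) (mb s1).
case: (b s1) => s2 o2 /= {}hb m sub Ps.
have [Q1 e1 m1] := ha (fun x h => sub _ (m _ h)) Ps.
have [Q2 e2 m2] := hb sub Q1.
split=> //; first exact: evolve_trans e2.
by move=> x; rewrite mem_cat => /orP[/m1|/m2].
Qed.

Lemma hoare_conseq (P P' : lstate -> Prop) a (Q Q' : lstate -> Prop) :
  (forall s, P s -> P' s) -> (forall s, Q' s -> Q s) -> hoare P' a Q' -> hoare P a Q.
Proof. by move=> h1 h2 h s sub /h1 /(h s sub)[/h2]. Qed.

Lemma hoare_pre (P' P : lstate -> Prop) a (Q : lstate -> Prop) :
  (forall s, P s -> P' s) -> hoare P' a Q -> hoare P a Q.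
Proof. by move=> h; apply: hoare_conseq. Qed.

Lemma hoare_post (Q' P : lstate -> Prop) a (Q : lstate -> Prop) :
  (forall s, Q' s -> Q s) -> hoare P a Q' -> hoare P a Q.
Proof. by move=> h; apply: hoare_conseq. Qed.

Lemma hoare_read P k Q : (forall s0, P s0 -> hoare (fun s => s = s0 /\ P s) (k s0) Q) ->
  hoare P (read k) Q.
Proof. by move=> h s sub Ps; apply: (h s). Qed.

Lemma hoare_skip (P Q : lstate -> Prop) : (forall s, P s -> Q s) ->
  hoare P (@skip R f Payload Hash) Q.
Proof. by move=> h s _ /h; split=> //; apply: evolve_refl. Qed.

Lemma hoare_when (b : bool) P a Q : (b -> hoare P a Q) -> (~~ b -> forall s, P s -> Q s) ->
  hoare P (when b a) Q.
Proof.
rewrite /when; case: b => [h _|_ h]; first exact: h.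
exact/hoare_skip/h.
Qed.

Lemma hoare_update g P Q : (forall s, P s -> Q (g s) /\ evolve s (g s) [::]) ->
  hoare P (@update R f Payload Hash g) Q.
Proof. by move=> h s _ /h[]. Qed.

Definition stable (F : lstate -> Prop) := forall s s' o, evolve s s' o -> F s -> F s'.

Lemma hoare_stable F P a Q : stable F -> hoare P a Q ->
  hoare (fun s => P s /\ F s) a (fun s => Q s /\ F s).
Proof. by move=> st h s sub [/(h s sub)[Qs ev m] Fs]; split=> //; split=> //;
  exact: (st _ _ _ ev Fs). Qed.

Lemma hoare_send j m P : (forall s, P s -> msg_ok S W0 W i m) ->
  hoare P (@send R f Payload Hash j m) P.
Proof.
move=> h s _ Ps; split=> //; first exact: evolve_refl.
by move=> x; rewrite inE => /eqP -> /=; apply: h Ps.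
Qed.

(** * Triples of the basic actions *)

Lemma evolve_frame s s' o : broadcasts s' = broadcasts s -> cur_view s' = cur_view s ->
  timer_start s' = timer_start s -> highest_voted_view s' = highest_voted_view s ->
  {subset proposals s <= proposals s'} -> {subset committed s <= committed s'} ->
  {subset votes s <= votes s'} -> {subset timeouts s <= timeouts s'} ->
  evolve s s' o.
Proof.
move=> e1 e2 e3 e4 *; split; rewrite ?e1 ?e2 ?e3 ?e4 //; try by constructor 1.
all: by move=> *; constructor 1.
Qed.

(** The three excluded kinds of message are those that [local_inv] tracks among the broadcasts; they
    get rules of their own. *)
Lemma hoare_broadcast m u bv bt bl be ps :
  (if m is (MProposal _ | MTimeout _ | MNERequest _) then false else true) ->
  msg_ok S W0 W i m ->
  hoare (running u bv bt bl be ps) (@broadcast R f Payload Hash m) (running u bv bt bl be ps).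
Proof.
move=> hm mok s sub [iv cv hv ht hl he hps] /=.
have mem m' : (if m' is (MProposal _ | MTimeout _ | MNERequest _) then true else false) ->
    m' \in m :: broadcasts s -> m' \in broadcasts s.
  by rewrite inE; case: eqP => // -> ; case: (m) hm.
split.
- split=> //; last first.
    move=> /hl l /= /l[h|h]; [left|by right].
    by rewrite /has_proposed /= -/(has_proposed _ _) h orbT.
  case: iv; split=> //=.
  + by move=> r /inv_rec0[? ? ? ? h]; split=> //; rewrite inE h orbT.
  + by move=> p /mem-/(_ isT); auto.
  + by move=> p p' /mem-/(_ isT) h /mem-/(_ isT); auto.
  + by move=> p /mem-/(_ isT); auto.
  + by move=> p /mem-/(_ isT); auto.
  + by move=> m' /inv_W1 h; rewrite inE h orbT.
- split=> //=; try by left.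
  + by move=> x h; rewrite inE h orbT.
  + move=> m'; rewrite inE => /orP[/eqP ->|]; last by left.
    by right=> j; rewrite map_f // mem_enum.
  + by move=> p /mem-/(_ isT); left.
  + by constructor 1.
- by move=> x /mapP[j _ ->].
Qed.

(** A change of view creates new duties: the leader must propose, and commits are due unless the
    entry is by a TC, which witnesses a quorum of timeouts. Without a change both flags are kept. *)
Lemma hoare_enter c u bv bt bl be ps : known_cert W0 W c -> u <= (cert_view c).+1 ->
  hoare (running u bv bt bl be ps) (@enter R f Payload Hash now c)
    (running (cert_view c).+1 bv bt (bl && (u == (cert_view c).+1))
       (if u == (cert_view c).+1 then be else if c is CertTC _ then true else false) ps).
Proof.
move=> kc lev; set v := (cert_view c).+1; apply: hoare_read => s0 [_ cv _ _ _ _ _].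
rewrite cv /when; case: (leqP u (cert_view c)) => lu; last first.
  have -> : u = v by lia.
  rewrite eqxx andbT; apply: hoare_skip => s [_]; done.
have -> : (u == v) = false by lia.
rewrite andbF.
move=> s _ [-> {s} [iv cv' hv ht hl he hps]].
have lu' : cur_view s0 < v by lia.
have [vc ec kk] := kc.
have ev : evolve s0 (enter now c s0).1 [::].
  rewrite /enter /read /when cv lu.
  by case: (c) lu => ? /= lu; split=> //=; try (by constructor 1); right; split=> //; lia.
move: ev; rewrite /enter /read /when cv lu => ev.
split=> //.
clear ev; case: c kc @v lev lu lu' vc ec kk => [q|t] kc v lev lu lu' vc ec kk; split=> //=;
  try (by move=> _; constructor 2; case: kk); rewrite /= in lu vc ec.
all: case: iv => p1 [p2 p2'] p3 p4 [p5 p5' p5''] p6 p7 p8 [p9 p9'] p10 p11 p12 p13 p14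
  p15 p16 p17.
all: have le x : x <= cur_view s0 -> x <= v by move=> h; apply: leq_trans h (ltnW lu').
all: have lt x : x < cur_view s0 -> x < v by move=> h; apply: ltn_trans h lu'.
all: split=> //=; try exact: le.
all: try (by left).
all: try (by split=> //; [apply: le | apply: lt]).
all: try (by split=> // M /p9'[? ?]; split=> //; apply: le).
all: try (by move=> r /p11[? ? ? ? ?]; split=> //; apply: lt).
all: try (by move=> p /p12[? ? ? ?]; split=> //; apply: le).
all: try (by move=> r /p15 ?; apply: lt).
all: try (by split=> //; [apply: le]).
all: try (by split=> //; [apply: lt]).
- by move=> c [<-].
- by right; exists t.
Qed.

Lemma hoare_obtain q u bv bt bl be ps :
  hoare (running u bv bt bl be ps) (@obtain R f Payload Hash iss q)
    (running u bv bt bl be (ps ++ pointed_by iss q)).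
Proof.
apply: hoare_update => s [iv cv hv ht hl he hps]; split; last first.
  by apply: evolve_frame => // p /= h; rewrite mem_cat h.
split=> //=; last first.
  by move=> p; rewrite !mem_cat => /orP[/hps ->|->] //; rewrite orbT.
case: iv; split=> //= p; rewrite mem_cat => /orP[|/proposal_chain_sub];
  first exact: inv_props0.
by move/iss_issued_in.
Qed.

Lemma with_ancestors_props (ps : seq proposal) p b : p \in ps -> b \in with_ancestors ps
  (p_block p) ->
  exists2 p', p' \in ps & b = p_block p'.
Proof.
rewrite /with_ancestors => pp; rewrite inE => /orP[/eqP ->|/mapP[p' h ->]]; first by exists p.
by exists p' => //; move: h => /proposal_chain_sub.
Qed.

Lemma commit_blocks_props (ps : seq proposal) q b : b \in commit_blocks ps q ->
  exists2 p, p \in ps & b = p_block p.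
Proof.
rewrite /commit_blocks; case: (lookup _ ps) => [parent|] //.
case e: (lookup _ ps) => [gp|] //; case: ifP => // _.
by apply: with_ancestors_props; have [] := lookupP e.
Qed.

Lemma commitE q (s : lstate) : exists sp cm,
  commit q s = (set_committed cm (set_speculative sp s), [::]) /\
  (forall b, b \in cm = (b \in commit_blocks (proposals s) q) || (b \in committed s)).
Proof.
rewrite /commit /commit_blocks /read.
case: (lookup _ (proposals s)) => [parent|] /=; last first.
  by exists (speculative s), (committed s); case: s.
pose sp := if fresh parent then p_block parent :: speculative s else speculative s.
case: (lookup _ (proposals s)) => [gp|] /=; last first.
  exists sp, (committed s); rewrite /sp /andthen /when; case: (fresh parent) => /=;
    by case: (s).
exists sp; rewrite /sp /andthen /when; case: (qc_view q == _) => /=.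
  exists (undup (with_ancestors (proposals s) (p_block gp) ++ committed s)).
  split; last by move=> b; rewrite mem_undup mem_cat.
  by case: (fresh parent) => //=; case: (s).
by exists (committed s); split=> //; case: (fresh parent) => //=; case: (s).
Qed.

Lemma hoare_commit q u bv bt bl be ps :
  (~~ be -> id_backed S W0 (qc_view q) (qc_id q) /\ {subset pointed_by iss q <= ps}) ->
  hoare (running u bv bt bl be ps) (@commit R f Payload Hash q)
    (running u bv bt bl (be || ((qc_view q).+1 == u)) ps).
Proof.
move=> vpq s sub [iv cv hv ht hl he hps].
have [sp [cm [-> /= cmE]]] := commitE q s.
split=> //; last first.
  by apply: evolve_frame => // b /= h; rewrite cmE h orbT.
split=> //=; last first.
- case: (boolP be) vpq => [/he he' _ _|nbe [//|vid pq] /= /eqP qu].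
    case: he' => [?|?|[q' [ps' [h1 h2 h3 h4 h5]]]];
      [by constructor 1|by constructor 2|constructor 3].
    by exists q', ps'; split=> // b /h5 h; rewrite /= cmE h orbT.
  constructor 3; exists q, (proposals s); split=> //=; first by rewrite cv.
  + exact: inv_props.
  + by move=> p /pq /hps.
  + by move=> b h; rewrite cmE h.
- case: iv; split=> //= b; rewrite cmE => /orP[|]; last exact: inv_committed0.
  by case/commit_blocks_props => p /inv_props0 ip ->; exists p.
Qed.

Lemma hoare_broadcast_qc q u bv bt bl be ps : known_cert W0 W (CertQC q) ->
  hoare (running u bv bt bl be ps) (@broadcast_qc R f Payload Hash q) (running u bv bt bl
    be ps).
Proof.
move=> k; apply: hoare_read => s0 _; apply: hoare_when => [_|_ s [_]//].
by apply: (@hoare_pre (running u bv bt bl be ps)) => [s [] //|]; apply: hoare_broadcast.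
Qed.

Lemma hoare_broadcast_tc c u bv bt bl be ps : known_cert W0 W (CertTC c) ->
  hoare (running u bv bt bl be ps) (@broadcast_tc R f Payload Hash c) (running u bv bt bl
    be ps).
Proof.
move=> k; apply: hoare_read => s0 _; apply: hoare_when => [_|_ s [_]//].
by apply: (@hoare_pre (running u bv bt bl be ps)) => [s [] //|]; apply: hoare_broadcast.
Qed.

Lemma hoare_issue b otc onec u bv bt bl be ps : leader f u = i ->
  let p := mk_proposal S i u b otc onec in
  valid_proposal S p -> known_cert W0 W (pcert p) ->
  hoare (running u bv bt bl be ps) (issue S i b otc onec) (running u bv bt true be ps).
Proof.
move=> lu p vp kp; apply: hoare_read => s0 [_ cv0' _ _ _ _ _].
rewrite cv0'; apply: hoare_when => [np|/negbNE hp]; last first.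
  move=> s [->{s} [iv cv hv ht hl he hps]]; split=> // _ _; left.
  by rewrite cv.
move=> s sub [e]; subst s0; move=> [iv cv hv ht hl he hps].
have mb m : m \in MProposal p :: broadcasts s -> m = MProposal p \/ m \in broadcasts s.
  by rewrite inE => /orP[/eqP|]; [left|right].
have np' p' : MProposal p' \in broadcasts s -> p_view p' <> u.
  move=> h e; move/negP: np; apply; apply/hasP; exists (MProposal p') => //.
  exact/eqP.
split.
- split=> //=.
  + case: iv; split=> //=.
    * by move=> r /inv_rec0[? ? ? ? h]; split=> //; rewrite inE h orbT.
    * by move=> p' /mb[[->]|/inv_bprop0 //]; split=> //=; rewrite cv.
    * move=> p1 p2 /mb[[->]|h1] /mb[[->]|h2] //= e; last exact: inv_buniq0.
        by case: (np' _ h2).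
      by case: (np' _ h1).
    * by move=> M /mb[//|/inv_bto0].
    * by move=> M /mb[//|/inv_bne0].
    * by move=> m' /inv_W1 h; rewrite inE h orbT.
  + by move=> _ _; left; rewrite /has_proposed /= cv eqxx.
- split=> //=; try by constructor 1.
  + by move=> x h; rewrite inE h orbT.
  + move=> m /mb[->|]; last by left.
    by right=> j; rewrite map_f // mem_enum.
  + by move=> p' /mb[[->]|]; [right; rewrite /= cv | left].
- move=> x /mapP[j _ ->] /=; right; exists i; apply: sub.
  by rewrite /= mem_head.
Qed.

Lemma hoare_propose_qc q u bv bt bl be ps : leader f u = i -> known_cert W0 W (CertQC q) ->
  (qc_view q).+1 = u ->
  hoare (running u bv bt bl be ps) (propose_qc S i q) (running u bv bt true be ps).
Proof.
move=> lu k qu; apply: hoare_read => s0 [_ cv0' _ _ _ _ _]; rewrite cv0'.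
apply: (@hoare_pre (running u bv bt bl be ps)) => [s [] //|].
have [vq _ _] := k.
by apply: hoare_issue => //; apply: valid_proposal_newqc.
Qed.

(** * Recovery and proposals after a TC *)

Lemma hoare_recover c u bv bt bl be ps : leader f u = i -> known_cert W0 W (CertTC c) ->
  tc_high_qc c = None -> (tc_view c).+1 = u ->
  hoare (running u bv bt bl be ps) (recover S now c) (running u bv bt true be ps).
Proof.
move=> lu k cq cu s sub [iv cv hv ht hl he hps]; move: sub.
rewrite /recover /read /when; case: ifP => [nc|/negbFE hc] sub; last first.
  split=> //; last exact: evolve_refl.
  split=> // _ _; right; case/mapP: hc => r rs e; exists r => //.
  by rewrite -e cv.
have mb m : m \in MNERequest Payload c :: broadcasts s -> m = MNERequest Payload c \/ m
  \in broadcasts s.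
  by rewrite inE => /orP[/eqP|]; [left|right].
split.
- split=> //=.
  + case: iv; split=> //=.
    * move=> r; rewrite inE => /orP[/eqP -> /=|].
        by split=> //=; [rewrite cu | lia | rewrite mem_head].
      rewrite mem_filter => /andP[_] /inv_rec0[? ? ? ? h]; split=> //.
      by rewrite inE h orbT.
    * by move=> p' /mb[//|/inv_bprop0 //].
    * by move=> p1 p2 /mb[//|h1] /mb[//|h2] //= e; exact: inv_buniq0.
    * by move=> M /mb[//|/inv_bto0].
    * by move=> M /mb[[->]|/inv_bne0 //]; lia.
    * by move=> m' /inv_W1 h; rewrite inE h orbT.
  + move=> _ _; right; exists (Recovery c 1 now); first by rewrite mem_head.
    by rewrite /= cv.
- split=> //=; try by constructor 1.
  + by move=> x h; rewrite inE h orbT.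
  + move=> m /mb[->|]; last by left.
    by right=> j; rewrite mem_cat map_f // mem_enum.
  + by move=> p' /mb[//|]; left.
- have mi : MNERequest Payload c \in W i by apply: sub; rewrite /= mem_head.
  move=> x /=; rewrite mem_cat => /orP[|] /mapP[j _ ->] //=.
Qed.

Lemma hoare_propose_tc c u bv bt bl be ps : leader f u = i -> known_cert W0 W (CertTC c) ->
  (tc_view c).+1 = u ->
  hoare (running u bv bt bl be ps) (propose_tc S i now c) (running u bv bt true be ps).
Proof.
move=> lu k cu; apply: hoare_read => s0 [iv cv0' _ _ _ _ _]; rewrite cv0'.
have [vc _ [_ tk]] := k.
apply: hoare_when => [np|/negbNE hp]; last first.
  move=> s [->{s} [iv' cv hv ht hl he hps]]; split=> // _ _; left.
  by rewrite cv.
apply: (@hoare_pre (running u bv bt bl be ps)) => [s [] //|].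
case: (valid_tcP vc) => [[q [cq _ vq lt]]|[T [cq cT vT le]]]; rewrite cq.
  by apply: hoare_issue => //; apply: valid_proposal_newtc.
rewrite cT; case e: [seq p <- proposals s0 | p_header p == tip_header T] => [|p x] /=.
  exact: hoare_recover.
have : p \in [seq p <- proposals s0 | p_header p == tip_header T] by rewrite e mem_head.
rewrite mem_filter => /andP[/eqP hp pp].
apply: hoare_issue => //; apply: (valid_proposal_re vc cT) => //.
by have [] := issued_in_block W0_ok (inv_props iv pp).
Qed.

(** Restored by [recover_returns] at the end of every message: a recovery still running means that
    the sought proposal has not been received. *)
Definition no_lookup (s : lstate) := forall r T, r \in recoveries s ->
  tc_high_tip (rec_tc r) = Some T -> lookup (tip_id T) (proposals s) = None.

Lemma hoare_recover_tick r u bv bt bl be ps :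
  hoare (fun s => running u bv bt bl be ps s /\ r \in recoveries s) (recover_tick S now r)
    (running u bv bt bl be ps).
Proof.
move=> s sub [[iv cv hv ht hl he hps] rs].
have kr := inv_rec iv rs.
rewrite /recover_tick /read /andthen /=.
split.
- split=> //=.
  + case: iv; split=> //= r'; rewrite inE mem_filter => /orP[/eqP -> //|/andP[_]].
    exact: inv_rec0.
  + move=> /hl h /= /h[?|[r' r's e]]; [by left|right].
    case: (eqVneq (rec_tc r') (rec_tc r)) => ne; last first.
      by exists r' => //; rewrite inE mem_filter ne r's orbT.
    exists (Recovery (rec_tc r) (rec_rounds r).+1 now); first by rewrite mem_head.
    by rewrite /= -ne.
- exact: evolve_frame.
- case: kr => kc _ _ _ mr x /mapP[j _ ->] /=; split=> //.
  exact: sub.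
Qed.

Lemma recover_tick_no_lookup r s : r \in recoveries s -> no_lookup s ->
  no_lookup (recover_tick S now r s).1.
Proof.
move=> rs h r' T; rewrite /recover_tick /read /andthen /= inE mem_filter.
move=> /orP[/eqP ->|/andP[_]] /=; exact: h.
Qed.

(** The state-independent part of [inv_rec]; it stays true of the recoveries listed at the start
    while the loop over them removes some. *)
Definition recovery_ok (r : recovery R f Hash) :=
  [/\ known_cert W0 W (CertTC (rec_tc r)), tc_high_qc (rec_tc r) = None
    & leader f (tc_view (rec_tc r)).+1 = i].

Lemma hoare_drop_recovery c u bv bt bl be ps :
  hoare (running u bv bt bl be ps)
    (@update R f Payload Hash (fun s => set_recoveries [seq r' <- recoveries s | rec_tc
      r' != c] s))
    (running u bv bt (bl && (u != (tc_view c).+1)) be ps).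
Proof.
apply: hoare_update => s [iv cv hv ht hl he hps]; split; last exact: evolve_frame.
split=> //=.
- by case: iv; split=> //= r; rewrite mem_filter => /andP[_]; exact: inv_rec0.
- move=> /andP[/hl h uc] /= /h[?|[r' r's e]]; [by left|right].
  exists r' => //; rewrite mem_filter r's andbT; apply: contraNneq uc => <-.
  by rewrite e cv.
Qed.

(** Dropping a recovery can destroy the witness of [leader_served] only if it concerns the current
    view, and precisely then a proposal is issued in its place. *)
Lemma hoare_recover_return r u bv bt be ps : recovery_ok r ->
  hoare (running u bv bt true be ps) (recover_return S i r) (running u bv bt true be ps).
Proof.
move=> [kc cq lr]; apply: hoare_read => s0 [iv0 cv _ _ _ _ _].
have [vc _ [_ tk]] := kc.
case: (valid_tcP vc) => [[q [e]]|[T [_ cT vT /andP[T0 Tle]]]]; first by rewrite cq in e.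
cbv zeta; rewrite cT.
have ret a : bmono a ->
  (u = (tc_view (rec_tc r)).+1 -> hoare (running u bv bt false be ps) a (running u bv bt
    true be ps)) ->
  hoare (fun s => s = s0 /\ running u bv bt true be ps s)
   (update (set_recoveries [seq r' <- recoveries s0 | rec_tc r' != rec_tc r]) ;;
    when (cur_view s0 == (tc_view (rec_tc r)).+1) a) (running u bv bt true be ps).
  move=> ma ha; apply: (@hoare_seq _ _ (running u bv bt (true && (u != (tc_view (rec_tc
    r)).+1)) be ps)).
  - exact: bmono_when.
  - move=> s sub [e Ps]; subst s0;
    exact (@hoare_drop_recovery (rec_tc r) u bv bt true be ps s sub Ps).
  - rewrite cv; case: eqVneq => [e|ne]; first exact: ha.
    by apply: hoare_skip.
case el: (lookup (tip_id T) (proposals s0)) => [p|].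
  have [pp pid] := lookupP el; have ip := inv_props iv0 pp.
  apply: ret => [|eu]; first exact: bmono_issue.
  apply: hoare_issue => //; first by rewrite eu.
  apply: (valid_proposal_re vc cT) => //; last by rewrite eu.
    by have [] := issued_in_block W0_ok ip.
  by have [] := issued_in_tip hash_inj W0_ok ip vT T0 pid.
apply: hoare_when => [le|_ s [] //].
set sgs := [seq sg <- ne_sigs s0 | _] in le *.
apply: ret => [|eu]; first exact: bmono_issue.
rewrite cv; apply: hoare_issue => //; first by rewrite eu.
have [vh eid hv lt vq] := valid_tipP vT T0.
apply: valid_proposal_nec => //; last by rewrite eu.
rewrite /valid_nec /=; apply/andP; split; first by lia.
apply/and3P; split.
- by rewrite size_take_min (minn_idPl le).
- rewrite map_inj_in_uniq ?take_uniq ?filter_uniq ?(inv_ne iv0) //.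
  move=> [? ?] [? ?] /mem_take + /mem_take; rewrite !mem_filter /=.
  by move=> /andP[/eqP -> _] /andP[/eqP -> _] ->.
- by apply/allP => sg /mem_take; rewrite mem_filter => /andP[].
Qed.

Lemma recover_return_effect r (s : lstate) : let s' := (recover_return S i r s).1 in
  [/\ proposals s' = proposals s, {subset recoveries s' <= recoveries s}
    & forall T, tc_high_tip (rec_tc r) = Some T -> lookup (tip_id T) (proposals s) <> None ->
        forall r', r' \in recoveries s' -> rec_tc r' <> rec_tc r].
Proof.
rewrite /recover_return /read; cbv zeta.
have iss_eff b o1 o2 (s1 : lstate) : proposals (issue S i b o1 o2 s1).1 = proposals s1 /\
    recoveries (issue S i b o1 o2 s1).1 = recoveries s1.
  by rewrite /issue /read /when; case: ifP.
have ret b o1 o2 (a := issue S i b o1 o2) cond (s1 : lstate) :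
  let s' := ((update (set_recoveries [seq r' <- recoveries s1 | rec_tc r' != rec_tc r]) ;;
     when cond a) s1).1 in
  [/\ proposals s' = proposals s1, {subset recoveries s' <= recoveries s1}
    & forall r', r' \in recoveries s' -> rec_tc r' <> rec_tc r].
  have key (s2 : lstate) : proposals (when cond a s2).1 = proposals s2 /\
     recoveries (when cond a s2).1 = recoveries s2.
    by rewrite /when; case: cond => //; apply: iss_eff.
  rewrite /andthen /=;
    move: (key (set_recoveries [seq r' <- recoveries s1 | rec_tc r' != rec_tc r] s1)).
  case: (when cond a _) => s3 o3 /= [-> ->] /=; split=> //.
    by move=> x; rewrite mem_filter => /andP[].
  by move=> x; rewrite mem_filter => /andP[/eqP].
case: (tc_high_tip (rec_tc r)) => [T|] /=; last by split.
case el: (lookup (tip_id T) (proposals s)) => [p|].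
  by have [? ? h] := ret (p_block p) (Some (rec_tc r)) None (cur_view s == (tc_view
    (rec_tc r)).+1) s; split.
rewrite {1 2 3}/when; case: ifP => _ /=; last by split=> // T' [<-].
match goal with |- context [issue S i ?b ?o1 ?o2] =>
 have [? ? h] := ret b o1 o2 (cur_view s == (tc_view (rec_tc r)).+1) s end.
by split=> // T' [<-].
Qed.

(** The loop leaves the stored proposals alone and only removes recoveries, so a lookup that
    succeeds at the start still succeeds when the turn of its recovery comes. *)
Lemma recover_returns_no_lookup (s : lstate) : no_lookup (recover_returns S i s).1.
Proof.
rewrite /recover_returns /read.
suff key rs (s1 : lstate) : let s' := (foldr (fun r a => recover_return S i r ;; a)
    (@skip R f Payload Hash) rs s1).1 in
  [/\ proposals s' = proposals s1, {subset recoveries s' <= recoveries s1}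
    & forall r T, r \in rs -> tc_high_tip (rec_tc r) = Some T ->
       lookup (tip_id T) (proposals s1) <> None ->
        forall r', r' \in recoveries s' -> rec_tc r' <> rec_tc r].
  have [ep sub h] := key (recoveries s) s.
  move=> r T rs eT; rewrite ep; apply: contrapT => nl.
  exact: (h r T (sub _ rs) eT nl r rs).
elim: rs s1 => [|r rs IH] s1 /=; first by split.
have [ep1 sub1 h1] := recover_return_effect r s1.
rewrite /andthen; case: (recover_return S i r s1) ep1 sub1 h1 => s2 o2 /= ep1 sub1 h1.
have [ep2 sub2 h2] := IH s2.
case: (foldr _ _ _ s2) ep2 sub2 h2 => s3 o3 /= ep2 sub2 h2.
split; first by rewrite ep2.
  by move=> x /sub2/sub1.
move=> r' T; rewrite inE => /orP[/eqP ->|r'rs] eT nl x xs; last first.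
  by apply: (h2 _ _ r'rs eT) => //; rewrite ep1.
by apply: (h1 _ eT nl) => //; apply: sub2.
Qed.

Lemma hoare_recover_returns u bv bt be ps :
  hoare (running u bv bt true be ps) (recover_returns S i) (running u bv bt true be ps).
Proof.
apply: hoare_read => s0 [iv0 cv _ _ _ _ _].
apply: (@hoare_pre (running u bv bt true be ps)) => [s [] //|].
have : {in recoveries s0, forall r, recovery_ok r}.
  by move=> r /(inv_rec iv0)[? ? ? _ _].
elim: (recoveries s0) => [|r rs IH] h /=; first exact: hoare_skip.
apply: hoare_seq.
- by apply: bmono_foldr => r'; apply: bmono_recover_return.
- by apply: hoare_recover_return; apply: h; rewrite mem_head.
- by apply: IH => r' r's; apply: h; rewrite inE r's orbT.
Qed.

Lemma hoare_timeout_view u bv bt bl be ps : cause u ->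
  hoare (running u bv bt bl be ps) (timeout_view S i) (running u bv bt bl be ps).
Proof.
move=> ev s sub [iv cv hv ht hl he hps]; move: sub.
rewrite /timeout_view /read /when; cbv zeta.
case: ifP => [nto|_] sub; last by split=> //; apply: evolve_refl.
set q := last_qc s in sub *; set T := local_tip s in sub *.
set cer := (if (qc_view q).+1 == cur_view s then CertQC q else _) in sub *.
have [kq qlt] := inv_qc iv; have itc := inv_tc iv; have ic := inv_cert iv.
(* By [inv_cert] one of the two stored certificates is of the preceding view, so the final default
   in [cer] is never reached. *)
have [kcer vcer] : known_cert W0 W cer /\ (cert_view cer).+1 = cur_view s.
  rewrite /cer; case: eqP => [e|ne] //.
  by case: ic => [//|[c [e1 e2]]]; rewrite e1; split=> //; apply: itc.
have [vcc _ _] := kcer.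
have gen (M : timeout) (s1 : lstate) :
   s1 = set_broadcasts (MTimeout Payload M :: broadcasts s) (set_highest_voted_view
     (cur_view s)
     (set_voted_ids (voted_ids s1) s)) ->
   {subset broadcasts s1 <= W i} ->
   m_last_cer M = cer -> m_view M = cur_view s -> valid_timeout S M ->
   signer (m_sig M) = i ->
   (forall T, m_tip M = Some T -> tip_backed S W0 T /\ 0 < tip_view T) ->
   (forall w, m_tip_vote M = Some w -> signer (vt_sig w) = i) ->
   [/\ running u bv bt bl be ps s1,
      evolve s s1 [seq (j, MTimeout Payload M) | j <- enum 'I_(3 * f).+1]
    & forall x, x \in [seq (j, MTimeout Payload M) | j <- enum 'I_(3 * f).+1] ->
       msg_ok S W0 W i x.2].
  move=> es1 sub1 ecer ev' vM sM tM wM.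
  have mb m : m \in MTimeout Payload M :: broadcasts s -> m = MTimeout Payload M \/ m \in
    broadcasts s.
    by rewrite inE => /orP[/eqP|]; [left|right].
  move: sub1; rewrite es1 => sub1.
  split.
  - split=> //=; case: iv; split=> //=.
    * by move=> r /inv_rec0[? ? ? ? h]; split=> //; rewrite inE h orbT.
    * by move=> p' /mb[//|/inv_bprop0 //].
    * by move=> p1 p2 /mb[//|h1] /mb[//|h2] //= e; exact: inv_buniq0.
    * by move=> M' /mb[[->]|/inv_bto0 //]; rewrite ev' cv sM.
    * by move=> M' /mb[//|/inv_bne0 //].
    * by move=> m' /inv_W1 h; rewrite inE h orbT.
  - split=> //=; try by constructor 1.
    * by move=> x h; rewrite inE h orbT.
    * exact: inv_hv.
    * move=> m /mb[->|]; last by left.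
      by right=> j; rewrite map_f // mem_enum.
    * by move=> p' /mb[//|]; left.
    * by constructor 2; exists M; rewrite mem_head.
  - move=> x /mapP[j _ ->] /=; rewrite ecer; split=> //; split=> //.
    * by rewrite sM; apply: sub1; rewrite /= mem_head.
    * by move=> T' /tM[/(tip_backed_mono W0W)].
    * by move=> w /wM ->.
have [vq _ _] := kq; rewrite /= -/q in vq qlt.
move: sub; case: leqP => [Tq|qT]; rewrite /andthen /= => sub.
  apply: gen => //; try by case: (s).
  by rewrite /valid_timeout /= vcc vcer eqxx /= vq qlt eqxx.
have [vT Tle tok] := inv_tip iv.
apply: gen => //.
- rewrite /valid_timeout /= vcc vcer eqxx /= /valid_vote /= !eqxx vT Tle.
  by [].
- by move=> T' /= [<-]; split=> //; apply: leq_ltn_trans qT.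
- by move=> w /= [<-].
Qed.

(** * Triples of the message handlers *)

Lemma running_lead u bv bt bl be ps s :
  (leader f u = i -> leader_served s) -> running u bv bt bl be ps s -> running u bv bt
    true be ps s.
Proof.
move=> h [iv cv hv ht hl he hps]; split=> // _ lc.
by apply: h => //; rewrite -cv.
Qed.

Lemma running_weak u bv bt (bl be : bool) ps bv' bt' (bl' be' : bool) ps' s :
  bv <= bv' -> bt <= bt' -> (bl' -> bl) -> (be' -> be) -> {subset ps' <= ps} ->
  running u bv bt bl be ps s -> running u bv' bt' bl' be' ps' s.
Proof.
move=> le1 le2 l1 l2 sub [iv cv hv ht hl he hps]; split=> //.
- by move=> w ws le; apply: hv => //; apply: leq_trans le.
- by move=> v le; apply: ht; apply: leq_trans le.
- by move=> /l1.
- by move=> /l2.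
- by move=> p /sub/hps.
Qed.

(** The state between handlers: both thresholds are at the current view and no duty is left. *)
Definition boundary (s : lstate) :=
  running (cur_view s) (cur_view s) (cur_view s) true true [::] s.

Lemma running_boundary u bv bt ps s : bv <= u -> bt <= u ->
  running u bv bt true true ps s -> boundary s.
Proof.
by move=> l1 l2 m; have [_ cv _ _ _ _ _] := m; rewrite /boundary cv; apply: running_weak m.
Qed.

(* What the delivery of [m] from [j] achieves for good. *)
Definition effect (j : validator) (m : msg) (s : lstate) : Prop :=
  match m with
  | MProposal p => p \in proposals s /\
      (j = leader f (p_view p) -> valid_proposal S p ->
       p_view p < cur_view s \/ cur_view s = p_view p /\ p_view p <= highest_voted_view s)
  | MVote w => i = leader f (vt_view w) \/ i = leader f (vt_view w).+1 ->
      vt_view w < cur_view s \/ w \in votes s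
  | MQC q => j = leader f (qc_view q) -> qc_view q < cur_view s
  | MTimeout M => m_view M < cur_view s \/
      exists M', [/\ M' \in timeouts s,
        m_view M' = m_view M & signer (m_sig M') = signer (m_sig M)]
  | _ => True
  end.

Lemma evolve_cv s s' o : evolve s s' o -> cur_view s <= cur_view s'.
Proof. by case=> _ _ _ _ _ [[->]|[/ltnW]]. Qed.

Lemma effect_stable j m : stable (effect j m).
Proof.
move=> s s' o ev; have cv := evolve_cv ev.
case: m => //= [p|w|q|M].
- move=> [/(ev_props ev) pp h]; split=> // e vp.
  case: (h e vp) => [lt|[e1 le]]; first by left; apply: leq_trans cv.
  have le' := leq_trans le (ev_hv ev).
  case: (ev_cv ev) => [[e2 _]|[lt _]]; [right|left]; last by rewrite -e1.
  by rewrite e2.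
- move=> h /h[lt|/(ev_votes ev)]; [left|by right]; exact: leq_trans cv.
- by move=> h /h lt; apply: leq_trans cv.
- case=> [lt|[M' [/(ev_to ev) ? ? ?]]]; first by left; apply: leq_trans cv.
  by right; exists M'.
Qed.

Definition absorbed (m : msg) : seq proposal :=
  flatten [seq pointed_by iss q | q <- qcs_of_msg m].

Lemma absorbed_sub m q : q \in qcs_of_msg m -> {subset pointed_by iss q <= absorbed m}.
Proof. by move=> qm p pq; apply/flattenP; exists (pointed_by iss q) => //; apply: map_f. Qed.

Lemma hoare_obtains qs u bv bt bl be ps :
  hoare (running u bv bt bl be ps)
    (foldr (fun q a => @obtain R f Payload Hash iss q ;; a) (@skip R f Payload Hash) qs)
    (running u bv bt bl be (ps ++ flatten [seq pointed_by iss q | q <- qs])).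
Proof.
elim: qs ps => [|q qs IH] ps /=; first by rewrite cats0; apply: hoare_skip.
apply: hoare_seq; [|exact: hoare_obtain|rewrite catA; exact: IH].
by apply: bmono_foldr => ?; bmono.
Qed.

Lemma hoare_absorb j m u bv bt bl be : msg_ok S W0 W0 j m ->
  hoare (running u bv bt bl be [::]) (absorb iss m)
    (fun s => running u bv bt bl be (absorbed m) s /\ (if m is MProposal p then p \in
      proposals s else true)).
Proof.
move=> mok; rewrite /absorb.
pose F (s : lstate) : Prop := if m is MProposal p then p \in proposals s else true.
have stF : stable F by move=> s s' o ev; rewrite /F; case: (m) => // p; apply: (ev_props ev).
apply: (@hoare_seq _ _ (fun s => running u bv bt bl be [::] s /\ F s)).
- by apply: bmono_foldr => ?; bmono.
- rewrite /F; case: (m) mok => [p|w|q|M|c|c|c|sg] mok; try by apply: hoare_skip.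
  apply: hoare_update => s [iv cv hv ht hl he hps]; split; last first.
    by apply: evolve_frame => // p' /= h; rewrite mem_rcons inE h orbT.
  split; last by rewrite /= mem_rcons mem_head.
  split=> //; case: iv; split=> //= p'; rewrite mem_rcons inE => /orP[/eqP ->//|].
  exact: inv_props0.
- exact (hoare_stable stF (@hoare_obtains (qcs_of_msg m) u bv bt bl be [::])).
Qed.

Local Notation start ps := (running cv0 cv0 cv0 true true ps).

(** For a reproposal the new local tip is the high tip of the TC, which has the header of [p]; so in
    either case the vote carries the id of [p]. *)
Lemma hoare_add_vote_block p u bv bt be ps : issued_in W0 p -> valid_proposal S p ->
  u = p_view p ->
  hoare (running u bv bt true be ps)
    (@update R f Payload Hash
       (if (if fresh p then Some (tip_of p) else if p_tc p is Some c then tc_high_tip c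
         else None)
          is Some T then set_local_tip T else id) ;;
     read (fun s' =>
        let v := cur_view s' in
        let w := make_vote S i v (h_hash (tip_header (local_tip s'))) in
        @send R f Payload Hash (leader f v) (MVote Payload w) ;;
        @send R f Payload Hash (leader f v.+1) (MVote Payload w) ;;
        @log_vote R f Payload Hash w ;;
        @update R f Payload Hash (set_highest_voted_view v)))
    (fun s => running u bv bt true be ps s /\ highest_voted_view s = u).
Proof.
move=> ip vp eu s sub [iv cv hv ht hl he hps].
have [mp _ kp] : [/\ MProposal p \in W0 (leader f (p_view p)),
  valid_proposal S p & known_cert W0 W0 (pcert p)].
  case: (issued_in_valid W0_ok ip) => // e; have := valid_proposal_view vp.
  by rewrite e.
have [T [eT vT Tle [Tok hT]]] : exists T,
   [/\ (if fresh p then Some (tip_of p) else if p_tc p is Some c then tc_high_tip c else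
     None) = Some T,
     valid_tip S T, tip_view T <= u & tip_backed S W0 T /\ tip_header T = p_header p].
  case: ifP => fr.
    exists (tip_of p); split=> //; first exact: valid_proposal_tip.
      by rewrite eu.
    by split=> //; exists p.
  have [c [T [pc cT vc ev eh]]] := valid_proposal_reproposal vp (negbT fr).
  move: kp; rewrite /pcert pc => -[_ _ [_ tk]].
  exists T; split=> //; last by split=> //; apply: tk.
    by case: (valid_tcP vc) => [[q [_ e]]|[T' [_ e vT _]]]; rewrite cT in e => //;
      case: e => ->.
  case: (valid_tcP vc) => [[q [_ e]]|[T' [_ e _ le]]]; rewrite cT in e => //; case: e => ->.
  by rewrite eu ev; case/andP: le => _ /leqW.
move: sub; rewrite eT /read /andthen /= => sub.
split.
- split=> //; split=> //; case: iv; split=> //=.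
  by split=> //; rewrite cv.
- split=> //=; try by constructor 1.
  + exact: inv_hv.
  + by constructor 3; exists p; rewrite hT cv /=; split=> //; rewrite ?inE ?eqxx ?orbT.
- rewrite hT cv => x; rewrite !inE => h.
  have -> : x.2 = MVote Payload (make_vote S i u (h_hash (p_header p))).
    by case/orP: h => /eqP ->.
  split; first by rewrite /valid_vote /= !eqxx.
  right; exists p; split=> //; first exact: (issued_in_mono W0W).
  by rewrite (valid_proposal_id vp) /= -eu.
Qed.

Lemma valid_proposal_nextqc p : valid_proposal S p -> (qc_view (p_qc p)).+1 = p_view p ->
  p_tc p = None.
Proof.
move=> vp e; have fr : fresh p by rewrite /fresh e eqxx.
have := valid_proposal_tip vp fr; rewrite /tip_of /= -/(tip_of p) (fresh_tip_nongenesis vp) /=.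
by rewrite -e eqxx => /and5P[_ _ _ _ /andP[_ /andP[/eqP]]].
Qed.

Lemma hoare_on_proposal j p ps : issued_in W0 p ->
  {subset pointed_by iss (p_qc p) <= ps} ->
  hoare (start ps) (on_proposal S i now j p) (fun s => boundary s /\
     (j = leader f (p_view p) -> valid_proposal S p ->
       p_view p < cur_view s \/ cur_view s = p_view p /\ p_view p <= highest_voted_view s)).
Proof.
move=> ip sub; apply: hoare_read => s0 [iv0 cvs0 _ _ _ _ _]; rewrite cvs0.
apply: hoare_when => [/and3P[vp /eqP ej cle]|g s [_ m]]; last first.
  split; first exact: running_boundary m.
  move=> e vp; left; have [_ -> _ _ _ _ _] := m.
  by move: g; rewrite vp e eqxx /= -ltnNge.
have [mp _ kp] : [/\ MProposal p \in W0 (leader f (p_view p)),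
  valid_proposal S p & known_cert W0 W0 (pcert p)].
  case: (issued_in_valid W0_ok ip) => // e; have := valid_proposal_view vp.
  by rewrite e.
have kW := known_cert_monor W0W kp.
have [vc ec] := valid_proposal_cert vp.
pose F (s : lstate) := highest_voted_view s0 <= highest_voted_view s.
have stF : stable F by move=> s s' o ev le; apply: leq_trans (ev_hv ev).
apply: (@hoare_pre (fun s => start ps s /\ F s)) => [s [-> ?]|]; first by split=> //;
  rewrite /F.
set blk := when (highest_voted_view s0 < p_view p) _.
have bblk : bmono blk.
  rewrite /blk; bmono => s m; rewrite /update /=.
  by case: (fresh p) => //; case: (p_tc p) => //= c; case: (tc_high_tip c).
(* Commits are still owed exactly when a new view has been entered by a QC. *)
pose be1 := if cv0 == p_view p then true else if pcert p is CertTC _ then true else false.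
apply: (@hoare_seq _ _ (fun s => running (p_view p) cv0 cv0 true be1 ps s /\ F s));
  first by bmono.
  apply: hoare_stable => //.
  have := @hoare_enter (pcert p) cv0 cv0 cv0 true true ps kW; rewrite ec => /(_ cle).
  rewrite -/be1 => en; apply: (hoare_post _ en) => s m.
  (* If [i] leads the view of [p], then [p] is its own proposal. *)
  apply: (running_lead _ m) => le _; left; have [iv cv _ _ _ _ _] := m.
  apply/hasP; exists (MProposal p); last by rewrite cv.
  by apply: (inv_W0 iv); rewrite -le.
have tcN := valid_proposal_nextqc vp.
apply: (@hoare_seq _ _ (fun s => running (p_view p) cv0 cv0 true be1 ps s /\ F s));
  first by bmono.
  apply: hoare_stable => //; apply: hoare_when => [/eqP e|//].
  have kq : known_cert W0 W (CertQC (p_qc p)) by move: kW; rewrite /pcert tcN.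
  apply: hoare_seq; [by bmono| |exact: hoare_send].
  by apply: hoare_when => // _; apply: hoare_broadcast_qc.
apply: (@hoare_seq _ _ (fun s => running (p_view p) cv0 cv0 true true ps s /\ F s)) => //.
  apply: hoare_stable => //.
  have be1T : be1 || ((qc_view (p_qc p)).+1 == p_view p).
    by rewrite /be1 -ec /pcert; case: ifP => // _; case: (p_tc p) => //=.
  rewrite -be1T; apply: hoare_commit => nb; split=> //.
  by move: kp nb; rewrite /be1 /pcert; case: ifP => // _; case: (p_tc p) => // -[].
rewrite /blk; apply: hoare_when => [_|le s [m le']].
  apply: (@hoare_pre (running (p_view p) cv0 cv0 true true ps)) => [s [] //|].
  apply: (hoare_post _ (@hoare_add_vote_block p (p_view p) cv0 cv0 true ps ip vp erefl))
    => s [m hv].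
  split; first exact: running_boundary m.
  by move=> _ _; right; rewrite hv; have [_ -> _ _ _ _ _] := m.
split; first exact: running_boundary m.
move=> _ _; right; have [_ -> _ _ _ _ _] := m; split=> //.
by apply: leq_trans le'; rewrite leqNgt.
Qed.

Lemma hoare_commit_entry q u bv bt bl be ps : (qc_view q).+1 = u ->
  id_backed S W0 (qc_view q) (qc_id q) -> {subset pointed_by iss q <= ps} ->
  hoare (running u bv bt bl be ps) (@commit R f Payload Hash q) (running u bv bt bl true ps).
Proof.
move=> qu vid sub; have := @hoare_commit q u bv bt bl be ps (fun _ => conj vid sub).
by rewrite qu eqxx orbT.
Qed.

(** Either the leader of the view broadcasts the QC or the next leader broadcasts a proposal on it;
    both back the entry. This is computed directly, because the triples for these very actions
    presuppose [known_cert] for the QC. *)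
Lemma on_vote_tail_broadcasts q (s : lstate) : cur_view s <= qc_view q ->
  let s' := (@obtain R f Payload Hash iss q ;; enter now (CertQC q) ;;
    @commit R f Payload Hash q ;;
      if i == leader f (qc_view q) then @broadcast_qc R f Payload Hash q else propose_qc
        S i q) s in
  (i == leader f (qc_view q) -> MQC Payload q \in broadcasts s'.1) /\
  (i != leader f (qc_view q) ->
     exists p, MProposal p \in broadcasts s'.1 /\ p_view p = (qc_view q).+1).
Proof.
move=> le; rewrite /andthen /obtain /update /enter /read /when /= le /=.
set s1 := set_last_qc _ _.
have cv1 : cur_view s1 = (qc_view q).+1 by [].
have [sp [cm [-> _]]] := commitE q s1.
have cv2 : cur_view (set_committed cm (set_speculative sp s1)) = (qc_view q).+1 by [].
move: (set_committed _ _) cv2 => s2 cv2.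
case: (i == leader f (qc_view q)); split=> // _.
  rewrite /broadcast_qc /read /when; case: ifP => [_|/negbFE h] //=.
  by rewrite mem_head.
rewrite /propose_qc /issue /read /when cv2; case: ifP => [_|/negbFE] /=.
  exists (mk_proposal S i (qc_view q).+1 (new_block S (qc_view q).+1 q) None None).
  by split=> //; apply: mem_head.
case/hasP => -[p|||||||] // pin /eqP e; by exists p.
Qed.

Lemma hoare_on_vote j w ps : valid_vote S w -> id_backed S W0 (vt_view w) (vt_id w) ->
  hoare (start ps) (on_vote S i now iss w)
    (fun s => boundary s /\ effect j (MVote Payload w) s).
Proof.
move=> vw vidw; apply: hoare_read => s0 [iv0 cvs0 hv0 _ _ _ _]; rewrite cvs0 vw /=.
apply: hoare_when => [/andP[cle il]|g s [_ m]]; last first.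
  split; first exact: running_boundary m.
  have [_ -> _ _ _ _ _] := m; move: g; rewrite negb_and -ltnNge => /orP[->|g]; first by left.
  by move=> /= e; move: g; case: e => ->; rewrite eqxx ?orbT.
set ws := add_vote w (votes s0).
have [uv vv] := inv_votes iv0.
have uws : uniq ws by rewrite /ws /add_vote; case: ifP => // h; rewrite rcons_uniq h.
have vws w' : w' \in ws -> valid_vote S w' /\ id_backed S W0 (vt_view w') (vt_id w').
  rewrite /ws /add_vote; case: ifP => _; first exact: vv.
  by rewrite mem_rcons inE => /orP[/eqP ->|/vv].
have wws : w \in ws by rewrite /ws /add_vote; case: ifP => // _; rewrite mem_rcons mem_head.
(* Only the id of [w] can newly reach a quorum. *)
have cnt w' : w' \in ws -> cv0 <= vt_view w' -> vt_id w' <> vt_id w ->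
    size [seq x <- ws | vt_id x == vt_id w'] < quorum.
  move=> w's le ne.
  have w'v : w' \in votes s0.
    move: w's; rewrite /ws /add_vote; case: ifP => // _.
    by rewrite mem_rcons inE => /orP[/eqP e|//]; rewrite e in ne.
  have -> : [seq x <- ws | vt_id x == vt_id w'] = [seq x <- votes s0 | vt_id x == vt_id w'].
    rewrite /ws /add_vote; case: ifP => // _; rewrite filter_rcons.
    by case: eqP => // e; case: ne.
  exact: hv0.
(* If [w] completes a quorum, its view is exempted from the vote bound until [enter] moves beyond
   it. *)
pose b := if form_qc w ws is Some _ then (vt_view w).+1 else cv0.
apply: (@hoare_seq _ _ (fun s => running cv0 b cv0 true true ps s /\ votes s = ws)).
- by destruct (form_qc w ws); bmono; case: ifP => _; bmono.
- apply: hoare_update => s [-> [iv cv hv ht hl he hps]]; split; last first.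
    apply: evolve_frame => //= x xs; rewrite /ws /add_vote; case: ifP => // _.
    by rewrite mem_rcons inE xs orbT.
  split=> //; split=> //=; first by case: iv; split.
  move=> w' w's /=; rewrite /b; case ef: (form_qc w ws) => [q|] le.
    apply: cnt => //; first by apply: leq_trans le; lia.
    move=> e; have [vw' _] := vws _ w's.
    have [e' _] := vote_id_inj hash_inj vw' vw e.
    by rewrite e' ltnn in le.
  case: (eqVneq (vt_id w') (vt_id w)) => [->|/eqP]; last exact: cnt.
  by move: ef; rewrite /form_qc; case: leqP.
rewrite /b; case ef: (form_qc w ws) => [q|]; last first.
  apply: hoare_skip => s [m ev]; split; first exact: running_boundary m.
  by move=> _; right; rewrite ev.
have [vq qv qi _] := form_qcP hash_inj uws (fun w' h => (vws w' h).1) vw ef.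
rewrite -qv in cle il *.
move=> s sub [m _]; have [_ cvs _ _ _ _ _] := m.
have kq : known_cert W0 W (CertQC q).
  split=> //=; last by rewrite qv qi.
  have := @on_vote_tail_broadcasts q s; rewrite cvs => /(_ cle)[h1 h2].
  case: (boolP (i == leader f (qc_view q))) => [e|ne].
    constructor 3; exists q; split=> //; rewrite /= -(eqP e); apply: sub.
    exact: h1.
  have [p [pin pv]] := h2 ne.
  by constructor 4; exists p; split=> //; right; exists i; apply: sub.
move: s sub {cvs} m; change (hoare (running cv0 (qc_view q).+1 cv0 true true ps)
  (@obtain R f Payload Hash iss q ;; enter now (CertQC q) ;; @commit R f Payload Hash q ;;
      if i == leader f (qc_view q) then @broadcast_qc R f Payload Hash q else propose_qc S i q)
  (fun s => boundary s /\ (i = leader f (qc_view q) \/ i = leader f (qc_view q).+1 ->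
     qc_view q < cur_view s \/ w \in votes s))).
apply: hoare_seq; [by bmono|exact: hoare_obtain|].
apply: hoare_seq; [by bmono|apply: (hoare_enter kq); rewrite /= ?ule ?leW ?leqW //|].
have -> : (cv0 == (cert_view (CertQC q)).+1) = false by rewrite /=; lia.
apply: hoare_seq; [by bmono| |].
  apply: hoare_commit_entry => //; first by rewrite qv qi.
  by move=> p h; rewrite mem_cat h orbT.
rewrite /=.
apply: (@hoare_post (running (qc_view q).+1 (qc_view q).+1 cv0 true true (ps ++
  pointed_by iss q))) => [s m|].
  split; first by apply: running_boundary m => //; lia.
  by have [_ -> _ _ _ _ _] := m; left.
case: ifP il => [/eqP il _|_ /= /eqP il].
  apply: (@hoare_pre (running (qc_view q).+1 (qc_view q).+1 cv0 true true (ps ++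
    pointed_by iss q))).
    (* As leader of the view of [q], [i] does not lead the next one and owes no proposal there. *)
    move=> s; apply: running_lead => il'; have := leader_succ_neq (qc_view q) f_gt0.
    by rewrite -il il' eqxx.
  exact: hoare_broadcast_qc.
exact: hoare_propose_qc.
Qed.

Lemma hoare_enter_new c ps : known_cert W0 W c -> cv0 <= cert_view c ->
  hoare (start ps) (enter now c)
    (running (cert_view c).+1 cv0 cv0 false (if c is CertTC _ then true else false) ps).
Proof.
move=> kc le; have := @hoare_enter c cv0 cv0 cv0 true true ps kc (leqW le).
by have -> : (cv0 == (cert_view c).+1) = false by lia.
Qed.

Lemma hoare_on_qc j q ps : known_cert W0 W (CertQC q) -> {subset pointed_by iss q <= ps} ->
  hoare (start ps) (on_qc S i now j q) (fun s => boundary s /\ effect j (MQC Payload q) s).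
Proof.
move=> kq sub; apply: hoare_read => s0 [iv0 cvs0 _ _ _ _ _]; rewrite cvs0.
have [vq _ vid] := kq; rewrite /= in vq vid.
rewrite vq /=; apply: hoare_when => [le|g s [_ m]]; last first.
  split; first exact: running_boundary m.
  by move=> _; have [_ -> _ _ _ _ _] := m; rewrite ltnNge.
apply: (@hoare_pre (start ps)) => [s [] //|].
have ent u bl be : u <= (qc_view q).+1 -> hoare (running u cv0 cv0 bl be ps)
    (enter now (CertQC q) ;; @commit R f Payload Hash q)
    (running (qc_view q).+1 cv0 cv0 (bl && (u == (qc_view q).+1)) true ps).
  move=> ule; apply: hoare_seq; [by bmono|apply: (hoare_enter kq);
    rewrite /= ?ule ?leW ?leqW //|].
  exact: hoare_commit_entry.
have leW : cv0 <= (qc_view q).+1 by exact: leqW.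
(* The view after the part of the handler that depends on the sender; the duties of the leader of
   [cv0] remain fulfilled if that part changed nothing. *)
pose u := if j == leader f (qc_view q) then (qc_view q).+1 else cv0.
have uv : u <= (qc_view q).+1 by rewrite /u; case: ifP.
apply: (@hoare_seq _ _ (running u cv0 cv0 (u == cv0) true ps)).
- by bmono.
- rewrite /u; apply: hoare_when => [-> |/negbTE -> s]; last by rewrite eqxx.
  have -> : ((qc_view q).+1 == cv0) = (true && (cv0 == (qc_view q).+1)) by rewrite eq_sym.
  apply: hoare_seq; [by bmono|apply: (hoare_enter kq); rewrite /= ?ule ?leW ?leqW //|].
  apply: hoare_seq; [by bmono| |exact: hoare_send].
  exact: hoare_commit_entry.
apply: (@hoare_seq _ _ (running u cv0 cv0 (u == cv0) true ps)).
- by bmono.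
- by apply: hoare_when => [_|//]; apply: hoare_broadcast_qc.
have eff s : cur_view s = u -> effect j (MQC Payload q) s.
  by move=> cv /= e; rewrite cv /u e eqxx.
apply: hoare_when => [/eqP il|nl s m]; last first.
  split; last by apply: eff; case: m.
  have [_ cv _ _ _ _ _] := m.
  apply: (@running_boundary u cv0 cv0 ps) => //; try by rewrite /u; case: ifP.
  move: m; rewrite /u; case: ifP => jl; last by rewrite eqxx.
  by apply: running_lead => e; rewrite e eqxx in nl.
apply: (@hoare_post (running (qc_view q).+1 cv0 cv0 true true ps)) => [s m|].
  split; first exact: running_boundary m.
  by have [_ cv _ _ _ _ _] := m; move=> /= _; rewrite cv.
move=> s sb m.
have := @hoare_seq (running u cv0 cv0 (u == cv0) true ps) _ _ (propose_qc S i q)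
  (running (qc_view q).+1 cv0 cv0 true true ps) (bmono_propose_qc S i q) (ent u (u ==
    cv0) true uv)
  (hoare_propose_qc (esym il) kq erefl).
have -> : ((enter now (CertQC q) ;; @commit R f Payload Hash q) ;; propose_qc S i q) =
   (enter now (CertQC q) ;; @commit R f Payload Hash q ;; propose_qc S i q).
  apply/funext => x; rewrite /andthen; case: (enter now (CertQC q) x) => x1 o1.
  case: (commit q x1) => x2 o2; case: (propose_qc S i q x2) => x3 o3.
  by rewrite catA.
by apply.
Qed.

Lemma hoare_on_tc c ps : known_cert W0 W (CertTC c) ->
  hoare (start ps) (on_tc S i now c) boundary.
Proof.
move=> kc; apply: hoare_read => s0 [iv0 cvs0 _ _ _ _ _]; rewrite cvs0.
apply: hoare_when => [/andP[vc le]|_ s [_ m]]; last exact: running_boundary m.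
apply: (@hoare_pre (start ps)) => [s [] //|].
apply: hoare_seq; [by bmono|exact: hoare_enter_new|].
apply: hoare_seq; [by bmono|exact: hoare_broadcast_tc|].
apply: (@hoare_post (running (tc_view c).+1 cv0 cv0 true true ps)) => [s|].
  by apply: running_boundary; exact: leqW.
apply: hoare_when => [/eqP il|nl s]; first exact: hoare_propose_tc.
by apply: running_lead => e; rewrite e eqxx in nl.
Qed.

(** A request never makes a leader enter its own view with nothing proposed: the sender is the
    leader of that view and, having broadcast the request, is already past the view of the TC. *)
Lemma hoare_enter_request (j : validator) c ps : known_cert W0 W (CertTC c) ->
  MNERequest Payload c \in W0 j -> j = leader f (tc_view c).+1 -> cv0 <= (tc_view c).+1 ->
  hoare (start ps) (enter now (CertTC c)) (running (tc_view c).+1 cv0 cv0 true true ps).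
Proof.
move=> kc mj ej le s sub m.
have [iv cv _ _ _ _ _] := m.
have := @hoare_enter (CertTC c) cv0 cv0 cv0 true true ps kc le s sub m.
rewrite /= if_same => -[m' ev mok]; split=> //.
case: (eqVneq cv0 (tc_view c).+1) m' => [->//|ne] m'.
apply: running_lead m' => e.
have : tc_view c < cur_view s by apply: (inv_bne iv); apply: (inv_W0 iv); rewrite -e -ej.
by rewrite cv; lia.
Qed.

Lemma hoare_on_proposal_request (j : validator) c ps : known_cert W0 W (CertTC c) ->
  MNERequest Payload c \in W0 j ->
  hoare (start ps) (on_proposal_request S now j c) boundary.
Proof.
move=> kc mj; apply: hoare_read => s0 [iv0 cvs0 _ _ _ _ _].
apply: hoare_when => [/and4P[_ _ /eqP ej le]|_ s [_ m]]; last exact: running_boundary m.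
rewrite cvs0 in le.
apply: (@hoare_pre (start ps)) => [s [] //|].
apply: (@hoare_post (running (tc_view c).+1 cv0 cv0 true true ps)) => [s|];
  first exact: running_boundary.
apply: hoare_seq; [by bmono|exact: hoare_enter_request mj ej le|].
case: (tc_high_tip c) => [T|]; last exact: hoare_skip.
case el: (lookup _ _) => [p|]; last exact: hoare_skip.
apply: hoare_send => s _ /=; have [pp _] := lookupP el.
by apply: (issued_in_mono W0W); apply: (inv_props iv0).
Qed.

Lemma hoare_on_ne_request (j : validator) c ps : known_cert W0 W (CertTC c) ->
  MNERequest Payload c \in W0 j ->
  hoare (start ps) (on_ne_request S i now j c) boundary.
Proof.
move=> kc mj; apply: hoare_read => s0 [iv0 cvs0 _ _ _ _ _].
apply: hoare_when => [/and4P[_ _ /eqP ej le]|_ s [_ m]]; last exact: running_boundary m.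
rewrite cvs0 in le.
apply: (@hoare_pre (start ps)) => [s [] //|].
apply: (@hoare_post (running (tc_view c).+1 cv0 cv0 true true ps)) => [s|];
  first exact: running_boundary.
apply: hoare_seq; [by bmono|exact: hoare_enter_request mj ej le|].
case: (tc_high_tip c) => [T|]; last exact: hoare_skip.
apply: hoare_when => // _.
apply: hoare_seq; [by bmono|by apply: hoare_send|].
apply: hoare_update => s [iv cv hv ht hl he hps]; split; last exact: evolve_frame.
by split=> //; case: iv; split.
Qed.

Lemma hoare_on_ne sg ps : hoare (start ps) (@on_ne R f Payload Hash sg) boundary.
Proof.
apply: hoare_read => s0 _.
apply: (@hoare_post (start ps)) => [s|]; first exact: running_boundary.
apply: hoare_when => [ns|_ s [] //].
apply: hoare_update => s [-> [iv cv hv ht hl he hps]]; split; last exact: evolve_frame.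
split=> //; case: iv; split=> //=.
by rewrite rcons_uniq ns.
Qed.

(** Recorded timeouts never exceed the current view, and the handler has first entered the view of
    [M] by its [last_cer]; so only the count for [u] itself can reach a quorum. *)
Lemma hoare_record_timeout M u bv bt bl be ps : known_timeout S W0 M -> m_view M = u ->
  hoare (running u bv bt bl be ps) (@record_timeout R f Payload Hash M)
   (fun s => running u bv u.+1 bl be ps s /\
      exists M', [/\ M' \in timeouts s,
        m_view M' = m_view M & signer (m_sig M') = signer (m_sig M)]).
Proof.
move=> kM eu; apply: hoare_read => s0 [iv0 cvs0 _ _ _ _ _].
have tc s : local_inv s -> cur_view s = u -> timeouts_short u.+1 s.
  move=> iv cv v lt; have [_ h] := inv_to iv.
  rewrite (@eq_in_filter _ _ pred0) ?filter_pred0 // => M' /h[_ le] /=.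
  by apply/negbTE/eqP => e; move: le; rewrite e cv leqNgt lt.
apply: hoare_when => [nh|/negbNE /hasP[M' M's /andP[/eqP e1 /eqP e2]] s [es m]]; last first.
  have [iv cv hv ht hl he hps] := m; split; first by split=> //; apply: tc.
  by exists M'; rewrite es.
apply: hoare_update => s [-> {s} [iv cv hv ht hl he hps]]; split; last first.
  by apply: evolve_frame => //= x xs; rewrite mem_rcons inE xs orbT.
split; last by exists M; rewrite /= mem_rcons mem_head.
have iv' : local_inv (set_timeouts (rcons (timeouts s0) M) s0).
  case: iv => p1 p2 p3 p4 p5 p6 p7 p8 [p9 p9'] p10 p11 p12 p13 p14 p15 p16 p17; split=> //=.
  split.
    rewrite map_rcons rcons_uniq p9 andbT; apply: contra nh => /mapP[M' M's [e1 e2]].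
    by apply/hasP; exists M' => //; rewrite e1 e2 !eqxx.
  move=> M'; rewrite mem_rcons inE => /orP[/eqP ->|/p9' //].
  by split=> //; rewrite eu cv.
by split=> //; apply: tc.
Qed.

Lemma timeout_signers_uniq (s : lstate) v : local_inv s ->
  uniq [seq signer (m_sig M) | M <- timeouts s & m_view M == v].
Proof.
move=> iv; have [u _] := inv_to iv.
have : uniq [seq (m_view M, signer (m_sig M)) | M <- timeouts s & m_view M == v].
  by apply: subseq_uniq u; apply: map_subseq; apply: filter_subseq.
have -> : [seq (m_view M, signer (m_sig M)) | M <- timeouts s & m_view M == v] =
   map (pair v) [seq signer (m_sig M) | M <- timeouts s & m_view M == v].
  rewrite -map_comp; apply/eq_in_map => M; rewrite mem_filter => /andP[/eqP e _] /=.
  by rewrite e.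
exact: map_uniq.
Qed.

Lemma known_timeout_timed_out M : known_timeout S W0 M -> timed_out W0 (signer (m_sig M))
  (m_view M).
Proof. by case=> _ mM _ _; exists M. Qed.

Lemma known_form_tc (s : lstate) v : local_inv s ->
  let Ms := [seq M <- timeouts s | m_view M == v] in
  quorum <= size Ms ->
  known_cert W0 W (CertTC (form_tc v (take quorum Ms))) /\
  tc_view (form_tc v (take quorum Ms)) = v.
Proof.
move=> iv Ms le.
have sz : size (take quorum Ms) = quorum by rewrite size_take_min (minn_idPl le).
have us : uniq [seq signer (m_sig M) | M <- take quorum Ms].
  by rewrite map_take take_uniq //; apply: timeout_signers_uniq.
have kM M : M \in take quorum Ms -> known_timeout S W0 M /\ m_view M = v.
  move=> /mem_take; rewrite mem_filter => /andP[/eqP -> Mt].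
  by have [_ h] := inv_to iv; have [] := h _ Mt.
have [|vt ev tT] := @form_tcP _ _ _ _ S v (take quorum Ms) sz _ us.
  move=> M /kM[[vM _ tM _] e]; split=> // T /tM[] //.
have tq : quorum_timed_out W0 v.
  exists [seq signer (m_sig M) | M <- take quorum Ms]; rewrite us size_map sz; split=> //.
  by move=> j /mapP[M /kM[/known_timeout_timed_out h <-] ->].
split=> //; split=> //=; rewrite ?ev //; first by constructor 2;
  apply: quorum_timed_out_mono tq.
split=> // T /tT[M /kM[[_ _ tM _] _]]; by case/tM.
Qed.

(** A timeout triggered by the messages of others has an earlier timeout of the same view behind it,
    which provides the [cause]. A quorum, in turn, is used up at once by entering the next view. *)
Lemma hoare_timeout_certificates M ps : known_timeout S W0 M ->
  let v := m_view M in cv0 <= v ->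
  hoare (fun s => running v cv0 v.+1 true true ps s)
   (read (fun s'' =>
          let Ms := [seq M' <- timeouts s'' | m_view M' == v] in
          when (f.+1 <= size Ms) (timeout_view S i) ;;
          when (quorum <= size Ms) (
            let t := form_tc v (take quorum Ms) in
            enter now (CertTC t) ;;
            when (i == leader f (tc_view t).+1) (propose_tc S i now t)))) boundary.
Proof.
move=> kM v cle; apply: hoare_read => s0 [iv0 cvs0 _ _ _ _ _] /=.
set Ms := [seq _ <- _ | _].
have [le|gt] := leqP quorum (size Ms); last first.
  apply: (@hoare_pre (running v cv0 v true true ps)).
    move=> s [-> [iv cv hv ht hl he hps]]; split=> // v' le'.
    by case: (eqVneq v' v) => [->|ne] //; apply: ht; lia.
  rewrite {2}/when; apply: (@hoare_post (running v cv0 v true true ps)) => [s|];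
    first exact: running_boundary.
  apply: (@hoare_seq _ _ (running v cv0 v true true ps)); [by bmono| |exact: hoare_skip].
  apply: hoare_when => // lt; apply: hoare_timeout_view.
  have : 0 < size Ms by apply: leq_trans lt.
  case e: Ms => [|M0 Ms'] // _.
  have : M0 \in Ms by rewrite e mem_head.
  rewrite mem_filter => /andP[/eqP ev Mt]; have [_ h] := inv_to iv0.
  by have [/known_timeout_timed_out /timed_out_cause] := h _ Mt; rewrite ev.
apply: (@hoare_pre (running v cv0 v.+1 true true ps)) => [s [] //|].
have lt : 0 < size Ms by apply: leq_trans le.
apply: hoare_seq; first by rewrite /when; bmono.
  apply: hoare_when => [_|_ s m]; last exact: m.
  apply: hoare_timeout_view; move: lt; case e: Ms => [|M0 Ms'] // _.
  have : M0 \in Ms by rewrite e mem_head.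
  rewrite mem_filter => /andP[/eqP ev Mt]; have [_ h] := inv_to iv0.
  by have [/known_timeout_timed_out /timed_out_cause] := h _ Mt; rewrite ev.
rewrite /when.
have [kt ev] := known_form_tc iv0 le.
set t := form_tc v _ in kt ev *.
apply: (@hoare_post (running v.+1 v.+1 v.+1 true true ps)) => [s|];
  first exact: running_boundary.
apply: (@hoare_seq _ _ (running v.+1 cv0 v.+1 false true ps)); first by bmono.
  have := @hoare_enter (CertTC t) v cv0 v.+1 true true ps kt; rewrite /= ev => /(_ (leqnSn _)).
  have -> : (v == v.+1) = false by lia.
  by [].
apply: (@hoare_post (running v.+1 cv0 v.+1 true true ps)) => [s|];
  first by apply: running_weak => //; apply: leqW.
case: ifP => [/eqP il|/negbT nl].
  by rewrite ev in il; apply: hoare_propose_tc => //; rewrite ev.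
by apply: hoare_skip => s; apply: running_lead => e; rewrite ev e eqxx in nl.
Qed.

Lemma hoare_on_timeout M ps : known_timeout S W0 M -> known_cert W0 W (m_last_cer M) ->
  (forall q, q \in qcs_of_cert (m_last_cer M) -> {subset pointed_by iss q <= ps}) ->
  hoare (start ps) (on_timeout S i now iss M)
    (fun s => boundary s /\ (m_view M < cur_view s \/
      exists M', [/\ M' \in timeouts s,
        m_view M' = m_view M & signer (m_sig M') = signer (m_sig M)])).
Proof.
move=> kM kc psub; apply: hoare_read => s0 [iv0 cvs0 _ _ _ _ _]; rewrite cvs0.
have [vM _ tM wM] := kM; rewrite vM /=.
apply: hoare_when => [cle|g s [_ m]]; last first.
  split; first exact: running_boundary m.
  by have [_ -> _ _ _ _ _] := m; left; rewrite ltnNge.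
set v := m_view M; set c := m_last_cer M in kc psub *.
have ec : (cert_view c).+1 = v by case/and3P: vM => _ /eqP.
have [vc _ kk] := kc.
pose be1 := if cv0 == v then true else if c is CertTC _ then true else false.
(* The test [has_proposed] is made on the initial state; growth of the broadcasts transfers its
   positive outcome to the later one. *)
pose F (s : lstate) := {subset broadcasts s0 <= broadcasts s}.
have stF : stable F by move=> s s' o ev h m /h; exact: (ev_bc ev).
apply: (@hoare_pre (fun s => start ps s /\ F s)) => [s [-> m]|]; first by split=> // ?.
apply: (@hoare_seq _ _ (fun s => start ps s /\ F s)).
- by bmono; case: (form_qc _ _) => *; bmono.
- apply: hoare_stable => //; case: (c) kc => [q|t] kc; first exact: hoare_skip.
  exact: hoare_broadcast_tc.
apply: (@hoare_seq _ _ (fun s => running v cv0 cv0 (cv0 == v) be1 ps s /\ F s)).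
- by bmono.
- by apply: hoare_stable => //; have := @hoare_enter c cv0 cv0 cv0 true true ps kc;
  rewrite ec; apply.
apply: (@hoare_seq _ _ (running v cv0 cv0 true be1 ps)).
- by bmono.
- rewrite ec; apply: hoare_when => [/andP[/eqP il _]|nl s [m Fs]].
    apply: (@hoare_pre (running v cv0 cv0 (cv0 == v) be1 ps)) => [s [] //|].
    case: (c) kc ec => [q|t] kc ec; first exact: hoare_propose_qc.
    exact: hoare_propose_tc.
  apply: (running_lead _ m) => e; have [_ cv _ _ _ _ _] := m; move=> _; left.
  move: nl; rewrite e eqxx /= negbK cv => /hasP[mm mmin mmv].
  by apply/hasP; exists mm => //; apply: Fs.
apply: (@hoare_seq _ _ (running v cv0 cv0 true true ps)).
- by bmono.
- case: (c) kc ec psub kk @be1 => [q|t] kc ec psub kk be1; last first.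
    by rewrite /be1 if_same; apply: hoare_skip.
  apply: (@hoare_seq _ _ (running v cv0 cv0 true be1 ps)); [by bmono| |].
    by apply: hoare_when => // _; apply: hoare_broadcast_qc.
  apply: hoare_seq; [by bmono|exact: hoare_send|].
  apply: hoare_seq; [by bmono|exact: hoare_send|].
  by apply: hoare_commit_entry => //; apply: psub; rewrite mem_head.
apply: (@hoare_seq _ _ (running v cv0 cv0 true true ps)).
- by bmono.
- case eT: (m_tip M) => [T|]; last exact: hoare_skip.
  case ew: (m_tip_vote M) => [w|]; last exact: hoare_skip.
  apply: hoare_update => s [iv cv hv ht hl he hps]; split; last exact: evolve_frame.
  split=> //; case: iv => p1 p2 p3 p4 p5 p6 p7 [p8 p8'] p9 p10 p11 p12 p13 p14 p15 p16 p17;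
    split=> //=.
  have [vw ev] : valid_vote S w /\ vt_view w = m_view M.
    case/and3P: vM => _ _; rewrite eT ew; case: (m_qc M) => // /and4P[/andP[-> /eqP ->]].
    by [].
  have tow : timed_out W0 (signer (vt_sig w)) (vt_view w).
    by rewrite (wM w ew) ev; apply: known_timeout_timed_out.
  rewrite /add_vote; case: ifP => [//|nw]; rewrite rcons_uniq nw; split=> // w'.
  by rewrite mem_rcons inE => /orP[/eqP ->|/p8'].
apply: hoare_read => s1 [iv1 cv1 _ _ _ _ _].
apply: (@hoare_pre (running v cv0 cv0 true true ps)) => [s [] //|].
case eoq: (if (m_tip M, m_tip_vote M) is (Some _, Some w)
    then form_qc w (tip_votes s1) else None) => [q|]; last first.
  apply: hoare_seq.
  - by bmono; rewrite /when; bmono.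
  - exact: hoare_record_timeout.
  pose rec (s : lstate) := exists M', [/\ M' \in timeouts s,
    m_view M' = m_view M & signer (m_sig M') = signer (m_sig M)].
  have st : stable rec.
    by move=> s s' o ev [M' [h1 h2 h3]]; exists M'; split=> //; exact: (ev_to ev).
  apply: (hoare_post _ (hoare_stable st (hoare_timeout_certificates kM cle))).
  by move=> s [b e]; split=> //; right.
move: eoq; case eT: (m_tip M) => [T|] //; case ew: (m_tip_vote M) => [w|] // ef.
have [vw ev] : valid_vote S w /\ vt_view w = v.
  case/and3P: vM => _ _; rewrite eT ew; case: (m_qc M) => // /and4P[/andP[-> /eqP ->]].
  by [].
have [utv vtv] := inv_tvotes iv1.
have [vq qv qi [l [ul sl hl]]] := form_qcP hash_inj utv (fun w' h => (vtv w' h).1) vw ef.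
rewrite ev in qv.
(* Tip votes travel inside timeout messages, so a quorum of them is a quorum of timeouts: this QC is
   backed without any further broadcast. *)
have tq : quorum_timed_out W0 (qc_view q).
  exists l; rewrite sl; split=> // j /hl[w' [w's <- ev']].
  by rewrite qv -ev -ev'; have [] := vtv _ w's.
have vid : id_backed S W0 (qc_view q) (qc_id q).
  left; exists (signer (m_sig M)); rewrite qv; exact: known_timeout_timed_out.
have kq : known_cert W0 W (CertQC q) by split=> //; constructor 2;
  apply: quorum_timed_out_mono tq.
apply: (@hoare_post (running v.+1 cv0 cv0 true true (ps ++ pointed_by iss q))).
  move=> s m; split; first by apply: running_boundary m; apply: leqW.
  by have [_ -> _ _ _ _ _] := m; left.
apply: hoare_seq; [by bmono|exact: hoare_obtain|].
apply: (@hoare_seq _ _ (running v.+1 cv0 cv0 false false (ps ++ pointed_by iss q)));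
  [by bmono| |].
  have := @hoare_enter (CertQC q) v cv0 cv0 true true (ps ++ pointed_by iss q) kq.
  rewrite /= qv => /(_ (leqnSn _)).
  have -> : (v == v.+1) = false by lia.
  by [].
apply: (@hoare_seq _ _ (running v.+1 cv0 cv0 false true (ps ++ pointed_by iss q)));
  [by bmono| |].
  apply: hoare_commit_entry => //; first by rewrite qv.
  by move=> p h; rewrite mem_cat h orbT.
rewrite qv; apply: hoare_when => [/eqP il|nl s].
  by apply: hoare_propose_qc => //; rewrite qv.
by apply: running_lead => e; rewrite e eqxx in nl.
Qed.

(** * Processing a whole message, and the start *)

Definition handle (j : validator) (m : msg) : act :=
  match m with
  | MProposal p => on_proposal S i now j p
  | MVote w => on_vote S i now iss w
  | MQC q => on_qc S i now j q
  | MTimeout M => on_timeout S i now iss M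
  | MTC c => on_tc S i now c
  | MNERequest c => on_ne_request S i now j c
  | MProposalRequest c => on_proposal_request S now j c
  | MNE sg => on_ne sg
  end.

Lemma bmono_handle j m : bmono (handle j m).
Proof.
case: m => [p|w|q|M|c|c|c|sg] /=.
- rewrite /on_proposal; bmono => s1 mm; rewrite /update /=.
  by case: (fresh p) => //; case: (p_tc p) => //= c; case: (tc_high_tip c).
- by rewrite /on_vote; bmono.
- by rewrite /on_qc; bmono.
- by rewrite /on_timeout; bmono.
- by rewrite /on_tc; bmono.
- by rewrite /on_ne_request; bmono.
- by rewrite /on_proposal_request; bmono.
- by rewrite /on_ne; bmono.
Qed.

Lemma bmono_on_message j m : bmono (on_message S i now iss j m).
Proof.
apply: bmono_seq; last by apply: bmono_seq; [exact: bmono_handle|exact: bmono_recover_returns].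
apply: bmono_seq; first by case: m => *; bmono.
by apply: bmono_foldr => q; bmono.
Qed.

Lemma hoare_on_message j m : msg_ok S W0 W0 j m ->
  hoare (start [::]) (on_message S i now iss j m)
    (fun s => (boundary s /\ no_lookup s) /\ effect j m s).
Proof.
move=> mok s sub Ps.
set a2 := handle j m.
have hsub := @absorbed_sub m.
have h2 : hoare (fun s => start (absorbed m) s /\ (if m is MProposal p then p \in
  proposals s else true))
   a2 (fun s => boundary s /\ effect j m s).
  rewrite /a2; case: m mok {a2 Ps sub} hsub => [p|w|q|M|c|c|c|sg] mok hsub.
  - pose F (s : lstate) := p \in proposals s.
    have stF : stable F by move=> s1 s' o ev; apply: (ev_props ev).
    apply: (hoare_post _ (hoare_stable stF (hoare_on_proposal mok (hsub _ (mem_head _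
      _))))) => s1 [[b e] pp].
    by split.
  - case: mok => vw vid;
    apply: (@hoare_pre (start (absorbed (MVote Payload w)))) => [s1 [] //|].
    exact: hoare_on_vote.
  - apply: (@hoare_pre (start (absorbed (MQC Payload q)))) => [s1 [] //|].
    by apply: hoare_on_qc; [exact: known_cert_monor|apply: hsub; rewrite mem_head].
  - case: mok => kM kc;
    apply: (@hoare_pre (start (absorbed (MTimeout Payload M)))) => [s1 [] //|].
    apply: hoare_on_timeout => //; first exact: known_cert_monor.
    by move=> q qm; apply: hsub; rewrite /= mem_cat qm.
  - apply: (@hoare_pre (start (absorbed (MTC Payload c)))) => [s1 [] //|].
    by apply: (hoare_post _ (hoare_on_tc _)) => [s1|] //; exact: known_cert_monor.
  - case: mok => kc mj;
    apply: (@hoare_pre (start (absorbed (MNERequest Payload c)))) => [s1 [] //|].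
    by apply: (hoare_post _ (hoare_on_ne_request _ mj)) => [s1|] //; exact: known_cert_monor.
  - case: mok => kc mj;
    apply: (@hoare_pre (start (absorbed (MProposalRequest Payload c)))) => [s1 [] //|].
    by apply: (hoare_post _ (hoare_on_proposal_request _ mj)) => [s1|] //;
      exact: known_cert_monor.
  - apply: (@hoare_pre (start (absorbed (MNE Payload sg)))) => [s1 [] //|].
    by apply: (hoare_post _ (@hoare_on_ne sg _)).
have h3 : hoare (fun s => boundary s /\ effect j m s) (recover_returns S i)
   (fun s => boundary s /\ effect j m s).
  apply: hoare_stable; first exact: effect_stable.
  move=> s1 sub1 b; have [b' ev mm] := hoare_recover_returns sub1 b.
  by split=> //; apply: running_boundary b'.
have bm2 : bmono a2 by apply: bmono_handle.
have [[b e] ev mm] : [/\ boundary (on_message S i now iss j m s).1 /\ effect j m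
  (on_message S i now iss j m s).1,
   evolve s (on_message S i now iss j m s).1 (on_message S i now iss j m s).2
   & forall x, x \in (on_message S i now iss j m s).2 -> msg_ok S W0 W i x.2].
  apply: (hoare_seq _ (@hoare_absorb j m cv0 cv0 cv0 true true mok)
    (hoare_seq (bmono_recover_returns S i) h2 h3) sub Ps).
  by apply: bmono_seq => //; exact: bmono_recover_returns.
split=> //; split=> //; split=> //.
rewrite /on_message -/(handle j m) -/a2 /andthen.
case: (absorb iss m s) => s1 o1; case: (a2 s1) => s2 o2.
by move: (@recover_returns_no_lookup s2); case: (recover_returns S i s2).
Qed.

(** The handler is regarded as running from view 1, although the initial state has view 0; thus the
    entry into view 1 owes no commits. *)
Lemma on_start_ok : cv0 = 1 -> W0 i = [::] ->
  let s0 := initial_lstate S in let r := on_start S i now s0 in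
  {subset broadcasts r.1 <= W i} ->
  [/\ boundary r.1, evolve s0 r.1 r.2, (forall x, x \in r.2 -> msg_ok S W0 W i x.2)
    & no_lookup r.1].
Proof.
move=> e1 W0i s0 r sub.
pose s1 := (enter now (CertQC (genesis_qc S)) s0).1.
have er : r = when (i == leader f 1) (propose_qc S i (genesis_qc S)) s1.
  by rewrite /r /on_start /andthen /=; case: (when _ _ _).
have ev1 : evolve s0 s1 [::].
  by split=> //; try (by constructor 1); right.
have Ig : issued_in W0 (genesis_proposal S) by left.
have kg : known_cert W0 W (CertQC (genesis_qc S)).
  split; [by rewrite /= /valid_qc eqxx|by constructor 1|right].
  by exists (genesis_proposal S).
have m1 : running 1 0 0 false true [::] s1.
  split=> //; last by move=> _; constructor 1.
  split=> //.
  - by move=> p; rewrite inE => /eqP ->.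
  - by left.
  - split=> //; last by exists (genesis_proposal S).
    by rewrite /= -/(genesis_proposal S); apply/orP; left; apply/eqP.
  - by rewrite W0i.
have h : hoare (running 1 0 0 false true [::]) (when (i == leader f 1) (propose_qc S i
  (genesis_qc S)))
     (running 1 0 0 true true [::]).
  apply: hoare_when => [/eqP il|nl s]; first exact: hoare_propose_qc.
  by apply: running_lead => e; rewrite e eqxx in nl.
rewrite er in sub *; have [m2 ev2 mok] := h s1 sub m1; split=> //.
- exact: running_boundary m2.
- exact: evolve_trans ev1 ev2.
- by rewrite /when; case: ifP.
Qed.

End Triples.

HB.instance Definition _ (R : realType) (f : nat) (Payload Hash : eqType) :=
  gen_eqMixin (packet R f Payload Hash).

(** * Steps of the system *)

Section Global.

Variables (R : realType) (f : nat) (Payload Hash : eqType).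
Variable S : setting R f Payload Hash.
Hypothesis hash_inj : injective (hash S).
Hypothesis f_gt0 : 0 < f.

Local Notation validator := 'I_(3 * f).+1.
Local Notation msg := (msg f Payload Hash).
Local Notation lstate := (lstate R f Payload Hash).
Local Notation config := (config R f Payload Hash).
Local Notation proposal := (proposal f Payload Hash).
Local Notation packet := (packet R f Payload Hash).
Local Notation act := (act R f Payload Hash).

Definition world_of (c : config) : world f Payload Hash := fun j => broadcasts (local c j).

Definition some_timeout (W : world f Payload Hash) v := exists j, timed_out W j v.

(** Between steps the parameters collapse: both worlds become the current one, and a broadcast
    timeout is its own cause. *)
Lemma inv_mono i (W0a Wa W : world f Payload Hash) cause (s : lstate) :
  local_inv S i W0a Wa cause s -> world_sub W0a W -> world_sub Wa W -> W i = broadcasts s ->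
  local_inv S i W W (some_timeout W) s.
Proof.
move=> iv s0 sa ei.
have kn c : known_cert S W0a Wa c -> known_cert S W W c.
  case: c => [q|t] [? e k]; split=> //; try exact: (entry_backed_mono sa e).
    exact: id_backed_mono k.
  by case: k => /(quorum_timed_out_mono s0) ? h; split=> // T /h/(tip_backed_mono s0).
case: iv => p1 [p2 p2'] p3 p4 [p5 p5' p5''] p6 [p7 p7'] [p8 p8'] [p9 p9'] p10 p11 p12 p13
  p14 p15 p16 p17.
split=> //.
- by move=> p /p1; apply: issued_in_mono.
- by split=> //; apply: kn.
- by move=> c /p3/kn.
- by split=> //; apply: tip_backed_mono p5''.
- by split=> // w /p7'[? /(id_backed_mono s0)].
- by split=> // w /p8'[? /(timed_out_mono s0)].
- by split=> // M /p9'[/(known_timeout_mono s0)].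
- by move=> r /p11[/kn].
- by move=> p /p12[? ? ? /kn].
- move=> M h; split; last by case: (p14 _ h).
  by exists i, M; rewrite ei.
- by move=> b /p16[p [/(issued_in_mono s0) ? ?]]; exists p.
- by rewrite ei.
Qed.

Record local_ok (c : config) (i : validator) : Prop := LocalOk {
  lo_inv : local_inv S i (world_of c) (world_of c) (some_timeout (world_of c)) (local c i);
  lo_v : votes_short (cur_view (local c i)) (local c i);
  lo_t : timeouts_short (cur_view (local c i)) (local c i);
  lo_l : leader_served i (local c i);
  lo_n : no_lookup (local c i) }.

Record config_inv (c : config) : Prop := Ginv {
  g_local : forall i, started (local c i) -> local_ok c i;
  g_unst : forall i, ~~ started (local c i) -> local c i = initial_lstate S;
  g_net : forall pk, pk \in net c ->
    msg_ok S (world_of c) (world_of c) (src pk) (contents pk);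
  g_iss : forall p, p \in issued c <-> issued_in S (world_of c) p }.

Lemma config_inv_world c : config_inv c -> world_ok S (world_of c).
Proof.
move=> g; split.
  move=> j p h; case: (boolP (started (local c j))) => st; last first.
    by move: h; rewrite /world_of (g_unst g st).
  by have [? _ ? ?] := inv_bprop (lo_inv (g_local g st)) h.
move=> j p p' h h'; case: (boolP (started (local c j))) => st; last first.
  by move: h; rewrite /world_of (g_unst g st).
exact: (inv_buniq (lo_inv (g_local g st)) h h').
Qed.

(* [tr_TO]: the first timeout of a view can only come from a timer. *)
Record trans (t : R) (c c' : config) (i : validator) (o : seq (validator * msg)) : Prop
  := Trans {
  tr_other : forall j, j != i -> local c' j = local c j;
  tr_ev : evolve S i t (world_of c) (local c i) (local c' i) o;
  tr_out : forall x, x \in o -> Packet i x.1 x.2 t \in net c';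
  tr_net : forall pk, pk \in net c' -> pk \in net c \/ sent_at pk = t;
  tr_TO : forall v, some_timeout (world_of c') v -> some_timeout (world_of c) v \/
    [/\ started (local c i), cur_view (local c i) = v
      & (Theta_view S <= elapsed S i (timer_start (local c i)) t)%R];
  tr_ce : entry_commits S (issued c) (world_of c) (cur_view (local c i)) (local c' i) \/
    (t < GST S)%R }.

Lemma run_local i t (a : act) rest c j : local (run i t a rest c) j =
  if j == i then (a (local c i)).1 else local c j.
Proof. by rewrite /run; case: (a _). Qed.

Lemma run_net i t (a : act) rest c : net (run i t a rest c) =
  rest ++ [seq Packet i x.1 x.2 t | x <- (a (local c i)).2].
Proof. by rewrite /run; case: (a _). Qed.

Lemma run_issued i t (a : act) rest c : issued (run i t a rest c) =
  issued c ++ pmap (fun x => if x.2 is MProposal p then Some p else None) (a (local c i)).2.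
Proof. by rewrite /run; case: (a _). Qed.

Lemma run_sub i t (a : act) rest c : bmono a -> world_sub (world_of c) (world_of (run i t
  a rest c)).
Proof.
move=> ba j m; rewrite /world_of run_local; case: eqP => [->|//]; exact: ba.
Qed.

Lemma run_ok i t (a : act) rest c cause : config_inv c -> bmono a ->
  let c' := run i t a rest c in let r := a (local c i) in
  {subset rest <= net c} ->
  local_inv S i (world_of c) (world_of c') cause r.1 ->
  votes_short (cur_view r.1) r.1 -> timeouts_short (cur_view r.1) r.1 -> leader_served i
    r.1 -> no_lookup r.1 ->
  evolve S i t (world_of c) (local c i) r.1 r.2 ->
  (forall x, x \in r.2 -> msg_ok S (world_of c) (world_of c') i x.2) ->
  started r.1 -> config_inv c'.
Proof.
move=> g ba c' r rsub iv hv ht hl hn ev mok st.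
have sub : world_sub (world_of c) (world_of c') by exact: run_sub.
have ei : local c' i = r.1 by rewrite /c' run_local eqxx.
have ej j : j != i -> local c' j = local c j by rewrite /c' run_local => /negbTE ->.
have refl W : @world_sub f Payload Hash W W by move=> ? ?.
split.
- move=> j; case: (eqVneq j i) => [->|ne].
    rewrite ei => _; split; rewrite ?ei //.
    by apply: inv_mono iv _ _ _ => //; rewrite /world_of ei.
  rewrite (ej _ ne) => sj; have [l1 l2 l3 l4 l5] := g_local g sj.
  split; rewrite ?(ej _ ne) //.
  by apply: inv_mono l1 _ _ _ => //; rewrite /world_of ej.
- move=> j; case: (eqVneq j i) => [->|ne]; first by rewrite ei st.
  by rewrite (ej _ ne); apply: (g_unst g).
- move=> pk; rewrite /c' run_net mem_cat => /orP[/rsub/(g_net g)|/mapP[x xo ->]] /=.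
    exact: msg_ok_mono.
  exact: (msg_ok_monol sub (mok _ xo)).
- move=> p; rewrite /c' run_issued mem_cat; split.
    case/orP => [/(g_iss g)|]; first exact: issued_in_mono.
    rewrite mem_pmap => /mapP[[j m] /mok /=]; case: m => // p' ip [->].
    exact: ip.
  case=> [->|[j]].
    by apply/orP; left; apply/(g_iss g); left.
  rewrite /world_of -/c'; case: (eqVneq j i) => [->|ne].
    rewrite ei => /(ev_sent ev)[h|h].
      by apply/orP; left; apply/(g_iss g); right; exists i.
    apply/orP; right; rewrite mem_pmap; apply/mapP; exists (i, MProposal p) => //.
  by rewrite (ej _ ne) => h; apply/orP; left; apply/(g_iss g); right; exists j.
Qed.

Lemma run_trans i t (a : act) rest c (o := (a (local c i)).2) c' : c' = run i t a rest c ->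
  {subset rest <= net c} ->
  evolve S i t (world_of c) (local c i) (a (local c i)).1 o ->
  (forall v, some_timeout (world_of c') v -> some_timeout (world_of c) v \/
    [/\ started (local c i), cur_view (local c i) = v
      & (Theta_view S <= elapsed S i (timer_start (local c i)) t)%R]) ->
  entry_commits S (issued c) (world_of c) (cur_view (local c i)) (a (local c i)).1 \/ (t
    < GST S)%R ->
  trans t c c' i o.
Proof.
move=> -> rsub ev hto hce; split=> //; rewrite ?run_local ?eqxx //.
- by move=> j /negbTE; rewrite run_local => ->.
- by move=> x xo; rewrite run_net mem_cat; apply/orP; right; apply/mapP; exists x.
- by move=> pk; rewrite run_net mem_cat => /orP[/rsub|/mapP[x _ ->]]; [left|right].
Qed.

Lemma evolve_started i t W (s s' : lstate) o : evolve S i t W s s' o -> started s ->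
  started s'.
Proof. by move=> /evolve_cv le st; apply: leq_trans le. Qed.

Lemma start_of_local c i cv : config_inv c -> started (local c i) -> cv = cur_view (local
  c i) ->
  forall W cause iss, world_sub (world_of c) W -> (forall v,
    some_timeout (world_of c) v -> cause v) ->
  running S i iss (world_of c) W cv cause cv cv cv true true [::] (local c i).
Proof.
move=> g st -> W cause iss sub hev; have [iv hv ht hl hn] := g_local g st.
split=> //; last by constructor 1.
case: iv => p1 [p2 p2'] p3 p4 p5 p6 p7 p8 p9 p10 p11 p12 p13 p14 p15 p16 p17.
split=> //.
- by split=> //; apply: known_cert_monor p2.
- by move=> c0 /p3; apply: known_cert_monor.
- by move=> r /p11[/(known_cert_monor sub)].
- by move=> p /p12[? ? ? /(known_cert_monor sub)].
- by move=> M /p14[/hev].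
Qed.

Lemma run_boundary i t (a : act) rest c cv cause (r := a (local c i)) c' :
  c' = run i t a rest c -> config_inv c -> bmono a -> {subset rest <= net c} ->
  boundary S i (issued c) (world_of c) (world_of c') cv cause r.1 -> no_lookup r.1 ->
  evolve S i t (world_of c) (local c i) r.1 r.2 ->
  (forall x, x \in r.2 -> msg_ok S (world_of c) (world_of c') i x.2) ->
  started r.1 ->
  (forall v, cause v -> some_timeout (world_of c) v \/
    [/\ started (local c i), cur_view (local c i) = v
      & (Theta_view S <= elapsed S i (timer_start (local c i)) t)%R]) ->
  cv = cur_view (local c i) \/ (t < GST S)%R ->
  config_inv c' /\ exists i o, trans t c c' i o.
Proof.
move=> -> g ba rsub [iv _ hv ht hl he _] nl ev mok st hEV hcv; split.
  by apply: run_ok iv _ _ _ _ _ _ _ => //; apply: hl.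
exists i, r.2; apply: (run_trans erefl) => //; last first.
  by case: hcv => [<-|]; [left; apply: he|right].
move=> v [j [M []]]; rewrite /world_of run_local; case: eqP => [_|_] h e; last first.
  by left; exists j, M.
by apply: hEV; rewrite -e; have [] := inv_bto iv h.
Qed.

Lemma timeout_view_no_lookup i (s : lstate) : no_lookup s -> no_lookup (timeout_view S i s).1.
Proof.
move=> nl; rewrite /timeout_view /read /when; case: ifP => // _.
by rewrite /andthen /=; case: ifP.
Qed.

(** The last clause prepares the liveness argument: a packet leaves the net only when its effect has
    been achieved. *)
Theorem step_ok t c c' : config_inv c -> step S t c c' ->
  [/\ config_inv c', exists i o, trans t c c' i o &
    forall pk, pk \in net c -> pk \in net c' \/
      effect S (dst pk) (src pk) (contents pk) (local c' (dst pk))].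
Proof.
move=> g; have world_ok_conf := config_inv_world g.
have stay i a rest pk : {subset net c <= rest} -> pk \in net c ->
    pk \in net (run i t a rest c) \/
    effect S (dst pk) (src pk) (contents pk) (local (run i t a rest c) (dst pk)).
  by move=> h pkn; left; rewrite run_net mem_cat h.
have own i a rest : {subset broadcasts (a (local c i)).1 <= world_of (run i t a rest c) i}.
  by move=> m; rewrite /world_of run_local eqxx.
have TOW j v : timed_out (world_of c) j v -> some_timeout (world_of c) v by exists j.
case.
- move=> i ns tG; have es := g_unst g ns.
  set a := on_start S i t; set c1 := run _ _ _ _ _.
  have ba : bmono a by rewrite /a /on_start; bmono.
  have W0i : world_of c i = [::] by rewrite /world_of es.
  have W1i : {subset broadcasts (a (initial_lstate S)).1 <= world_of c1 i}.
    by rewrite -es; apply: own.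
  have := on_start_ok f_gt0 (issued c) (some_timeout (world_of c)) (erefl 1) W0i W1i.
  rewrite -es /= => -[b ev mok nl].
  have [] := @run_boundary i t a (net c) c 1 _ c1 erefl g ba _ b nl ev mok => //.
  + have [iv _ _ _ _ _ _] := b; have [_] := inv_qc iv.
    exact: leq_ltn_trans.
  + by left.
  + by right.
  + by move=> g1 tr; split=> // pk; apply: stay.
- move=> pk l1 l2 en st.
  set a := on_message _ _ _ _ _ _; set c1 := run _ _ _ _ _.
  have ba : bmono a by exact: bmono_on_message.
  have sub : world_sub (world_of c) (world_of c1) by exact: run_sub.
  have pkn : pk \in net c by rewrite en mem_cat mem_head orbT.
  have st0 := start_of_local g st erefl (cause := some_timeout (world_of c)) (issued c)
    sub (fun v h => h).
  have [[[b nl] eff] ev mok] := hoare_on_message hash_inj f_gt0 world_ok_conf sub (g_iss g) TOW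
     (g_net g pkn) (own _ a _) st0.
  have rsub : {subset l1 ++ l2 <= net c}.
    by move=> x; rewrite en !mem_cat inE => /orP[->|->]; rewrite ?orbT.
  have [] := @run_boundary (dst pk) t a (l1 ++ l2) c _ _ c1 erefl g ba rsub b nl ev mok.
  + exact: evolve_started ev st.
  + by left.
  + by left.
  move=> g1 tr; split=> // x; rewrite en mem_cat inE => /or3P[xl|/eqP ->|xl].
  + by left; rewrite run_net !mem_cat xl.
  + by right; rewrite /c1 run_local eqxx.
  + by left; rewrite run_net !mem_cat xl orbT.
- move=> i st nto el.
  set a := timeout_view S i; set c1 := run _ _ _ _ _.
  have ba : bmono a by exact: bmono_timeout_view.
  have sub : world_sub (world_of c) (world_of c1) by exact: run_sub.
  (* Only a timer step may time out of a view that nobody has timed out of before. *)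
  pose cause v := some_timeout (world_of c) v \/ cur_view (local c i) = v.
  have st0 := start_of_local g st erefl (cause := cause) (issued c) sub (fun v h =>
    or_introl h).
  have [m ev mok] := hoare_timeout_view t sub (or_intror erefl) (own _ a _) st0.
  have st' := evolve_started ev st.
  have cvr : cur_view (a (local c i)).1 = cur_view (local c i) by case: m.
  have [] := @run_boundary i t a (net c) c _ _ c1 erefl g ba _ (running_boundary (leqnn
    _) (leqnn _) m)
     _ ev mok st' => //.
  + by apply: timeout_view_no_lookup; apply: (lo_n (g_local g st)).
  + by move=> v [|e]; [left|right].
  + by left.
  + by move=> g1 tr; split=> // pk; apply: stay.
- move=> i r rs _ _.
  case: (boolP (started (local c i))) => [st|ns]; last first.
    by move: rs; rewrite (g_unst g ns).
  set a := recover_tick S t r; set c1 := run _ _ _ _ _.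
  have ba : bmono a by exact: bmono_recover_tick.
  have sub : world_sub (world_of c) (world_of c1) by exact: run_sub.
  have st0 := start_of_local g st erefl (cause := some_timeout (world_of c)) (issued c)
    sub (fun v h => h).
  have [m ev mok] := hoare_recover_tick (own _ a (net c)) (conj st0 rs).
  have [] := @run_boundary i t a (net c) c _ _ c1 erefl g ba _ (running_boundary (leqnn
    _) (leqnn _) m)
     _ ev mok (evolve_started ev st) => //.
  + by apply: recover_tick_no_lookup => //; apply: (lo_n (g_local g st)).
  + by left.
  + by left.
  + by move=> g1 tr; split=> // pk; apply: stay.
- split=> //; last by left.
  exists ord0, [::]; split=> //; first exact: evolve_refl.
  + by left.
  + by left.
  + by left; constructor 1.
Qed.

Lemma config_inv_initial : config_inv (initial_config S).
Proof.
split=> //= p; split=> [|[->|[j]] //]; last by rewrite inE.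
by rewrite inE => /eqP ->; left.
Qed.

End Global.

(** * Executions *)

Section Trace.

Variables (R : realType) (f : nat) (Payload Hash : eqType).
Variable S : setting R f Payload Hash.
Variable E : execution S.
Hypothesis f_gt0 : 0 < f.
Hypothesis S_ok : setting_ok S.

Local Notation validator := 'I_(3 * f).+1.
Local Notation quorum := (quorum f).
Local Notation lstate := (lstate R f Payload Hash).
Local Notation tm := (time E).
Local Notation "'st' k i" := (local (conf E k) i) (at level 10, k at level 9, i at level 9).
Local Notation view k i := (cur_view (local (conf E k) i)).
Local Notation wld k := (world_of (conf E k)).
Local Notation d := (delta S).

Let hash_inj : injective (hash S) := hash_collision_free S_ok.
Let d_gt0 : (0 < d)%R := delta_gt0 S_ok.

Lemma config_inv_conf k : config_inv S (conf E k).
Proof.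
elim: k => [|k IH]; first by rewrite conf0; apply: config_inv_initial.
by have [] := step_ok hash_inj f_gt0 IH (conf_step E k).
Qed.

Lemma world_ok_conf k : world_ok S (wld k).
Proof. exact: (config_inv_world (config_inv_conf k)). Qed.

Lemma local_conf k i : started (st k i) -> local_ok S (conf E k) i.
Proof. exact: (g_local (config_inv_conf k)). Qed.

Lemma trans_conf k : exists i o, trans S (tm k) (conf E k) (conf E k.+1) i o.
Proof. by have [] := step_ok hash_inj f_gt0 (config_inv_conf k) (conf_step E k). Qed.

Lemma evolve_conf k j : exists o, evolve S j (tm k) (wld k) (st k j) (st k.+1 j) o /\
  (forall x, x \in o -> Packet j x.1 x.2 (tm k) \in net (conf E k.+1)).
Proof.
have [i [o tr]] := trans_conf k.
case: (eqVneq j i) => [->|ne]; first by exists o; split; [exact: tr_ev tr|exact: tr_out tr].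
by exists [::]; split=> //; rewrite (tr_other tr ne); apply: evolve_refl.
Qed.

Lemma stable_conf (F : lstate -> Prop) j : (forall t W, stable S j t W F) ->
  forall k k', k <= k' -> F (st k j) -> F (st k' j).
Proof.
move=> stF k k' /subnK <-; elim: (k' - k) => [|n IH] //= /IH h.
by rewrite addSn; have [o [ev _]] := evolve_conf (n + k) j; apply: stF ev h.
Qed.

Lemma view_mono k k' j : k <= k' -> view k j <= view k' j.
Proof.
move=> le; apply: (@stable_conf (fun s => view k j <= cur_view s)) le _ => // t W s s' o
  /evolve_cv.
by move=> h1 h2; apply: leq_trans h1.
Qed.

Lemma bc_mono k k' : k <= k' -> world_sub (wld k) (wld k').
Proof.
move=> le j m; apply: (@stable_conf (fun s => m \in broadcasts s)) le => t W s s' o ev.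
exact: (ev_bc ev).
Qed.

Lemma committed_mono k k' j b : k <= k' -> b \in committed (st k j) -> b \in committed
  (st k' j).
Proof.
move=> le; apply: (@stable_conf (fun s => b \in committed s)) le => t W s s' o ev.
exact: (ev_comm ev).
Qed.

(** * Deadlines and deliveries *)

Lemma time_mono k k' : k <= k' -> (tm k <= tm k')%R.
Proof.
move=> /subnK <-; elim: (k' - k) => [|n IH] //.
by rewrite addSn; apply: le_trans IH (time_le E _).
Qed.

Lemma time_lt_index k k' : (tm k < tm k')%R -> k < k'.
Proof. by rewrite ltnNge => lt; apply/negP => /time_mono; rewrite leNgt lt. Qed.

(** Deadlines become indices. Several steps may share one time, so the index is taken least:
    everything before it has happened by [T]. *)
Lemma first_after T : exists k, (T < tm k)%R /\ (forall k0, k0 < k -> (tm k0 <= T)%R).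
Proof.
have ex : exists k, (T < tm k)%R by exact: time_diverges.
case: (ex_minnP ex) => k lt mn; exists k; split=> // k0 lt0.
by rewrite leNgt; apply/negP => /mn; rewrite leqNgt lt0.
Qed.

Lemma after_index T k k' : (T < tm k')%R -> (forall k0, k0 < k -> (tm k0 <= T)%R) -> k <= k'.
Proof. by move=> lt h; rewrite leqNgt; apply/negP => /h; rewrite leNgt lt. Qed.

Lemma net_sent k pk : pk \in net (conf E k) -> exists2 k0, k0 < k & sent_at pk = tm k0.
Proof.
elim: k => [|k IH]; first by rewrite conf0.
have [i [o tr]] := trans_conf k.
case/(tr_net tr) => [/IH[k0 lt e]|->]; last by exists k.
by exists k0 => //; apply: leqW.
Qed.

(** At step [k'] the packet would be overdue, so it has left the net, and its effect is stable from
    its delivery on. *)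
Lemma delivered k k' pk T : pk \in net (conf E k) -> (GST S <= T)%R ->
  (forall k0, k0 < k -> (tm k0 <= T)%R) -> (T + d < tm k')%R ->
  effect S (dst pk) (src pk) (contents pk) (st k' (dst pk)).
Proof.
move=> pkn gT hT lt.
have lek : k <= k' by apply: after_index hT; have := d_gt0; move: lt; lra.
have : pk \in net (conf E k') \/ effect S (dst pk) (src pk) (contents pk) (st k' (dst pk)).
  move: lek pkn => /subnK <-; elim: (k' - k) => [|n IH] //; first by left.
  move=> /IH{IH}; rewrite addSn => -[pkn|ef].
    by have [_ _ h] := step_ok hash_inj f_gt0 (config_inv_conf (n + k)) (conf_step E (n +
      k)); apply: h.
  right; have [o [ev _]] := evolve_conf (n + k) (dst pk).
  exact: (effect_stable ev ef).
case=> // /(nthP pk)[n ltn en].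
have [/(_ pk (take n (net (conf E k'))) (drop n.+1 (net (conf E k')))) + _ _ _] :=
  conf_not_overdue E k'.
rewrite -{1}(cat_take_drop n (net (conf E k'))) (drop_nth pk ltn) en => /(_ erefl).
have [k0 lt0 ->] := net_sent pkn.
have : (Num.max (tm k0) (GST S) <= T)%R by rewrite ge_max hT.
by move: lt; lra.
Qed.

Lemma broadcast_sent k i m j : m \in broadcasts (st k i) ->
  exists2 k0, k0 < k & Packet i j m (tm k0) \in net (conf E k0.+1).
Proof.
elim: k => [|k IH]; first by rewrite conf0.
have [o [ev out]] := evolve_conf k i.
case/(ev_sent ev) => [/IH[k0 lt h]|h]; first by exists k0 => //; apply: leqW.
by exists k => //; exact: (out _ (h j)).
Qed.

Lemma broadcast_delivered k k' i m j T : m \in broadcasts (st k i) -> (GST S <= T)%R ->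
  (forall k0, k0 < k -> (tm k0 <= T)%R) -> (T + d < tm k')%R ->
  effect S j i m (st k' j).
Proof.
move=> /broadcast_sent - /(_ j)[k0 lt pk] gT hT ltT.
apply: (delivered pk gT) ltT => k1 le1; apply: hT; exact: leq_trans le1 lt.
Qed.

(** Traces the current [highest_voted_view] back to the step that set it, and so to vote packets
    actually sent to both leaders. *)
Lemma votes_sent k i (v := highest_voted_view (st k i)) :
  [\/ v = 0, timed_out (wld k) i v |
   exists p, [/\ issued_in S (wld k) p, p_view p = v &
     forall j, j = leader f v \/ j = leader f v.+1 -> exists2 k0, k0 < k &
       Packet i j (MVote Payload (make_vote S i v (h_hash (p_header p)))) (tm k0) \in net
         (conf E k0.+1)]].
Proof.
rewrite {}/v; elim: k => [|k IH]; first by constructor 1; rewrite conf0.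
have [o [ev out]] := evolve_conf k i.
have sub := bc_mono (leqnSn k).
case: (ev_vote ev) => [->|[M [Mb e]]|[p /= [ip pv o1 o2]]].
- case: IH => [h|h|[p [ip pv h]]]; [by constructor 1|by constructor 2;
  apply: timed_out_mono h|].
  constructor 3; exists p; split=> //; first exact: issued_in_mono ip.
  by move=> j /h[k0 lt ?]; exists k0 => //; apply: leqW.
- by constructor 2; exists M.
- constructor 3; exists p; split=> //; first exact: issued_in_mono ip.
  by move=> j [->|->]; exists k => //; [exact: (out _ o1)|exact: (out _ o2)].
Qed.

(** * Synchronisation of views *)

Lemma started_after k i : (GST S <= tm k)%R -> started (st k i).
Proof.
move=> le; have [_ h _ _] := conf_not_overdue E k.
by apply: contraT => /h; rewrite ltNge le.
Qed.

(** Every reason in [entry_backed] beyond the start consists of messages broadcast to all. A QC from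
    its leader and a proposal move the receiver directly; a quorum of timeouts recorded by a
    validator still at [v] or below would violate [timeouts_short]. *)
Lemma entry_sync k k' v T : entry_backed S (wld k) v -> (GST S <= T)%R ->
  (forall k0, k0 < k -> (tm k0 <= T)%R) -> (T + d < tm k')%R ->
  forall j, v < view k' j.
Proof.
move=> en gT hT lt j.
have lek : k <= k' by apply: after_index hT; have := d_gt0; move: lt; lra.
have dl i m : m \in broadcasts (st k i) -> effect S j i m (st k' j).
  by move=> h; apply: (broadcast_delivered j h gT hT lt).
have sj : started (st k' j).
  by apply: started_after; have := d_gt0; move: lt gT; lra.
case: en => [->|[l [ul sl hl]]|[q [qb ev]]|[p [ip pv]]].
- exact: sj.
- rewrite ltnNge; apply/negP => le.
  have [iv _ ht _ _] := local_conf sj.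
  have := ht v le; rewrite ltnNge; apply/negP; rewrite negbK; apply: leq_trans sl _.
  rewrite -(size_map (fun M => signer (m_sig M)) [seq M <- timeouts (st k' j) | m_view M
    == v]).
  apply: uniq_leq_size => // i /hl[M [Mb ev]].
  have := dl _ _ Mb; rewrite /= ev => -[|[M' [M't e1 e2]]]; first by rewrite ltnNge le.
  have si : started (st k i).
    by apply: contraT => /(g_unst (config_inv_conf k)) e; move: Mb; rewrite /world_of e.
  have [_ eM] := inv_bto (lo_inv (local_conf si)) Mb.
  by apply/mapP; exists M'; rewrite ?mem_filter ?e1 ?eqxx // e2 eM.
- by subst v; apply: (dl _ _ qb).
- case: (issued_in_valid (world_ok_conf k) ip) => [e|[pb vp _]]; first by move: pv; rewrite e.
  by have [_ /(_ erefl vp)] := dl _ _ pb; rewrite pv => -[/ltnW|[-> _]].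
Qed.

Lemma cert_entry k i : 0 < view k i -> entry_backed S (wld k) (view k i).-1.
Proof.
move=> si; have [iv _ _ _ _] := local_conf si.
case: (inv_cert iv) => [<-|[c [ec <-]]].
  by have [[_ e _] _] := inv_qc iv.
by have [_ e _] := inv_tc iv ec.
Qed.

Lemma view_sync k k' i v T : v <= view k i -> (GST S <= T)%R ->
  (forall k0, k0 < k -> (tm k0 <= T)%R) -> (T + d < tm k')%R ->
  forall j, v <= view k' j.
Proof.
case: v => [|v] // le gT hT lt j; apply: leq_trans le _.
have := @cert_entry k i; case e: (view k i) => [|u] // /(_ isT) en.
exact: (entry_sync en gT hT lt).
Qed.

(** Reaching [v] includes going beyond it, since a validator may skip views. *)
Definition first_entry v k := (forall i, view k i < v) /\ exists i, v <= view k.+1 i.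

Lemma first_entry_exists v k k' : (forall i, view k i < v) -> (exists i, v <= view k' i) ->
  exists k0, k <= k0 < k' /\ first_entry v k0.
Proof.
move=> lo hi; have lek : k <= k'.
  rewrite leqNgt; apply/negP => /ltnW le; case: hi => i hi.
  by have := leq_trans hi (view_mono i le); rewrite leqNgt lo.
move: hi; rewrite -(subnK lek); elim: (k' - k) => [[i]|n IH].
  by rewrite leqNgt lo.
move=> hi; case: (pselect (exists i, v <= view (n + k) i)) => [/IH[k0 [/andP[l1 l2] fe]]|no].
  by exists k0; rewrite l1 addSn ltnW.
exists (n + k); rewrite leq_addl addSn ltnSn; split=> //; split; last by rewrite -addSn.
by move=> i; rewrite ltnNge; apply/negP => h; apply: no; exists i.
Qed.

Lemma first_entry_lt v k k' i : first_entry v k -> v <= view k' i -> k < k'.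
Proof.
case=> lo _ le; rewrite ltnNge; apply/negP => /(view_mono i) /(leq_trans le).
by rewrite leqNgt lo.
Qed.

Lemma first_entry_bound v k T : first_entry v k -> (tm k <= T)%R ->
  forall k0, k0 < k.+1 -> (tm k0 <= T)%R.
Proof. by move=> _ le k0; rewrite ltnS => /time_mono h; apply: le_trans le. Qed.

Lemma timer_ge v k0 k i : first_entry v k0 -> v <= view k i ->
  (tm k0 <= timer_start (st k i))%R.
Proof.
move=> fe; elim: k => [|k IH] le; first by have := first_entry_lt fe le.
have ltk : k0 <= k by have := first_entry_lt fe le; rewrite ltnS.
have [o [ev _]] := evolve_conf k i; case: (ev_cv ev) => [[e1 ->]|[_ ->]];
  last exact: time_mono.
by apply: IH; rewrite -e1.
Qed.

Lemma timer_le k i : started (st k i) -> exists2 k0, k0 < k & timer_start (st k i) = tm k0.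
Proof.
elim: k => [|k IH]; first by rewrite conf0.
rewrite /started => s1; have [o [ev _]] := evolve_conf k i.
case: (ev_cv ev) => [[e1 ->]|[_ ->]]; last by exists k.
by move: s1; rewrite e1 => /IH[k0 lt e]; exists k0 => //; apply: leqW.
Qed.

Lemma new_proposal_view k k' j p : k <= k' -> MProposal p \in broadcasts (st k' j) ->
  MProposal p \in broadcasts (st k j) \/ view k j <= p_view p.
Proof.
move=> /subnK <-; elim: (k' - k) => [|n IH] //; first by left.
rewrite addSn; have [o [ev _]] := evolve_conf (n + k) j => /(ev_new ev)[/IH //|le].
by right; apply: leq_trans le; apply: view_mono; apply: leq_addl.
Qed.

(** * Progress within a view *)

Lemma no_timeout_mono v k k' : k <= k' -> ~ some_timeout (wld k') v -> ~ some_timeout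
  (wld k) v.
Proof. by move=> le no [j h]; apply: no; exists j; apply: timed_out_mono h; apply: bc_mono.
  Qed.

(* If the leader of [v] recovers, the proposal it looks for was issued before
   [v] was entered by everybody, hence has already been delivered to it. *)
Lemma leader_has_proposed v ka kb T (L := leader f v) : 0 < v -> ka <= kb ->
  (forall j, v <= view ka j) -> view kb L = v -> (GST S <= T)%R ->
  (forall k0, k0 < ka -> (tm k0 <= T)%R) -> (T + d < tm kb)%R ->
  has_proposed (st kb L) v.
Proof.
move=> v0 leab all_ge ev gT hT lt.
have sL : started (st kb L) by rewrite /started ev.
have [iv _ _ hl nl] := local_conf sL.
case: (hl _); rewrite ?ev // => -[r rs er].
have [kc cq _ _ _] := inv_rec iv rs.
have [Tp [cT vT /andP[T0 Tle] [p [ip pid]]]] := known_cert_tcP kc cq.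
have [_ pv] := issued_in_tip hash_inj (world_ok_conf kb) ip vT T0 pid.
have pp : p \in proposals (st kb L).
  case: (issued_in_valid (world_ok_conf kb) ip) => [e|[pb _ _]]; first by move: T0;
    rewrite -pv e.
  case: (new_proposal_view leab pb) => [pa|le]; last first.
    by have := leq_trans (all_ge _) le; rewrite pv -er ltnNge Tle.
  by have [] := broadcast_delivered L pa gT hT lt.
by case: (lookup_None (nl _ _ rs cT) pp).
Qed.

(* With [e] the time of entry: all are in [v] at [e + d], its leader has proposed
   at [e + 2 d], all have voted at [e + 3 d], and at [e + 4 d] the next leader
   has a quorum of votes. *)
Lemma progress v k0 k : 0 < v -> first_entry v k0 -> (GST S <= tm k0)%R ->
  ~ some_timeout (wld k) v -> (tm k0 + 4 * d < tm k)%R -> exists i, v < view k i.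
Proof.
move=> v0 fe gk noto lt; apply: contrapT => no.
have up i k1 : k1 <= k -> view k1 i <= v.
  move=> le; apply: (leq_trans (view_mono i le)); rewrite leqNgt; apply/negP => h.
  by apply: no; exists i.
have d0 := d_gt0; set e := tm k0 in gk lt *.
have [ka [lta hka]] := first_after (e + d)%R.
have [kb [ltb hkb]] := first_after (e + d + d)%R.
have [kc [ltc hkc]] := first_after (e + d + d + d)%R.
have lekc : kc <= k by apply: after_index hkc; lra.
have lekb : kb <= kc by apply: after_index hkb; lra.
have leka : ka <= kb by apply: after_index hka; lra.
have [_ [i0 hi0]] := fe.
have all_ge j : v <= view ka j.
  by apply: (view_sync hi0 gk _ lta); apply: first_entry_bound fe _.
have all_eq j k1 : ka <= k1 -> k1 <= k -> view k1 j = v.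
  move=> l1 l2; apply/eqP; rewrite eqn_leq up //=.
  exact: leq_trans (all_ge j) (view_mono j l1).
have g1 : (GST S <= e + d)%R by lra.
have g2 : (GST S <= e + d + d)%R by lra.
have g3 : (GST S <= e + d + d + d)%R by lra.
have hp := leader_has_proposed v0 leka all_ge (all_eq _ _ leka (leq_trans lekb lekc)) g1
  hka ltb.
case/hasP: hp => -[p|||||||] // pb /eqP pv.
have ip k1 : kb <= k1 -> issued_in S (wld k1) p.
  by move=> le; right; exists (leader f v); apply: (bc_mono le).
have [_ vp _] := wo_issued (world_ok_conf kb) pb.
have voted j : exists2 k1, k1 < kc & Packet j (leader f v.+1)
    (MVote Payload (make_vote S j v (h_hash (p_header p)))) (tm k1) \in net (conf E k1.+1).
  have [_] := broadcast_delivered j pb g2 hkb ltc.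
  rewrite pv => /(_ erefl vp); rewrite (all_eq j kc) ?(leq_trans leka) // ltnn => -[//|[_ vh]].
  have sj : started (st kc j) by rewrite /started (all_eq j kc) ?(leq_trans leka).
  have hv : highest_voted_view (st kc j) = v.
    apply/eqP; rewrite eqn_leq vh andbT.
    have := inv_hv (lo_inv (local_conf sj)).
    by rewrite (all_eq j kc) ?(leq_trans leka).
  have := votes_sent kc j; rewrite /= hv => -[e0|to|[p' [ip' pv' h]]].
  (* Nobody having timed out of [v], the recorded vote is for a proposal of view [v], and there is
     only [p]. *)
  - by rewrite e0 in v0.
  - by case: noto; exists j; apply: timed_out_mono to; apply: bc_mono.
  - have -> : p = p' by apply: (issued_in_view_inj (world_ok_conf kc)) => //;
    [exact: ip|rewrite pv].
    by apply: h; right.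
set L := leader f v.+1 in voted.
have vL : view k L = v by apply: all_eq => //; apply: leq_trans leka _; apply: leq_trans lekc.
have sL : started (st k L) by rewrite /started vL.
have voteL j : make_vote S j v (h_hash (p_header p)) \in votes (st k L).
  have [k1 ltk1 pk] := voted j.
  have lt4 : (e + d + d + d + d < tm k)%R by lra.
  have hk1 k2 : k2 < k1.+1 -> (tm k2 <= e + d + d + d)%R.
    by move=> le2; apply: hkc; apply: leq_trans le2 _.
  have := delivered pk g3 hk1 lt4.
  by rewrite /= vL ltnn => /(_ (or_intror erefl))[].
(* While [L] is in [v], its votes for one id stay below a quorum; but those of all [3 * f + 1]
   validators are stored and have the id of [p]. *)
have [_ hv _ _ _] := local_conf sL.
have := hv _ (voteL ord0); rewrite vL leqnn => /(_ isT).
rewrite ltnNge => /negP; apply.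
have -> : quorum = (2 * f).+1 by [].
apply: (@leq_trans (3 * f).+1); first by rewrite ltnS leq_mul2r orbT.
rewrite -{1}(card_ord (3 * f).+1) cardE -(size_map (fun j => make_vote S j v (h_hash
  (p_header p)))).
apply: uniq_leq_size.
  by rewrite map_inj_uniq ?enum_uniq // => x y [].
by move=> w /mapP[j _ ->]; rewrite mem_filter voteL andbT.
Qed.

(** [Theta_view] contains [3 + 2 + 3] delays [Delta], the middle two from [Theta_recovery], and
    [delta] is at most [Delta]. *)
Lemma Theta_ge : (8 * d <= Theta_view S)%R.
Proof.
have := delta_le_Delta S_ok; have := Theta_interval_ge0 S_ok.
rewrite /Theta_view /Theta_recovery => h1 h2.
have : (0 <= (further_rounds S)%:R * Theta_interval S)%R by apply: mulr_ge0.
lra.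
Qed.

(* A timer of [v] expires after [8 d] at the earliest, when everybody has left. *)
Lemma no_timeout v k0 : 0 < v -> first_entry v k0 -> (GST S <= tm k0)%R ->
  forall k, ~ some_timeout (wld k) v.
Proof.
move=> v0 fe gk; elim=> [[j [M []]]|k IH]; first by rewrite /world_of conf0.
have [i [o tr]] := trans_conf k.
case/(tr_TO tr) => // -[si ev]; rewrite /elapsed.
have d0 := d_gt0; have t8 := Theta_ge.
have le1 : (tm k0 <= timer_start (st k i))%R by apply: (timer_ge fe); rewrite ev.
have le2 : (timer_start (st k i) <= tm k)%R.
  by have [k1 lt ->] := timer_le si; apply: time_mono; apply: ltnW.
rewrite (clock_accurate S_ok) //; last exact: le_trans gk le1.
move=> le3.
have [k1 [lt1 h1]] := first_after (tm k0 + 4 * d)%R.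
have le4 : k1 <= k by apply: (after_index (T := (tm k0 + 4 * d)%R)) h1; lra.
(* The induction hypothesis covers all steps up to [k], so [progress] applies; by [5 d] after the
   entry the owner of the expiring timer has left [v]. *)
have [i' vi'] := progress v0 fe gk (no_timeout_mono le4 IH) lt1.
have lt5 : (tm k0 + 4 * d + d < tm k)%R by lra.
have g4 : (GST S <= tm k0 + 4 * d)%R by lra.
by have := view_sync vi' g4 h1 lt5 i; rewrite ev ltnn.
Qed.

Lemma next_entry v k0 : 0 < v -> first_entry v k0 -> (GST S <= tm k0)%R ->
  exists k1, [/\ first_entry v.+1 k1, (tm k0 <= tm k1)%R & (tm k1 <= tm k0 + 4 * d)%R].
Proof.
move=> v0 fe gk; have nto := no_timeout v0 fe gk.
have [k [lt h]] := first_after (tm k0 + 4 * d)%R.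
have hi := progress v0 fe gk (nto k) lt.
have [|k1 [/andP[l1 l2] fe1]] := @first_entry_exists v.+1 k0 k _ hi.
  by have [lo _] := fe; move=> i; apply: leqW.
by exists k1; split=> //; [exact: time_mono|exact: h].
Qed.

(** * From GST to the first regular view *)

Lemma all_time_out v k1 k2 T : (GST S <= T)%R -> (forall k0, k0 < k1 -> (tm k0 <= T)%R) ->
  k1 <= k2 -> (forall i, view k1 i = v) -> (forall i, view k2 i = v) -> 0 < v ->
  (T + Theta_view S < tm k2)%R -> quorum_timed_out (wld k2) v.
Proof.
move=> gT hT le e1 e2 v0 lt.
exists (enum 'I_(3 * f).+1); rewrite enum_uniq -cardE card_ord; split=> //.
  by rewrite ltnS leq_mul2r orbT.
move=> i _.
have s1 : started (st k1 i) by rewrite /started e1.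
have s2 : started (st k2 i) by rewrite /started e2.
(* A timer is restarted only together with a change of view. *)
have timer : (timer_start (st k2 i) <= T)%R.
  have keep : view k1 i < view k2 i \/ timer_start (st k2 i) = timer_start (st k1 i).
    move: le; clear e2 s2 lt => /subnK <-; elim: (k2 - k1) => [|n IH]; first by right.
    rewrite addSn; have [o [ev _]] := evolve_conf (n + k1) i.
    case: (ev_cv ev) => [[e3 e4]|[l _]]; first by rewrite e3 e4.
    by left; apply: leq_ltn_trans l; apply: view_mono; apply: leq_addl.
  case: keep => [|->]; first by rewrite e1 e2 ltnn.
  by have [k0 lt0 ->] := timer_le s1; apply: hT.
have [_ _ hto _] := conf_not_overdue E k2.
have : has_timed_out (st k2 i) v.
  apply: contraT => nto; have := hto i s2; rewrite e2 => /(_ nto).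
  (* The timer may have started before GST, when clocks drift: up to [T] monotonicity is used, from
     [T] on accuracy. *)
  have := clock_monotone S_ok i timer.
  have := clock_accurate S_ok i gT (y := tm k2).
  have t8 := Theta_ge; have d0 := d_gt0.
  rewrite /elapsed => h1 h2 h3; have := h1 _; lra.
by case/hasP => -[|||M||||] // Mb /eqP e; exists M.
Qed.

(** [v0] is the successor of the largest view [vs] at the first step not before GST, hence first
    entered after GST. If nobody went beyond [vs], all would be in it by [GST + d] and time out
    within [Theta_view], and these timeouts would drive everybody on after another [d]. *)
Lemma first_view : exists v0 k0, [/\ 0 < v0, first_entry v0 k0, (GST S <= tm k0)%R
  & (tm k0 <= GST S + Theta_view S + 2 * d)%R].
Proof.
have d0 := d_gt0; have t8 := Theta_ge.
have exG : exists k, (GST S <= tm k)%R.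
  by have [k lt] := time_diverges E (GST S); exists k; apply: ltW.
case: (ex_minnP exG) => kG gG mnG.
have hG k0 : k0 < kG -> (tm k0 <= GST S)%R.
  by move=> lt; apply: ltW; rewrite ltNge; apply/negP => /mnG; rewrite leqNgt lt.
pose vs := \max_(i < (3 * f).+1) view kG i.
have vsle i : view kG i <= vs by exact: (bigop.leq_bigmax (F := fun i => view kG i) i).
have [i0 hi0] : exists i0, vs = view kG i0.
  by have [|i0 h] := @bigop.eq_bigmax _ (fun i : validator => view kG i);
    [rewrite card_ord|exists i0].
have vs0 : 0 < vs by rewrite hi0; apply: started_after.
have [k1 [lt1 h1]] := first_after (GST S + d)%R.
have [k2 [lt2 h2]] := first_after (GST S + d + Theta_view S)%R.
have [k3 [lt3 h3]] := first_after (GST S + d + Theta_view S + d)%R.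
have hi : exists i, vs.+1 <= view k3 i.
  apply: contrapT => no.
  have up i k : k <= k3 -> view k i <= vs.
    move=> le; apply: (leq_trans (view_mono i le)); rewrite leqNgt; apply/negP => h.
    by apply: no; exists i.
  have l12 : k1 <= k2 by apply: after_index h1; lra.
  have l23 : k2 <= k3 by apply: after_index h2; lra.
  have lo j : vs <= view k1 j.
    by apply: (@view_sync kG k1 i0 _ (GST S)) => //; rewrite hi0.
  have eq1 j k : k1 <= k -> k <= k3 -> view k j = vs.
    move=> l1 l2; apply/eqP; rewrite eqn_leq up //=.
    exact: leq_trans (lo j) (view_mono j l1).
  have g1 : (GST S <= GST S + d)%R by lra.
  have tq : quorum_timed_out (wld k2) vs.
    apply: (all_time_out g1 h1 l12) => // i; apply: eq1 => //; exact: leq_trans l23.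
  have g2 : (GST S <= GST S + d + Theta_view S)%R by lra.
  have := entry_sync (Or42 _ _ _ tq) g2 h2 lt3 ord0.
  by rewrite (eq1 ord0 k3) ?ltnn // (leq_trans l12).
have [|k0 [/andP[l1 l2] fe]] := @first_entry_exists vs.+1 kG k3 _ hi.
  by move=> i; rewrite ltnS.
exists vs.+1, k0; split=> //; first exact: le_trans gG (time_mono l1).
have := h3 _ l2; lra.
Qed.

(** * The regime without timeouts *)

Section Happy.

Variables (v0 k0 : nat).
Hypotheses (v0_gt0 : 0 < v0) (fe0 : first_entry v0 k0) (gk0 : (GST S <= tm k0)%R).

Lemma entries n : exists k, [/\ first_entry (v0 + n) k, (tm k0 <= tm k)%R
  & (tm k <= tm k0 + n%:R * (4 * d))%R].
Proof.
elim: n => [|n [k [fe le1 le2]]]; first by exists k0; rewrite addn0 mul0r addr0.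
have [|k' [fe' le3 le4]] := next_entry (ltn_addr n v0_gt0) fe; first exact: le_trans le1.
exists k'; rewrite addnS; split=> //; first exact: le_trans le3.
by rewrite -natr1 mulrDl mul1r; lra.
Qed.

Lemma happy_no_timeout v k : v0 <= v -> ~ some_timeout (wld k) v.
Proof.
move=> /subnKC e; have [k1 [fe le _]] := entries (v - v0); rewrite e in fe.
apply: (no_timeout _ fe); last exact: le_trans le.
by rewrite -e ltn_addr.
Qed.

Lemma quorum_timed_out_some (W : world f Payload Hash) v : quorum_timed_out W v ->
  some_timeout W v.
Proof. by case=> [[|j l]] [_ // _ h]; exists j; apply: h; rewrite mem_head. Qed.

Lemma happy_Vid k v id : v0 <= v -> id_backed S (wld k) v id ->
  exists p, [/\ issued_in S (wld k) p, p_view p = v & p_id p = id].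
Proof. by move=> le [h|//]; case: (@happy_no_timeout v k). Qed.

(** A TC in [p] would be of a view from [v0] on and need timeouts; so the certificate of [p] is a QC
    of the preceding view, and for lack of timeouts it points to an issued proposal. *)
Lemma happy_parent k p : issued_in S (wld k) p -> v0 < p_view p ->
  [/\ h_view (p_header p) = p_view p, (qc_view (p_qc p)).+1 = p_view p &
   exists p', [/\ issued_in S (wld k) p',
     (p_view p').+1 = p_view p & p_id p' = qc_id (p_qc p)]].
Proof.
move=> ip lt; case: (issued_in_valid (world_ok_conf k) ip) => [e|[_ vp kp]].
  by move: lt; rewrite e.
case tcp: (p_tc p) kp => [c|]; rewrite /pcert tcp => -[_ _].
  case=> /quorum_timed_out_some /happy_no_timeout no _; exfalso; apply: no.
  by have [_] := valid_proposal_cert vp; rewrite /pcert tcp /= => e; rewrite -ltnS e.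
have [_ hv qv vq] := valid_proposal_notc vp tcp.
have le : v0 <= qc_view (p_qc p) by rewrite -ltnS qv.
move=> /(happy_Vid le)[p' [ip' pv' pid]]; split=> //.
by exists p'; rewrite pv'.
Qed.

(** Descends from view [w + n] to [w] one view at a time. The list [ps] is arbitrary because the
    lemma serves twice: for [issued], to learn what has been obtained, and for the stored proposals,
    to learn what is committed. *)
Lemma happy_chain k w (ps : seq (proposal f Payload Hash)) n p fuel : v0 < w ->
  {in ps, forall p, issued_in S (wld k) p} ->
  (forall p', issued_in S (wld k) p' -> w <= p_view p' <= w + n -> p' \in ps) ->
  issued_in S (wld k) p -> p_view p = w + n -> n < fuel ->
  exists p', [/\ p' \in proposal_chain ps fuel (p_id p),
    issued_in S (wld k) p' & p_view p' = w].
Proof.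
move=> ltw psI; elim: n p fuel => [|n IH] p [|fuel] // hps ip pv ltf.
  rewrite addn0 in pv; exists p; split=> //=.
  case el: (lookup (p_id p) ps) => [p'|]; last first.
    by case: (lookup_None el (hps _ ip _)) => //; rewrite pv addn0 leqnn.
  have [pp' e] := lookupP el;
    have -> : p = p' by apply: (issued_in_id_inj hash_inj (world_ok_conf k)) => //; exact: psI.
  exact: mem_head.
have lt : v0 < p_view p by rewrite pv; apply: leq_trans ltw (leq_addr _ _).
have [hv qv [p1 [ip1 pv1 e1]]] := happy_parent ip lt.
have [||||p' [h1 h2 h3]] := IH p1 fuel => //.
- by move=> p' ip' /andP[l1 l2]; apply: hps => //; rewrite l1 addnS leqW.
- by apply/eqP; rewrite -eqSS pv1 pv addnS.
exists p'; split=> //=.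
have pp : p \in ps by apply: hps => //; rewrite pv leqnn leq_addr.
case el: (lookup (p_id p) ps) => [p2|]; last by case: (lookup_None el pp).
have [pp2 e] := lookupP el;
  have -> : p2 = p by apply: (issued_in_id_inj hash_inj (world_ok_conf k)) => //; exact: psI.
by rewrite inE -e1 h1 orbT.
Qed.

(* Validators may skip views; what they skip is committed through the ancestors. *)
Lemma happy_committed k i w : v0 < w -> w.+2 <= view k i ->
  exists p, [/\ issued_in S (wld k) p, p_view p = w, h_view (p_header p) = w
     & p_block p \in committed (st k i)].
Proof.
move=> ltw; elim: k => [|k IH]; first by rewrite conf0.
have sub := bc_mono (leqnSn k).
have old : w.+2 <= view k i -> exists p, [/\ issued_in S (wld k.+1) p, p_view p = w,
  h_view (p_header p) = w
     & p_block p \in committed (st k.+1 i)].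
  move=> /IH[p [ip pv hv pc]]; exists p; split=> //; first exact: issued_in_mono ip.
  exact: committed_mono pc.
have [i' [o tr]] := trans_conf k.
case: (eqVneq i i') tr => [<-|ne] tr; last by rewrite (tr_other tr ne) in old *.
set u := view k.+1 i => leu.
have gk : (GST S <= tm k)%R.
  apply: (le_trans gk0); apply: time_mono; rewrite -ltnS.
  by apply: (first_entry_lt fe0 (i := i)); apply: leq_trans leu; lia.
case: (tr_ce tr) => [|]; last by rewrite ltNge gk.
case=> [e|/quorum_timed_out_some h|[q [ps [qu vid psI qps cps]]]].
- by apply: old; rewrite -e.
- by case: (happy_no_timeout _ h); rewrite -/u; move: leu ltw; case: (u) => [|[|u']] //=; lia.
have gi := config_inv_conf k.
rewrite -/u in qu.
have v0q : v0 <= qc_view q by lia.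
have [p1 [ip1 pv1 pid1]] := happy_Vid v0q vid.
have lt1 : v0 < p_view p1 by rewrite pv1; lia.
(* Having obtained what [q] leads to, the validator stores every proposal issued in the views from
   [w] to that of [q], including the views it skipped. *)
have inps p' : issued_in S (wld k) p' -> w <= p_view p' <= qc_view q -> p' \in ps.
  move=> ip' /andP[l1 l2]; apply: qps.
  have l3 : v0 < p_view p' by apply: leq_trans l1.
  have [|||||p2 [h1 h2 h3]] := @happy_chain k (p_view p') (issued (conf E k)) (qc_view q
    - p_view p') p1 (qc_view q).+1 l3 => //.
  + by move=> x /(g_iss gi).
  + by move=> x ix _; apply/(g_iss gi).
  + by rewrite pv1 subnKC.
  + by rewrite ltnS leq_subr.
  by rewrite -(issued_in_view_inj (world_ok_conf k) h2 ip' h3) /pointed_by -pid1.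
have look p' : p' \in ps -> lookup (p_id p') ps = Some p'.
  move=> pp'; case el: (lookup (p_id p') ps) => [p2|]; last by case: (lookup_None el pp').
  have [pp2 e] := lookupP el; congr Some.
  by apply: (issued_in_id_inj hash_inj (world_ok_conf k)) => //; exact: psI.
have [_ qv1 [p2 [ip2 pv2 e2]]] := happy_parent ip1 lt1.
have p1s : p1 \in ps by apply: inps => //; rewrite pv1 leqnn andbT; lia.
have p2s : p2 \in ps by apply: inps => //; lia.
have lt2 : v0 < p_view p2 by lia.
have [hv2 qv2 [p3 [ip3 pv3 e3]]] := happy_parent ip2 lt2.
(* [p1] is pointed to by [q] and [p2] is its parent; their views are consecutive, so the rule for
   final commits applies to [p2]. *)
have cb : commit_blocks ps q = with_ancestors ps (p_block p2).
  by rewrite /commit_blocks -pid1 look // -e2 look // qv1 pv1 eqxx.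
suff [p [ip pv pc]] : exists p, [/\ issued_in S (wld k) p,
  p_view p = w & p_block p \in with_ancestors ps (p_block p2)].
  exists p; split=> //; first exact: issued_in_mono ip.
    by have [|->] := happy_parent ip; rewrite pv.
  by apply: cps; rewrite cb.
(* Since [u] is two more than the view of [p2], [w] is that view or an earlier one; the latter is
   reached from the parent [p3] of [p2]. *)
case: (eqVneq w (p_view p2)) => [e|ne]; first by exists p2; rewrite mem_head.
have [|||||p [h1 h2 h3]] := @happy_chain k w ps (p_view p3 - w) p3 (qc_view (p_qc p2)).+1
  ltw => //.
- move=> x ix /andP[l1]; rewrite subnKC; last by lia.
  by move=> l2; apply: inps => //; lia.
- by rewrite subnKC //; lia.
- by lia.
exists p; split=> //; rewrite inE; apply/orP; right; apply: map_f.
by rewrite /pointed_by -e3.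
Qed.

End Happy.

(** A committed block was proposed in a view at least its own, by a leader that had entered that
    view. *)
Lemma not_committed_before w k b i : 0 < w -> first_entry w k -> h_view (b_header b) = w ->
  b \notin committed (st k i).
Proof.
move=> w0 [lo _] hb; apply/negP => bc.
have si : started (st k i).
  by apply: contraT => /(g_unst (config_inv_conf k)) e; move: bc; rewrite e.
have [p [ip eb]] := inv_committed (lo_inv (local_conf si)) bc.
have [_ le _] := issued_in_block (world_ok_conf k) ip.
move: le; rewrite /p_header eb hb => le.
case: (issued_in_valid (world_ok_conf k) ip) => [e|[pb _ _]]; first by move: le;
  rewrite e leqNgt w0.
set j := leader f (p_view p) in pb.
have sj : started (st k j).
  by apply: contraT => /(g_unst (config_inv_conf k)) e; move: pb; rewrite /world_of e.
have [_ le' _ _] := inv_bprop (lo_inv (local_conf sj)) pb.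
by have := leq_trans le le'; rewrite leqNgt lo.
Qed.

(** * Counting the commits in the window *)

Lemma commit_step k k' i b : b \notin committed (st k i) -> b \in committed (st k' i) ->
  exists k1, [/\ k <= k1 < k', b \notin committed (st k1 i) & b \in committed (st k1.+1 i)].
Proof.
move=> nb hb; have lek : k <= k'.
  by rewrite leqNgt; apply/negP => /ltnW le; move: nb; rewrite (committed_mono le hb).
move: hb; rewrite -(subnK lek); elim: (k' - k) => [|n IH] hb; first by rewrite hb in nb.
case: (boolP (b \in committed (st (n + k) i))) => [/IH[k1 [/andP[l1 l2] h1 h2]]|nb1].
  by exists k1; rewrite l1 addSn ltnW.
by exists (n + k); rewrite leq_addl addSn ltnSn -addSn.
Qed.

(** The bound on [h_view] is carried along so that the block added at each step is new. *)
Lemma distinct_blocks (P : block f Payload Hash -> Prop) w n :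
  (forall v, w <= v < w + n -> exists b, h_view (b_header b) = v /\ P b) ->
  exists bs : seq (block f Payload Hash), [/\ uniq bs, size bs = n &
    forall b, b \in bs -> P b /\ h_view (b_header b) < w + n].
Proof.
elim: n => [|n IH] h; first by exists [::].
have [v /andP[l1 l2]|bs [u sz hb]] := IH.
  by apply: h; rewrite l1 addnS leqW.
have [|b [vb Pb]] := h (w + n); first by rewrite leq_addr addnS /=.
exists (b :: bs); split=> /=; last 1 first.
- move=> b'; rewrite inE => /orP[/eqP ->|/hb[? lt]]; first by rewrite vb addnS.
  by split=> //; rewrite addnS ltnW.
- by rewrite u andbT; apply/negP => /hb[_]; rewrite vb ltnn.
- by rewrite sz.
Qed.

Lemma throughput i t1 t2 : (GST S + 4 * Theta_view S + 4 * d < t1)%R ->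
  (26 * d <= t2 - t1)%R ->
  exists bs : seq (block f Payload Hash), [/\ uniq bs,
    forall b, b \in bs -> commits_during E i t1 t2 b
  & (8^-1 * ((t2 - t1) / d) <= (size bs)%:R)%R].
Proof.
move=> ht1 ht2; have d0 := d_gt0; have t8 := Theta_ge.
have [v0 [k0 [v0_gt0 fe0 gk0 lek0]]] := first_view.
have k0t1 : (tm k0 < t1)%R by lra.
(* [w] is entered at or after [t1] while its predecessor was entered before [t1]; this gives the
   bound [t1 + 4 d]. *)
have [w [kw [ltw few lew1 lew2]]] : exists w kw, [/\ v0 < w, first_entry w kw, (t1 <= tm kw)%R
    & (tm kw <= t1 + 4 * d)%R].
  pose P n := exists k, [/\ first_entry (v0 + n) k, (GST S <= tm k)%R & (tm k < t1)%R].
  have [n [[k [fe gk ltk]] nP]] : exists n, P n /\ ~ P n.+1.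
    apply: contrapT => no.
    have allP n : P n.
      elim: n => [|n IH]; first by exists k0; rewrite addn0.
      by apply: contrapT => nP; apply: no; exists n.
    have [K [ltK hK]] := first_after t1.
    (* [M] bounds all views at the first step after [t1], so not every view can be entered before
       [t1]. *)
    pose M := \max_(j < (3 * f).+1) view K j.
    have [k [[_ [j hj]] _ lt]] := allP M.+1.
    have kK : k < K by apply: time_lt_index; apply: lt_trans ltK.
    have : view K j <= M by exact: (bigop.leq_bigmax (F := fun j => view K j) j).
    by move=> le; have := leq_trans hj (leq_trans (view_mono j kK) le);
      rewrite addnS ltnNge leq_addl.
  have [|kw [few le1 le2]] := next_entry _ fe gk; first by rewrite ltn_addr.
  exists (v0 + n).+1, kw; split=> //; first by rewrite ltnS leq_addr.
    rewrite leNgt; apply/negP => lt; apply: nP; exists kw; rewrite addnS; split=> //.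
    exact: le_trans le1.
  lra.
have gkw : (GST S <= tm kw)%R by lra.
have w0 : 0 < w by apply: leq_ltn_trans ltw.
pose X := ((t2 - t1) / d)%R.
have XE : (X * d = t2 - t1)%R by rewrite /X divfK // gt_eqF.
have X26 : (26 <= X)%R by rewrite /X ler_pdivlMr.
(* Blocks of the [N] views from [w] on are committed once view [w + N.+1] is reached. In units of
   [d] this takes 4 to enter [w], [4 * (N + 1)] for the following views and 1 to bring [i] along;
   fitting this into [X] means [N <= (X - 9) / 4]. Rounding down leaves [N > (X - 13) / 4], which is
   at least [X / 8] when [X >= 26]. *)
pose N := Num.truncn ((X - 9) / 4)%R.
have /andP[N1 N2] : (N%:R <= (X - 9) / 4 < N.+1%:R)%R by apply: Num.Theory.truncn_itv; lra.
rewrite -natr1 in N2.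
have [ku [feu leu1 leu2]] := entries w0 few gkw (N.+1).
have endt : (tm ku + d <= t2)%R.
  have h : (N.+1%:R * (4 * d) <= (X - 5) * d)%R.
    have -> : (N.+1%:R * (4 * d) = (4 * N.+1%:R) * d)%R by rewrite mulrA [(_ * 4)%R]mulrC.
    by rewrite ler_pM2r // -natr1; lra.
  rewrite mulrBl XE in h; lra.
have guk : (GST S <= tm ku)%R by lra.
have [k2 [lt2 h2]] := first_after (tm ku + d)%R.
have [lou [ju hju]] := feu.
have vi : w + N.+1 <= view k2 i.
  by apply: (view_sync hju guk _ lt2); apply: first_entry_bound feu _.
have [|bs [u sz hb]] := @distinct_blocks (commits_during E i t1 t2) w N.
  move=> v /andP[l1 l2].
  have [|p [ip pv hv pc]] := happy_committed v0_gt0 fe0 gk0 (leq_trans ltw l1) (w := v)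
    (k := k2) (i := i).
    by apply: leq_trans vi; rewrite addnS.
  exists (p_block p); split=> //.
  have [kv [fev le1 _]] := entries w0 few gkw (v - w); rewrite subnKC // in fev.
  have nb := @not_committed_before v kv (p_block p) i (leq_trans w0 l1) fev hv.
  have [k1 [/andP[l3 l4] nb1 hb1]] := commit_step nb pc.
  exists k1; split=> //; last by apply: le_trans (h2 _ l4) endt.
  by apply: (le_trans lew1); apply: (le_trans le1); apply: time_mono.
exists bs; split=> //; first by move=> b /hb[].
rewrite sz -/X; lra.
Qed.

End Trace.

Local Open Scope ring_scope.

Theorem theorem4 (R : realType) :
  exists c K : R, [/\ 0 < c, 0 < K &
    forall (f : nat) (Payload Hash : eqType) (S : setting R f Payload Hash)
      (E : execution S),
    (0 < f)%N -> setting_ok S ->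
    forall (i : 'I_(3 * f).+1) (t1 t2 : R),
      GST S + 4 * Theta_view S + 4 * delta S < t1 ->
      K * delta S <= t2 - t1 ->
      exists bs : seq (block f Payload Hash),
        [/\ uniq bs,
            forall b, b \in bs -> commits_during E i t1 t2 b
          & c * ((t2 - t1) / delta S) <= (size bs)%:R]].
Proof.
exists 8^-1, 26; split=> [||f Payload Hash S E f0 ok i t1 t2 h1 h2].
- by rewrite invr_gt0.
- by [].
- exact: throughput.
Qed.
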